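(* Let $\mathbb{S}=\{-1,1\}$ or $\mathbb{S}=\{\epsilon\in\mathbb{C}:|\epsilon|=1\}$. Consider the following properties of a separable Banach space $X$. (i) There are an unconditional commuting approximating sequence $\{T_k\}$ for $X$ and a vector space topology $\tau$ on $X$ such that $X$ enjoys $(u(\tau))$ and $T_kx\to x$ in $\tau$ uniformly for $x\in B_X$. (ii) $X$ enjoys $(u(T_k))$ for an unconditional commuting approximating sequence $\{T_k\}$. (iii) $X$ admits unconditional skipped blocking decompositions. (iv) $X$ has the metric unconditional approximation property (umap). Then (iv)$\Rightarrow$(i)$\Leftrightarrow$(ii)$\Rightarrow$(iii). If $X$ has finite cotype, then (iii)$\Rightarrow$(iv).
   Context: $\mathbb{S}=\{-1,1\}$ corresponds to the real and $\mathbb{S}=\{|\epsilon|=1\}$ to the complex version of each notion ($X$ complex in the latter case); the same $\mathbb{S}$ is used throughout. $B_X$ is the unit ball of $X$, $\mathrm{Id}$ the identity, $\operatorname{osc}_{\epsilon\in\mathbb{S}}f(\epsilon)=\sup_{\mathbb{S}}f-\inf_{\mathbb{S}}f$, and for a sequence $\{T_k\}_{k\ge1}$ of operators $\Delta T_k=T_k-T_{k-1}$ with $T_0=0$. An approximating sequence (a.s.) for $X$ is a sequence $\{T_k\}$ of bounded finite-rank operators on $X$ with $\|T_kx-x\|\to0$ for every $x\in X$. It is commuting if the $T_k$ commute with each other. It is unconditional if there is a constant $C$ with $\|\sum_{k=1}^n\epsilon_k\Delta T_k\|\le C$ for all $n$ and $\epsilon_k\in\mathbb{S}$. $X$ has umap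 if for every $\varepsilon>0$ there is an a.s. satisfying this inequality with $C=1+\varepsilon$. $X$ has $(u(\tau))$, for a vector space topology $\tau$ on $X$, if for all $u\in X$ and all norm bounded sequences $\{v_j\}\subseteq X$ with $v_j\to0$ in $\tau$, $\operatorname{osc}_{\epsilon\in\mathbb{S}}\|\epsilon u+v_j\|\to0$. $X$ has $(u(T_k))$, for a commuting a.s. $\{T_k\}$, if for all $\varepsilon>0$ and $n\ge1$ there is $m\ge n$ such that $\operatorname{osc}_{\epsilon\in\mathbb{S}}\|\epsilon x+y\|\le\varepsilon$ for all $x\in T_nB_X$ and $y\in(\mathrm{Id}-T_m)B_X$. $X$ admits unconditional skipped blocking decompositions if for each $\varepsilon>0$ there is an unconditional a.s. $\{S_k\}$ (with $S_0=0$) such that for all $0\le a_1<b_1<a_2<b_2<\cdots$ and all (finitely many) $x_k\in(S_{b_k}-S_{a_k})X$, $\sup_{\epsilon_k\in\mathbb{S}}\|\sum\epsilon_kx_k\|\le(1+\varepsilon)\|\sum x_k\|$. *)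

(* Defs.v *)
From HB Require Import structures.
From mathcomp Require Import all_boot all_order all_algebra.
From mathcomp Require Import all_classical all_reals all_analysis.
From mathcomp Require Import complex.
Set Implicit Arguments.
Unset Strict Implicit.
Unset Printing Implicit Defensive.
Import Order.TTheory GRing.Theory Num.Theory.
Import numFieldTopology.Exports numFieldNormedType.Exports.
Local Open Scope classical_set_scope.
Local Open Scope ring_scope.

Variant scalar_field := RealScalars | ComplexScalars.

Definition scalars (R : realType) (F : scalar_field) : numFieldType :=
  match F with RealScalars => R | ComplexScalars => R[i] end.

Definition real_part (R : realType) (F : scalar_field) : scalars R F -> R :=
  match F with RealScalars => id | ComplexScalars => @complex.Re R end.

(* [`|x|] lives in the scalar field, hence in [R[i]] (where it is a real
   element) over complex scalars; [nrm x] is the same number, as an element of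
   [R]. *)
Definition nrm (R : realType) (F : scalar_field)
    (X : normedModType (scalars R F)) (x : X) : R :=
  real_part `|x|.

Definition real_signs (K : numFieldType) : set K := [set 1; -1].

Definition unit_circle (K : numFieldType) : set K := [set e | `|e| = 1].

Arguments real_signs K : clear implicits.
Arguments unit_circle K : clear implicits.

Definition osc (R : realType) (T : Type) (S : set T) (f : T -> R) : R :=
  sup (f @` S) - inf (f @` S).

Definition separable (T : topologicalType) : Prop :=
  exists2 A : set T, countable A & dense A.

Record topology_on (X : Type) := TopologyOn {
  tau_open : set_system X;
  tau_openT : tau_open setT;
  tau_openI : forall A B, tau_open A -> tau_open B -> tau_open (A `&` B);
  tau_open_bigcup : forall (I : Type) (f : I -> set X),
    (forall i, tau_open (f i)) -> tau_open (\bigcup_i f i) }.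

(* A copy of the vector space [X], carrying the topology [tau] in place of
   whichever topology [X] comes with. *)
Definition with_topology (K : numFieldType) (X : lmodType K)
  (tau : topology_on X) : Type := X.

HB.instance Definition _ (K : numFieldType) (X : lmodType K)
    (tau : topology_on X) :=
  GRing.Lmodule.copy (with_topology tau) X.

HB.instance Definition _ (K : numFieldType) (X : lmodType K)
    (tau : topology_on X) :=
  isOpenTopological.Build (with_topology tau)
    (tau_openT tau) (@tau_openI _ tau) (@tau_open_bigcup _ tau).

Definition vector_space_topology (K : numFieldType) (X : lmodType K)
    (tau : topology_on X) : Prop :=
  let E := with_topology tau in
  continuous (fun z : E * E => z.1 + z.2) /\
  continuous (fun z : K^o * E => z.1 *: z.2).

Section banach.
Variables (R : realType) (F : scalar_field).
Local Notation K := (scalars R F).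
Variables (S : set K) (X : normedModType K).

Definition unit_ball : set X := [set x | nrm x <= 1].

Definition opnorm (f : X -> X) : R := sup [set nrm (f x) | x in unit_ball].

Definition bounded_operator (f : X -> X) : Prop :=
  exists C : R, forall x, nrm (f x) <= C * nrm x.

Definition finite_rank (f : X -> X) : Prop :=
  exists (n : nat) (b : 'I_n -> X),
    forall x, exists c : 'I_n -> K, f x = \sum_(i < n) c i *: b i.

(* The sequence proper is [T 1, T 2, ...]; [T 0] is fixed to be the operator
   [0], so that [Delta T k] needs no special case at [k = 1]. *)
Definition approximating_sequence (T : nat -> {linear X -> X}) : Prop :=
  [/\ forall x, T 0%N x = 0,
      forall k, bounded_operator (T k),
      forall k, finite_rank (T k) &
      forall x, (fun k => nrm (T k x - x)) @ \oo --> (0 : R)].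

Definition commuting (T : nat -> {linear X -> X}) : Prop :=
  forall j k x, T j (T k x) = T k (T j x).

Definition Delta (T : nat -> {linear X -> X}) (k : nat) (x : X) : X :=
  T k x - T k.-1 x.

Definition unconditional_with (C : R) (T : nat -> {linear X -> X}) : Prop :=
  forall (n : nat) (e : nat -> K), (forall k, S (e k)) ->
    opnorm (fun x => \sum_(1 <= k < n.+1) e k *: Delta T k x) <= C.

Definition unconditional (T : nat -> {linear X -> X}) : Prop :=
  exists C : R, unconditional_with C T.

Definition umap : Prop :=
  forall eps : R, 0 < eps ->
    exists T, approximating_sequence T /\ unconditional_with (1 + eps) T.

Definition u_topology (tau : topology_on X) : Prop :=
  forall (u : X) (v : nat -> X),
    (exists M : R, forall j, nrm (v j) <= M) ->
    (v : nat -> with_topology tau) @ \oo --> (0 : with_topology tau) ->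
    (fun j => osc S (fun e => nrm (e *: u + v j))) @ \oo --> (0 : R).

Definition u_sequence (T : nat -> {linear X -> X}) : Prop :=
  forall (eps : R) (n : nat), 0 < eps -> (1 <= n)%N ->
    exists2 m, (n <= m)%N &
      forall x y, (T n @` unit_ball) x ->
        [set z - T m z | z in unit_ball] y ->
        osc S (fun e => nrm (e *: x + y)) <= eps.

Definition tau_uniform_on_ball (tau : topology_on X)
    (T : nat -> {linear X -> X}) : Prop :=
  forall U : set (with_topology tau), nbhs (0 : with_topology tau) U ->
    \forall k \near \oo, forall x, unit_ball x -> U (T k x - x).

Definition admits_u_topology : Prop :=
  exists (T : nat -> {linear X -> X}) (tau : topology_on X),
    [/\ approximating_sequence T, commuting T & unconditional T] /\
    [/\ vector_space_topology tau, u_topology tau & tau_uniform_on_ball tau T].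

Definition admits_u_sequence : Prop :=
  exists T : nat -> {linear X -> X},
    [/\ approximating_sequence T, commuting T, unconditional T &
        u_sequence T].

Definition unconditional_skipped_blocking : Prop :=
  forall eps : R, 0 < eps ->
    exists T : nat -> {linear X -> X},
      [/\ approximating_sequence T, unconditional T &
        forall (a b : nat -> nat), (forall k, (a k < b k < a k.+1)%N) ->
        forall (N : nat) (x : nat -> X),
          (forall k, (k < N)%N -> range (fun z => T (b k) z - T (a k) z) (x k)) ->
          sup [set nrm (\sum_(k < N) e k *: x k)
                | e in [set e : nat -> K | forall k, S (e k)]]
            <= (1 + eps) * nrm (\sum_(k < N) x k)].

(* Rademacher cotype, with quadratic averages: [e] runs through the [2 ^ n]
   choices of signs.  By Kahane's inequality, no other exponent for the averages
   would change the notion. *)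
Definition has_cotype (q : R) : Prop :=
  exists C : R, forall (n : nat) (x : 'I_n -> X),
    (\sum_(i < n) nrm (x i) `^ q) `^ q^-1 <=
    C * Num.sqrt ((2 ^+ n)^-1 *
          \sum_(e : {ffun 'I_n -> bool})
             nrm (\sum_(i < n) (-1) ^+ e i *: x i) ^+ 2).

Definition finite_cotype : Prop := exists2 q : R, 2 <= q & has_cotype q.

End banach.
Arguments umap {R F} S X.
Arguments admits_u_topology {R F} S X.
Arguments admits_u_sequence {R F} S X.
Arguments unconditional_skipped_blocking {R F} S X.
Arguments finite_cotype {R F} X.

(* Main.v *)
(* (i) => (ii): T_n B_X is totally bounded, so (u(tau)) is needed at finitely many
   points only. (ii) => (i): tau is given by the seminorms |T_n x|.

   (ii) => (iii): a small perturbation of a subsequence satisfies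
   S_i S_j = S_min(i,j) for i <> j; (u(T_k)) then allows to change the signs of the
   blocks one after the other.

   (iii) => (iv): R_k is the mean of S_(kN+j) over j < N. Without the increments
   S_(kN+j) - S_(kN+j-1), the j-th sequence yields skipped blocks, and by cotype
   the deleted parts are small in the mean over j.

   (iv) => (ii): umap yields finite rank T_k -> Id with T_q T_p = T_p for p < q and
   Id - 2 T_k almost contractive. For triples c < p < h of indices, products of
   the increments T_p - T_c and T_h - T_p stay bounded when summed over disjoint
   triples (average over signs). Hence, in the mean over many triples, every power
   of T_p acts like T_c, as if T_p were a projection. For projections the powers
   of (Id - 2 T_m)(Id - 2 T_p) grow linearly at z in ker T_m unless T_p z = 0. So
   suitable means W_l of the T_k make |W_l (Id - W_(l+1))| summable, the infinite
   products Q_l = W_l W_(l+1) ... satisfy |Q_l (Id - Q_m)| -> 0 as m -> oo, and the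
   perturbation used in (ii) => (iii) turns them into a commuting sequence. *)

Require Import Defs.
From HB Require Import structures.
From mathcomp Require Import all_boot all_order all_algebra.
From mathcomp Require Import all_classical all_reals all_analysis.
From mathcomp Require Import complex ring lra zify.
Set Implicit Arguments.
Unset Strict Implicit.
Unset Printing Implicit Defensive.
Import Order.TTheory GRing.Theory Num.Theory.
Import numFieldTopology.Exports numFieldNormedType.Exports.
Local Open Scope classical_set_scope.
Local Open Scope ring_scope.

(** * Scalars and norms *)

Section scalars.
Variables (R : realType) (F : scalar_field).
Local Notation K := (scalars R F).

(** The obstacle in (iv) => (ii) is one-sidedness. If f has finite rank, then T_m f -> f in norm,
    because the range of f is finite-dimensional, but f T_m -> f holds in general only pointwise. So
    umap can be corrected to T_q T_p = T_p for p < q ([left_chain]), while T_p T_q = T_p is out of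
    reach until norm convergence of f (Id - T_m) to 0 ([absorbed]) has been gained. The averages W_l
    and their products serve this purpose. The third index h of a triple is there because on vectors
    fixed by T_h the complement Id - T_p is the increment T_h - T_p, and signed sums of increments
    are bounded. The price for a word of length n is a constant that depends on n but not on the
    number N of triples, so n is fixed first and division by N removes the error. The constants 1 +
    2^-j keep words of length L bounded by 2 once their indices are at least L. *)

Definition of_real : R -> K :=
  match F return R -> scalars R F with
  | RealScalars => id | ComplexScalars => real_complex R end.

Definition absr (a : K) : R := real_part `|a|.

Lemma of_realK : cancel of_real (@real_part R F).
Proof. by rewrite /of_real /real_part; case: F. Qed.

Lemma of_realD : {morph of_real : a b / a + b}.
Proof. by rewrite /of_real; case: F => a b //; rewrite rmorphD. Qed.

Lemma of_realM : {morph of_real : a b / a * b}.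
Proof. by rewrite /of_real; case: F => a b //; rewrite rmorphM. Qed.

Lemma of_real0 : of_real 0 = 0.
Proof. by rewrite /of_real; case: F => //; rewrite rmorph0. Qed.

Lemma of_real1 : of_real 1 = 1.
Proof. by rewrite /of_real; case: F => //; rewrite rmorph1. Qed.

Lemma ler_of_real a b : (of_real a <= of_real b) = (a <= b).
Proof. by rewrite /of_real; case: F => //; rewrite lecR. Qed.

Lemma ltr_of_real a b : (of_real a < of_real b) = (a < b).
Proof. by rewrite /of_real; case: F => //; rewrite ltcR. Qed.

Lemma of_real_ge0 (a : K) : 0 <= a -> a = of_real (real_part a).
Proof.
rewrite /of_real /real_part; case: F a => //= -[x y].
by rewrite lecE /= => /andP[/eqP -> _].
Qed.

Lemma norm_of_real (r : R) : `|of_real r| = of_real `|r|.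
Proof.
rewrite /of_real; case: F => //=.
by rewrite normc_def /= expr0n /= addr0 sqrtr_sqr.
Qed.

End scalars.

Section norm.
Variables (R : realType) (F : scalar_field).
Local Notation K := (scalars R F).
Local Notation of_real := (@of_real R F).

Lemma normE (V : normedModType K) (x : V) : `|x| = of_real (nrm x).
Proof. exact/of_real_ge0/normr_ge0. Qed.

Lemma absE (a : K) : `|a| = of_real (absr a).
Proof. exact/of_real_ge0/normr_ge0. Qed.

Variable X : normedModType K.
Implicit Types (x y : X) (a b : K).

Lemma nrm_ge0 x : 0 <= nrm x.
Proof. by rewrite -(@ler_of_real _ F) -normE of_real0 normr_ge0. Qed.

Lemma nrm0 : nrm (0 : X) = 0.
Proof. by rewrite /nrm normr0 -(of_real0 R F) of_realK. Qed.

Lemma nrm_eq0 x : nrm x = 0 -> x = 0.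
Proof. by move=> x0; apply/normr0_eq0; rewrite normE x0 of_real0. Qed.

Lemma nrmD x y : nrm (x + y) <= nrm x + nrm y.
Proof. by rewrite -(@ler_of_real _ F) of_realD -!normE ler_normD. Qed.

Lemma nrmN x : nrm (- x) = nrm x.
Proof. by rewrite /nrm normrN. Qed.

Lemma nrmB x y : nrm (x - y) <= nrm x + nrm y.
Proof. by rewrite -(nrmN y) nrmD. Qed.

Lemma nrm_subC x y : nrm (x - y) = nrm (y - x).
Proof. by rewrite -nrmN opprB. Qed.

Lemma nrmZ a x : nrm (a *: x) = absr a * nrm x.
Proof. by rewrite {1}/nrm normrZ (normE x) absE -of_realM of_realK. Qed.

Lemma nrm_sum (I : Type) (r : seq I) (P : pred I) (f : I -> X) :
  nrm (\sum_(i <- r | P i) f i) <= \sum_(i <- r | P i) nrm (f i).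
Proof.
elim/big_ind2: _ => [|x1 x2 y1 y2 h1 h2|//]; first by rewrite nrm0.
by rewrite (le_trans (nrmD _ _)) // lerD.
Qed.

Lemma nrm_le_dist x y : nrm x <= nrm y + nrm (x - y).
Proof. by rewrite -{1}(subrK y x) addrC nrmD. Qed.

End norm.

Section abs.
Variables (R : realType) (F : scalar_field).
Local Notation K := (scalars R F).
Implicit Types a b : K.

Lemma absr_ge0 a : 0 <= absr a.
Proof. by rewrite -(@ler_of_real _ F) -absE of_real0 normr_ge0. Qed.

Lemma absrM a b : absr (a * b) = absr a * absr b.
Proof. by rewrite {1}/absr normrM !absE -of_realM of_realK. Qed.

Lemma absr0 : absr (0 : K) = 0.
Proof. by rewrite /absr normr0 -(of_real0 R F) of_realK. Qed.

Lemma absr_eq0 a : absr a = 0 -> a = 0.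
Proof. by move=> a0; apply/normr0_eq0; rewrite absE a0 of_real0. Qed.

Lemma absr1 : absr (1 : K) = 1.
Proof. by rewrite /absr normr1 -(of_real1 R F) of_realK. Qed.

Lemma absrN a : absr (- a) = absr a.
Proof. by rewrite /absr normrN. Qed.

Lemma absrD a b : absr (a + b) <= absr a + absr b.
Proof. by rewrite -(@ler_of_real _ F) of_realD -!absE ler_normD. Qed.

Lemma absr_of_real (r : R) : absr (of_real F r) = `|r|.
Proof. by rewrite /absr norm_of_real of_realK. Qed.

Lemma absrV a : absr a^-1 = (absr a)^-1.
Proof.
have [->|a0] := eqVneq a 0; first by rewrite invr0 absr0 invr0.
have b0 : absr a != 0 by apply: contra a0 => /eqP /absr_eq0 ->.
by apply: (mulfI b0); rewrite -absrM !mulfV // absr1.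
Qed.

Lemma absr_nat n : absr (n%:R : K) = n%:R.
Proof.
rewrite /absr normr_nat.
have -> : (n%:R : K) = of_real F n%:R; last by rewrite of_realK.
elim: n => [|n ih]; first by rewrite of_real0.
by rewrite -addn1 !natrD ih of_realD of_real1.
Qed.

End abs.

(** * Null sequences of reals and completeness of the scalar field *)

Section complete.
Variables (R : realType).

(** The one-sided bound suffices for non-negative sequences and makes comparison a matter of upper
    bounds. *)
Definition tends0 (u : nat -> R) : Prop :=
  forall e, 0 < e -> exists N, forall n, (N <= n)%N -> u n <= e.

Lemma tends0P (u : nat -> R) : (forall n, 0 <= u n) ->
  (u @ \oo --> (0 : R)) <-> tends0 u.
Proof.
move=> u0; rewrite cvgrPdist_le; split=> [h e e0|h e e0].
  have [N _ hN] := h e e0; exists N => n Nn.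
  by have := hN n Nn; rewrite /= sub0r normrN ger0_norm.
have [N hN] := h e e0; exists N => // n Nn.
by rewrite /= sub0r normrN ger0_norm //; apply: hN.
Qed.

Lemma tends0_le (u v : nat -> R) :
  (forall n, u n <= v n) -> tends0 v -> tends0 u.
Proof.
move=> uv hv e e0; have [N hN] := hv e e0; exists N => n Nn.
by apply: le_trans (uv n) _; apply: hN.
Qed.

Lemma tends0D (u v : nat -> R) :
  tends0 u -> tends0 v -> tends0 (fun n => u n + v n).
Proof.
move=> hu hv e e0; have e2 : 0 < e / 2 by rewrite divr_gt0.
have [N hN] := hu _ e2; have [M hM] := hv _ e2.
exists (maxn N M) => n; rewrite geq_max => /andP[Nn Mn].
by rewrite [e]splitr lerD ?hN ?hM.
Qed.

Lemma tends0Z (c : R) (u : nat -> R) :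
  tends0 u -> (forall n, 0 <= u n) -> tends0 (fun n => c * u n).
Proof.
move=> hu u0 e e0; have c0 : 0 < `|c| + 1 by rewrite ltr_wpDl.
have [N hN] := hu _ (divr_gt0 e0 c0); exists N => n Nn.
apply: (@le_trans _ _ ((`|c| + 1) * u n)).
  by apply: ler_wpM2r => //; rewrite (le_trans (ler_norm c)) // lerDl.
by rewrite mulrC -ler_pdivlMr // hN.
Qed.

Lemma tends0_sum (I : Type) (r : seq I) (P : pred I) (u : I -> nat -> R) :
  (forall i, P i -> tends0 (u i)) ->
  tends0 (fun n => \sum_(i <- r | P i) u i n).
Proof.
move=> h; elim: r => [|i r ih].
  by move=> e e0; exists 0%N => n _; rewrite big_nil ltW.
have [Pi|nPi] := boolP (P i).
  by apply: tends0_le (tends0D (h i Pi) ih) => n; rewrite big_cons Pi.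
by apply: tends0_le ih => n; rewrite big_cons (negbTE nPi).
Qed.

Lemma tends0_sub (u : nat -> R) (k : nat -> nat) :
  (forall n, (n <= k n)%N) -> tends0 u -> tends0 (u \o k).
Proof.
move=> kn h e e0; have [N hN] := h e e0; exists N => n Nn /=.
by apply: hN; apply: leq_trans (kn n).
Qed.

Lemma tends0_inv : tends0 (fun n => n.+1%:R^-1).
Proof.
move=> e e0; exists (Num.bound e^-1) => n hn.
have h : e^-1 <= n.+1%:R.
  apply: le_trans (ltW (archi_boundP _)) _; first by rewrite invr_ge0 ltW.
  by rewrite ler_nat ltnW.
by rewrite -[leRHS]invrK lef_pV2 // posrE ?invr_gt0 ?ltr0n.
Qed.

Lemma real_complete (u : nat -> R) :
  (forall e, 0 < e -> exists N, forall m n, (N <= m)%N -> (N <= n)%N ->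
     `|u m - u n| <= e) ->
  exists l, tends0 (fun n => `|u n - l|).
Proof.
move=> h; have cu : cvg (u @ \oo).
  apply/cauchy_cvgP/cauchyP => e e0.
  have [N hN] := h (e / 2) ltac:(by rewrite divr_gt0).
  exists (u N); exists N => // n Nn /=.
  rewrite /ball /= /ball_ (le_lt_trans (hN _ _ _ Nn)) //.
  by rewrite ltr_pdivrMr // ltr_pMr // ltr1n.
exists (lim (u @ \oo)).
apply/(tends0P (fun n => normr_ge0 _)).
rewrite -(normr0 R) -(subrr (lim (u @ \oo))).
apply: cvg_norm; apply: cvgB => //; exact: cvg_cst.
Qed.

End complete.

Section scalars_complete.
Variables (R : realType) (F : scalar_field).
Local Notation K := (scalars R F).

Let ReIm_norm (z : R[i]) :
  complex.Re `|z| = Num.sqrt (complex.Re z ^+ 2 + complex.Im z ^+ 2).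
Proof. by case: z => a b; rewrite normc_def. Qed.

Lemma normc_ge_absRe (z : R[i]) : `|complex.Re z| <= complex.Re `|z|.
Proof. by rewrite ReIm_norm -sqrtr_sqr ler_wsqrtr // lerDl sqr_ge0. Qed.

Lemma normc_ge_absIm (z : R[i]) : `|complex.Im z| <= complex.Re `|z|.
Proof. by rewrite ReIm_norm -sqrtr_sqr ler_wsqrtr // lerDr sqr_ge0. Qed.

Lemma normc_le_ReIm (z : R[i]) :
  complex.Re `|z| <= `|complex.Re z| + `|complex.Im z|.
Proof.
rewrite ReIm_norm -[leRHS]ger0_norm ?addr_ge0 // -sqrtr_sqr ler_wsqrtr //.
rewrite sqrrD !real_normK ?num_real // addrAC lerDl.
by rewrite mulrn_wge0 // mulr_ge0.
Qed.

Lemma scalars_complete (u : nat -> K) :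
  (forall e, 0 < e -> exists N, forall m n, (N <= m)%N -> (N <= n)%N ->
     absr (u m - u n) <= e) ->
  exists l : K, tends0 (fun n => absr (u n - l)).
Proof.
rewrite /absr /real_part; case: F u => /= u h; first exact: real_complete.
have sub (z w : R[i]) : complex.Re z - complex.Re w = complex.Re (z - w) /\
    complex.Im z - complex.Im w = complex.Im (z - w).
  by case: z w => p q [r s].
have [|a ha] := @real_complete R (fun n => complex.Re (u n)).
  move=> e e0; have [N hN] := h e e0; exists N => m n Nm Nn.
  by apply: le_trans (hN m n Nm Nn); rewrite (sub _ _).1; apply: normc_ge_absRe.
have [|b hb] := @real_complete R (fun n => complex.Im (u n)).
  move=> e e0; have [N hN] := h e e0; exists N => m n Nm Nn.
  by apply: le_trans (hN m n Nm Nn); rewrite (sub _ _).2; apply: normc_ge_absIm.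
exists (a +i* b)%C; apply: tends0_le (tends0D ha hb) => n.
apply: le_trans (normc_le_ReIm _) _; rewrite -(sub _ _).1 -(sub _ _).2.
exact: lexx.
Qed.

End scalars_complete.

(** * Finite-dimensional subspaces and finite rank operators *)

Section finite_dimension.
Variables (R : realType) (F : scalar_field).
Local Notation K := (scalars R F).
Variable X : normedModType K.

Definition independent (r : nat) (b : nat -> X) : Prop :=
  forall c : nat -> K, \sum_(i < r) c i *: b i = 0 ->
    forall i, (i < r)%N -> c i = 0.

Lemma sum_recr_if (r : nat) (f g : nat -> K) (b : nat -> X) (a : K) (v : X) :
  \sum_(i < r.+1) (if (i < r)%N then f i else a) *:
    (if (i < r)%N then b i else v) = \sum_(i < r) f i *: b i + a *: v.
Proof.
rewrite big_ord_recr /= ltnn; congr (_ + _).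
by apply: eq_bigr => i _; rewrite ltn_ord.
Qed.

(** Induction on [n] through the intersection [V'] of [V] with the span of the first [n] vectors:
    either [V'] is all of [V], or one vector of [V] outside that span completes a basis of [V']. *)
Lemma basis_exists (V : X -> Prop) (n : nat) (b : nat -> X) :
  V 0 -> (forall a x y, V x -> V y -> V (a *: x + y)) ->
  (forall x, V x -> exists c : nat -> K, x = \sum_(i < n) c i *: b i) ->
  exists (r : nat) (g : nat -> X),
    [/\ forall i, (i < r)%N -> V (g i), independent r g &
        forall x, V x -> exists c : nat -> K, x = \sum_(i < r) c i *: g i].
Proof.
elim: n V => [|n ih] V V0 VD Vb.
  by exists 0%N, b.
pose sp x := exists c : nat -> K, x = \sum_(i < n) c i *: b i.
have spD a x y : sp x -> sp y -> sp (a *: x + y).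
  move=> [c ->] [d ->]; exists (fun i => a * c i + d i).
  rewrite scaler_sumr -big_split; apply: eq_bigr => i _ /=.
  by rewrite scalerA scalerDl.
have sp0 : sp 0.
  by exists (fun=> 0); rewrite big1 // => i _; rewrite scale0r.
pose V' x := V x /\ sp x.
have [||x []//|r [g [gV' gi gs]]] := ih V'.
- by [].
- by move=> a x y [Vx sx] [Vy sy]; split; [exact: VD | exact: spD].
have [VV'|] := pselect (forall x, V x -> V' x).
  by exists r, g; split=> // [i /gV'[]//|x /VV' /gs].
move=> /existsNP[v] /not_implyP[Vv nV'v].
have nsv : ~ sp v by move=> sv; apply: nV'v.
have [cv ev] := Vb v Vv; rewrite big_ord_recr /= in ev.
have cvn : cv n != 0.
  apply/eqP => c0; apply: nsv; exists cv.
  by rewrite ev c0 scale0r addr0.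
exists r.+1, (fun i => if (i < r)%N then g i else v); split.
- by move=> i _; case: ifP => // /gV'[].
- move=> c; rewrite big_ord_recr /= ltnn => s0.
  have e1 : \sum_(i < r) c i *: (if (i < r)%N then g i else v) =
      \sum_(i < r) c i *: g i.
    by apply: eq_bigr => i _; rewrite ltn_ord.
  rewrite e1 in s0.
  have cr0 : c r = 0.
    apply/eqP/negP => /negP cr; apply: nsv.
    have -> : v = (- (c r)^-1) *: (\sum_(i < r) c i *: g i) + 0.
      rewrite addr0; apply: (scalerI cr); rewrite scalerA mulrN mulfV //.
      by rewrite scaleN1r; apply/eqP; rewrite -addr_eq0 addrC s0.
    apply: (spD) => //.
    have : forall k, (k <= r)%N -> sp (\sum_(i < k) c i *: g i).
      elim=> [|k ihk] kr; first by rewrite big_ord0.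
      rewrite big_ord_recr /= addrC; apply: (spD); last exact: ihk (ltnW kr).
      by have [] := gV' k kr.
    by apply.
  rewrite cr0 scale0r addr0 in s0.
  move=> i; rewrite ltnS leq_eqVlt => /orP[/eqP->//|ir].
  exact: gi s0 i ir.
- move=> x Vx; have [cx ex] := Vb x Vx; rewrite big_ord_recr /= in ex.
  have [|d ed] := gs (- (cx n / cv n) *: v + x).
    split; first exact: VD.
    exists (fun i => - (cx n / cv n) * cv i + cx i).
    rewrite {1}ev ex scalerDr scalerA addrACA -scalerDl mulNr divfK // addNr.
    rewrite scale0r addr0 scaler_sumr -big_split; apply: eq_bigr => i _ /=.
    by rewrite scalerA scalerDl mulNr.
  exists (fun i => if (i < r)%N then d i else cx n / cv n).
  rewrite (sum_recr_if r d d g) -ed addrAC scaleNr addNr add0r //.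
Qed.

(** Coordinates on a finite-dimensional space are continuous. The induction step needs a positive
    distance from [b r] to the span of its predecessors: vectors of that span approaching [- b r]
    would have Cauchy coordinates, and the limits would give a linear relation. *)
Lemma independent_bound (r : nat) (b : nat -> X) : independent r b ->
  exists2 k, 0 < k & forall (c : nat -> K) i, (i < r)%N ->
    absr (c i) <= k * nrm (\sum_(i < r) c i *: b i).
Proof.
elim: r => [|r ih] bi; first by exists 1.
have [c c0|k k0 hk] := ih.
  move=> i ir; have := bi (fun i => if (i < r)%N then c i else 0).
  rewrite big_ord_recr /= ltnn scale0r addr0.
  have -> : \sum_(i < r) (if (i < r)%N then c i else 0) *: b i =
            \sum_(i < r) c i *: b i.
    by apply: eq_bigr => j _; rewrite ltn_ord.
  by move=> /(_ c0 i (ltnW ir)); rewrite ir.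
have [d d0 hd] : exists2 d, 0 < d & forall c : nat -> K,
    d <= nrm (b r + \sum_(i < r) c i *: b i).
  apply: contrapT => nd.
  have /choice[c hc] : forall n, exists c : nat -> K,
      nrm (b r + \sum_(i < r) c i *: b i) <= n.+1%:R^-1.
    move=> n; apply: contrapT => /forallNP h; apply: nd.
    exists n.+1%:R^-1; first by rewrite invr_gt0.
    by move=> c; rewrite ltW // ltNge; apply/negP/h.
  have lc i : (i < r)%N -> exists l : K, tends0 (fun n => absr (c n i - l)).
    move=> ir; apply: scalars_complete => e e0.
    have [N hN] := @tends0_inv R (e / k / 2) ltac:(by rewrite !divr_gt0).
    exists N => m n Nm Nn.
    have := hk (fun i => c m i - c n i) i ir => /le_trans; apply.
    have -> : \sum_(i < r) (c m i - c n i) *: b i =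
      (b r + \sum_(i < r) c m i *: b i) - (b r + \sum_(i < r) c n i *: b i).
      rewrite opprD addrACA subrr add0r -sumrB.
      by apply: eq_bigr => j _; rewrite scalerBl.
    rewrite mulrC -ler_pdivlMr //; apply: le_trans (nrmB _ _) _.
    by rewrite [leRHS]splitr lerD // (le_trans (hc _)) // hN.
  have /choice[l hl] : forall i, exists l : K,
      (i < r)%N -> tends0 (fun n => absr (c n i - l)).
    move=> i; have [ir|ir] := ltnP i r; last by exists 0.
    by have [l hl] := lc i ir; exists l.
  have z : nrm (b r + \sum_(i < r) l i *: b i) = 0.
    apply/eqP; rewrite eq_le nrm_ge0 andbT; apply/ler_addgt0Pl => e e0.
    rewrite addr0.
    have h1 : tends0 (fun n => \sum_(i < r) nrm (b i) * absr (c n i - l i)).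
      apply: tends0_sum => i _; apply: tends0Z; first exact: hl.
      by move=> n; apply: absr_ge0.
    have [N hN] := tends0D h1 (@tends0_inv R) e0.
    apply: le_trans (hN N (leqnn _)).
    have -> : b r + \sum_(i < r) l i *: b i =
       - \sum_(i < r) (c N i - l i) *: b i +
       (b r + \sum_(i < r) c N i *: b i).
      rewrite addrCA; congr (_ + _); rewrite -sumrN -big_split.
      by apply: eq_bigr => i _ /=; rewrite scalerBl opprB subrK.
    apply: le_trans (nrmD _ _) (lerD _ (hc _)); rewrite nrmN.
    apply: le_trans (nrm_sum _ _ _) _.
    by apply: ler_sum => i _; rewrite nrmZ mulrC.
  have := bi (fun i => if (i < r)%N then l i else 1).
  rewrite big_ord_recr /= ltnn scale1r.
  have -> : \sum_(i < r) (if (i < r)%N then l i else 1) *: b i =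
            \sum_(i < r) l i *: b i.
    by apply: eq_bigr => j _; rewrite ltn_ord.
  rewrite addrC (nrm_eq0 z) => /(_ erefl r (ltnSn r)).
  by rewrite ltnn => /eqP; rewrite oner_eq0.
have hcr (c : nat -> K) :
    absr (c r) <= d^-1 * nrm (\sum_(i < r.+1) c i *: b i).
  have [->|cr] := eqVneq (c r) 0.
    by rewrite absr0 mulr_ge0 ?invr_ge0 ?nrm_ge0 // ltW.
  rewrite ler_pdivlMl // big_ord_recr /= addrC.
  have -> : c r *: b r + \sum_(i < r) c i *: b i =
      c r *: (b r + \sum_(i < r) (c i / c r) *: b i).
    rewrite scalerDr scaler_sumr; congr (_ + _); apply: eq_bigr => i _.
    by rewrite scalerA mulrC divfK.
  by rewrite nrmZ mulrC ler_wpM2l ?absr_ge0 // (hd (fun i => c i / c r)).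
exists (d^-1 + k * (1 + d^-1 * nrm (b r))).
  by rewrite addr_gt0 ?invr_gt0 // mulr_gt0 // ltr_pwDl // mulr_ge0 ?nrm_ge0 //
    invr_ge0 ltW.
move=> c i; have N0 := nrm_ge0 (\sum_(i < r.+1) c i *: b i).
have d'0 : 0 <= d^-1 by rewrite invr_ge0 ltW.
have b0 := nrm_ge0 (b r).
rewrite ltnS leq_eqVlt mulrDl => /orP[/eqP->|ir].
  rewrite (le_trans (hcr c)) // lerDl mulr_ge0 // mulr_ge0 ?ltW //.
  by rewrite ltr_pwDl // mulr_ge0.
have : absr (c i) <= k * ((1 + d^-1 * nrm (b r)) * nrm (\sum_(i < r.+1) c i *: b i)).
  apply: le_trans (hk c i ir) _; rewrite ler_pM2l //.
  have -> : \sum_(i < r) c i *: b i =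
      \sum_(i < r.+1) c i *: b i - c r *: b r.
    by rewrite big_ord_recr /= addrK.
  apply: le_trans (nrmB _ _) _; rewrite mulrDl mul1r lerD2l nrmZ.
  by rewrite mulrAC ler_wpM2r // hcr.
rewrite mulrA => /le_trans; apply.
by rewrite lerDr mulr_ge0.
Qed.

End finite_dimension.

Section operators.
Variables (R : realType) (F : scalar_field).
Local Notation K := (scalars R F).
Variable X : normedModType K.
Implicit Types f g h : X -> X.

Definition bounded_linear f : Prop := linear f /\ bounded_operator f.

Definition finite_operator f : Prop := bounded_linear f /\ finite_rank f.

Definition opbound (c : R) f : Prop := forall x, nrm (f x) <= c * nrm x.

Lemma linD f x y : linear f -> f (x + y) = f x + f y.
Proof. by move=> lf; rewrite -[x in LHS]scale1r lf scale1r. Qed.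

Lemma lin0 f : linear f -> f 0 = 0.
Proof. by move=> lf; apply: (addrI (f 0)); rewrite -linD // !addr0. Qed.

Lemma linZ f a x : linear f -> f (a *: x) = a *: f x.
Proof. by move=> lf; rewrite -[a *: x]addr0 lf lin0 // addr0. Qed.

Lemma linN f x : linear f -> f (- x) = - f x.
Proof. by move=> lf; rewrite -scaleN1r linZ // scaleN1r. Qed.

Lemma linB f x y : linear f -> f (x - y) = f x - f y.
Proof. by move=> lf; rewrite linD // linN. Qed.

Lemma lin_sum f (I : Type) (r : seq I) (P : pred I) (u : I -> X) : linear f ->
  f (\sum_(i <- r | P i) u i) = \sum_(i <- r | P i) f (u i).
Proof.
move=> lf; apply: (big_morph f) => [x y|]; [exact: linD | exact: lin0].
Qed.

Lemma linear_id : linear (fun x : X => x).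
Proof. by []. Qed.

Lemma linear_comp f g : linear f -> linear g -> linear (fun x => f (g x)).
Proof. by move=> lf lg a x y; rewrite lg lf. Qed.

Lemma linear_add f g : linear f -> linear g -> linear (fun x => f x + g x).
Proof. by move=> lf lg a x y; rewrite lf lg scalerDr addrACA. Qed.

Lemma linear_scale a f : linear f -> linear (fun x => a *: f x).
Proof. by move=> lf b x y; rewrite lf scalerDr !scalerA mulrC. Qed.

Lemma linear_opp f : linear f -> linear (fun x => - f x).
Proof. by move=> lf b x y; rewrite lf opprD scalerN. Qed.

Lemma linear_sub f g : linear f -> linear g -> linear (fun x => f x - g x).
Proof. by move=> lf lg; apply/linear_add/linear_opp. Qed.

Lemma linear_zero : linear (fun _ : X => 0 : X).
Proof. by move=> a x y; rewrite scaler0 addr0. Qed.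

Lemma opboundW c d f : c <= d -> opbound c f -> opbound d f.
Proof.
by move=> cd bf x; rewrite (le_trans (bf x)) // ler_wpM2r ?nrm_ge0.
Qed.

Lemma bounded_opbound f : bounded_operator f -> exists2 c, 0 < c & opbound c f.
Proof.
move=> [c bf]; exists (`|c| + 1); first by rewrite ltr_wpDl.
by apply: opboundW bf; rewrite (le_trans (ler_norm c)) // lerDl.
Qed.

Lemma opbound_comp c d f g : 0 <= c -> opbound c f -> opbound d g ->
  opbound (c * d) (fun x => f (g x)).
Proof.
move=> c0 bf bg x; apply: le_trans (bf _) _.
by rewrite -mulrA ler_wpM2l.
Qed.

Lemma opboundD c d f g : opbound c f -> opbound d g ->
  opbound (c + d) (fun x => f x + g x).
Proof.
by move=> bf bg x; rewrite (le_trans (nrmD _ _)) // mulrDl lerD.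
Qed.

Lemma opboundN c f : opbound c f -> opbound c (fun x => - f x).
Proof. by move=> bf x; rewrite nrmN. Qed.

Lemma opboundB c d f g : opbound c f -> opbound d g ->
  opbound (c + d) (fun x => f x - g x).
Proof. by move=> bf bg; apply/opboundD/opboundN. Qed.

Lemma opboundZ a c f : opbound c f ->
  opbound (absr a * c) (fun x => a *: f x).
Proof.
by move=> bf x; rewrite nrmZ -mulrA ler_wpM2l ?absr_ge0.
Qed.

Lemma opbound_id : opbound 1 (fun x : X => x).
Proof. by move=> x; rewrite mul1r. Qed.

Lemma opbound_iter c f k : 0 <= c -> opbound c f -> opbound (c ^+ k) (iter k f).
Proof.
move=> c0 bf; elim: k => [|k ih] x /=; first by rewrite mul1r.
by rewrite exprS; apply: (@opbound_comp c (c ^+ k) f (iter k f)).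
Qed.

Lemma bounded_linear_comp f g : bounded_linear f -> bounded_linear g ->
  bounded_linear (fun x => f (g x)).
Proof.
move=> [lf /bounded_opbound[c c0 bf]] [lg [d bg]]; split.
  exact: linear_comp.
by exists (c * d); apply: opbound_comp => //; apply: ltW.
Qed.

Lemma bounded_linearD f g : bounded_linear f -> bounded_linear g ->
  bounded_linear (fun x => f x + g x).
Proof.
move=> [lf [c bf]] [lg [d bg]]; split; first exact: linear_add.
by exists (c + d); apply: opboundD.
Qed.

Lemma bounded_linearB f g : bounded_linear f -> bounded_linear g ->
  bounded_linear (fun x => f x - g x).
Proof.
move=> [lf [c bf]] [lg [d bg]]; split; first exact: linear_sub.
by exists (c + d); apply: opboundB.
Qed.

Lemma bounded_linear_id : bounded_linear (fun x : X => x).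
Proof. by split; [exact: linear_id | exists 1; exact: opbound_id]. Qed.

Lemma finite_rank_compl f h : linear h -> finite_rank f ->
  finite_rank (fun x => h (f x)).
Proof.
move=> lh [n [b fb]]; exists n, (fun i => h (b i)) => x.
have [c ->] := fb x; exists c; rewrite lin_sum //.
by apply: eq_bigr => i _; rewrite linZ.
Qed.

Lemma finite_rank_compr f h : finite_rank f -> finite_rank (fun x => f (h x)).
Proof. by move=> [n [b fb]]; exists n, b => x; apply: fb. Qed.

Lemma finite_rankD f g : finite_rank f -> finite_rank g ->
  finite_rank (fun x => f x + g x).
Proof.
move=> [n [b fb]] [m [d gd]].
exists (n + m)%N, (fun i => match fintype.split i with inl j => b j | inr j => d j end).
move=> x; have [c1 ->] := fb x; have [c2 ->] := gd x.
exists (fun i => match fintype.split i with inl j => c1 j | inr j => c2 j end).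
rewrite big_split_ord /=; congr (_ + _); apply: eq_bigr => i _.
  by rewrite (unsplitK (inl i)).
by rewrite (unsplitK (inr i)).
Qed.

Lemma finite_rank_zero : finite_rank (fun _ : X => 0 : X).
Proof.
exists 0%N, (fun _ => 0) => x; exists (fun _ => 0); by rewrite big_ord0.
Qed.

Lemma finite_operator_compl f h : bounded_linear h -> finite_operator f ->
  finite_operator (fun x => h (f x)).
Proof.
move=> bh [bf ff]; split; first exact: bounded_linear_comp.
by apply: finite_rank_compl => //; case: bh.
Qed.

Lemma finite_operator_compr f h : bounded_linear h -> finite_operator f ->
  finite_operator (fun x => f (h x)).
Proof.
move=> bh [bf ff]; split; first exact: bounded_linear_comp.
exact: finite_rank_compr.
Qed.

Lemma finite_operatorD f g : finite_operator f -> finite_operator g ->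
  finite_operator (fun x => f x + g x).
Proof.
move=> [bf ff] [bg fg]; split; first exact: bounded_linearD.
exact: finite_rankD.
Qed.

Lemma bounded_linearZ a f : bounded_linear f ->
  bounded_linear (fun x => a *: f x).
Proof.
move=> [lf [c bf]]; split; first exact: linear_scale.
by exists (absr a * c); apply: opboundZ.
Qed.

Lemma finite_operatorZ a f : finite_operator f ->
  finite_operator (fun x => a *: f x).
Proof.
move=> ff; apply: (@finite_operator_compl f (fun x => a *: x)) => //.
exact/bounded_linearZ/bounded_linear_id.
Qed.

Lemma finite_operatorB f g : finite_operator f -> finite_operator g ->
  finite_operator (fun x => f x - g x).
Proof.
move=> ff fg; apply: finite_operatorD => //.
have -> : (fun x => - g x) = (fun x => -1 *: g x).
  by apply/funext => x; rewrite scaleN1r.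
exact: finite_operatorZ.
Qed.

Lemma finite_operator_zero : finite_operator (fun _ : X => 0 : X).
Proof.
split; last exact: finite_rank_zero.
split; first exact: linear_zero.
by exists 0 => x; rewrite nrm0 mul0r.
Qed.

Lemma finite_operator_sum (I : Type) (r : seq I) (P : pred I) (f : I -> X -> X) :
  (forall i, finite_operator (f i)) ->
  finite_operator (fun x => \sum_(i <- r | P i) f i x).
Proof.
move=> ff; elim: r => [|i r ih].
  have -> : (fun x => \sum_(i <- [::] | P i) f i x) = (fun _ : X => 0 : X).
    by apply/funext => x; rewrite big_nil.
  exact: finite_operator_zero.
have [Pi|Pi] := boolP (P i); last first.
  congr (finite_operator _): ih; apply/funext => x.
  by rewrite big_cons (negbTE Pi).
have := finite_operatorD (ff i) ih; congr (finite_operator _).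
by apply/funext => x; rewrite big_cons Pi.
Qed.

(** The coordinates with respect to a basis of the range are bounded by [nrm (f x)], not merely by
    [nrm x]. Operators built from them are dominated by [f] and inherit its absorption. *)
Lemma finite_operator_factor f : finite_operator f ->
  exists (r : nat) (b g : nat -> X) (c : nat -> X -> K) (k : R),
  [/\ 0 < k, independent r b,
      forall x, f x = \sum_(i < r) c i x *: b i,
      forall i, (i < r)%N -> f (g i) = b i &
      forall i, (i < r)%N ->
        (forall a x y, c i (a *: x + y) = a * c i x + c i y) /\
        (forall x, absr (c i x) <= k * nrm (f x))].
Proof.
move=> [[lf _] [n [b' fb']]].
pose V x := exists y, x = f y.
have [|||r [b [bV bi bs]]] := @basis_exists R F X V n
    (fun i => match insub i with Some j => b' j | None => 0 end).
- by exists 0; rewrite lin0.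
- by move=> a x y [x' ->] [y' ->]; exists (a *: x' + y'); rewrite lf.
- move=> x [y ->]; have [c ->] := fb' y.
  exists (fun i => match insub i with Some j => c j | None => 0 end).
  by apply: eq_bigr => i _; rewrite valK.
have [k k0 hk] := independent_bound bi.
have /choice[g hg] : forall i, exists y, (i < r)%N -> f y = b i.
  move=> i; have [ir|ir] := ltnP i r; last by exists 0.
  by have [y ->] := bV i ir; exists y.
have /choice[c hc] : forall x, exists c : nat -> K,
    f x = \sum_(i < r) c i *: b i by move=> x; apply: bs; exists x.
exists r, b, g, (fun i x => c x i), k; split=> // i ir; split=> [a x y|x].
  symmetry; apply/eqP; rewrite -subr_eq0; apply/eqP.
  apply: (bi (fun i => a * c x i + c y i - c (a *: x + y) i)) ir.
  transitivity (a *: f x + f y - f (a *: x + y)); last by rewrite lf subrr.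
  rewrite !hc scaler_sumr -big_split -sumrB; apply: eq_bigr => j _ /=.
  by rewrite scalerBl scalerDl scalerA.
by rewrite hc; apply: hk.
Qed.

End operators.

(** * Perturbation to a commuting chain *)

Section perturbation.
Variables (R : realType) (F : scalar_field).
Local Notation K := (scalars R F).
Variable X : normedModType K.
Implicit Types f g h S P Q : X -> X.
Implicit Types T : nat -> X -> X.

Definition strongly_to_id T : Prop :=
  forall x, tends0 (fun m => nrm (T m x - x)).

Definition absorbed T f : Prop :=
  forall e, 0 < e -> exists N, forall m, (N <= m)%N ->
    opbound e (fun x => f (x - T m x)).

(** Convergence at the finitely many basis vectors of the range is uniform on the ball, since the
    coordinates are bounded. *)
Lemma finite_operator_uniform T f : finite_operator f ->
  (forall m, linear (T m)) -> strongly_to_id T ->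
  forall e, 0 < e -> exists N, forall m, (N <= m)%N ->
    opbound e (fun x => T m (f x) - f x).
Proof.
move=> ff lT TI e e0.
have [r [b [g [c [k [k0 _ fE _ cP]]]]]] := finite_operator_factor ff.
have [[lf /bounded_opbound[d d0 bf]] _] := ff.
have h : tends0 (fun m => \sum_(i < r) k * d * nrm (T m (b i) - b i)).
  apply: tends0_sum => i _; apply: tends0Z; first exact: TI.
  by move=> n; apply: nrm_ge0.
have [N hN] := h e e0; exists N => m Nm x.
have -> : T m (f x) - f x = \sum_(i < r) c i x *: (T m (b i) - b i).
  rewrite fE lin_sum // -sumrB; apply: eq_bigr => i _.
  by rewrite linZ // scalerBr.
apply: le_trans (nrm_sum _ _ _) _.
apply: le_trans (_ : \sum_(i < r) k * d * nrm (T m (b i) - b i) * nrm x <= _).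
  apply: ler_sum => i _; rewrite nrmZ mulrAC ler_wpM2r ?nrm_ge0 //.
  have [_ /(_ x) h1] := cP i (ltn_ord i).
  by rewrite (le_trans h1) // -mulrA ler_wpM2l ?bf // ltW.
by rewrite -mulr_suml ler_wpM2r ?nrm_ge0 // hN.
Qed.

Lemma absorbed_dominated T f g c : linear f -> 
  (forall x, nrm (f x) <= c * nrm (g x)) -> absorbed T g -> absorbed T f.
Proof.
move=> lf fg ag e e0; have c0 : 0 < `|c| + 1 by rewrite ltr_wpDl.
have [N hN] := ag _ (divr_gt0 e0 c0); exists N => m Nm x.
apply: le_trans (fg _) _.
apply: le_trans (_ : (`|c| + 1) * nrm (g (x - T m x)) <= _).
  by rewrite ler_wpM2r ?nrm_ge0 // (le_trans (ler_norm c)) // lerDl.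
by rewrite -ler_pdivlMl // mulrA [_^-1 * e]mulrC hN.
Qed.

Lemma absorbed_compl T f h : bounded_linear h -> linear f -> absorbed T f ->
  absorbed T (fun x => h (f x)).
Proof.
move=> [lh [c bh]] lf; apply: (@absorbed_dominated _ _ _ c) => //.
exact: linear_comp.
Qed.

Lemma absorbedD T f g : absorbed T f -> absorbed T g ->
  absorbed T (fun x => f x + g x).
Proof.
move=> af ag e e0; have e2 : 0 < e / 2 by rewrite divr_gt0.
have [N hN] := af _ e2; have [M hM] := ag _ e2.
exists (maxn N M) => n; rewrite geq_max => /andP[Nn Mn].
by have := opboundD (hN n Nn) (hM n Mn); rewrite -splitr.
Qed.

Lemma absorbedN T f : absorbed T f -> absorbed T (fun x => - f x).
Proof.
move=> af e e0; have [N hN] := af e e0; exists N => m Nm.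
by apply/opboundN/hN.
Qed.

Lemma absorbedB T f g : absorbed T f -> absorbed T g ->
  absorbed T (fun x => f x - g x).
Proof. by move=> af ag; apply/absorbedD/absorbedN. Qed.

(** [Q] lifts the range of [f] through preimages of a basis. Its domination by [f] makes [Q]
    absorbed whenever [f] is. *)
Lemma right_identity f : finite_operator f ->
  exists Q c, [/\ finite_operator Q, forall x, f (Q x) = f x &
                  forall x, nrm (Q x) <= c * nrm (f x)].
Proof.
move=> ff; have [r [b [g [c [k [k0 _ fE fg cP]]]]]] := finite_operator_factor ff.
have [[lf [d bf]] _] := ff.
pose Q x := \sum_(i < r) c i x *: g i.
pose q := \sum_(i < r) k * nrm (g i).
have Qb x : nrm (Q x) <= q * nrm (f x).
  rewrite mulr_suml; apply: le_trans (nrm_sum _ _ _) _.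
  apply: ler_sum => i _; rewrite nrmZ mulrAC ler_wpM2r ?nrm_ge0 //.
  by have [_ ->] := cP i (ltn_ord i).
have q0 : 0 <= q by apply: sumr_ge0 => i _; rewrite mulr_ge0 ?nrm_ge0 // ltW.
exists Q, q; split=> // [|x]; last first.
  rewrite lin_sum // [RHS]fE; apply: eq_bigr => i _.
  by rewrite linZ // fg.
split; last by exists r, (fun i => g i) => x; exists (fun i => c i x).
split; last first.
  exists (q * d) => x; apply: le_trans (Qb x) _.
  by rewrite -mulrA ler_wpM2l.
move=> a x y; rewrite scaler_sumr -big_split; apply: eq_bigr => i _ /=.
by have [-> _] := cP i (ltn_ord i); rewrite scalerDl scalerA.
Qed.

(** [P] is a projection onto the range of [f] whose coordinate functionals are combinations of those
    of a single [T k]. This takes the place of the Hahn-Banach theorem, and domination by [T k]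
    makes [P] absorbed once [T k] is. *)
Lemma left_identity T f : finite_operator f ->
  (forall m, finite_operator (T m)) -> strongly_to_id T ->
  exists P k c, [/\ finite_operator P, forall x, P (f x) = f x &
                  forall x, nrm (P x) <= c * nrm (T k x)].
Proof.
move=> ff fT TI.
have [r [b [g [c [k [k0 bi fE fg cP]]]]]] := finite_operator_factor ff.
have lT m : linear (T m) by have [[]] := fT m.
(* For large [m] the operator [T m] is within 1/2 of the identity on the range of [f], hence
   injective there. *)
have [d d0 [m hm]] : exists2 d, d < 1 & exists m, forall u : nat -> K,
    nrm (T m (\sum_(i < r) u i *: b i) - \sum_(i < r) u i *: b i) <=
    d * nrm (\sum_(i < r) u i *: b i).
  have [k' k'0 hk'] := independent_bound bi.
  have h : tends0 (fun m => \sum_(i < r) k' * nrm (T m (b i) - b i)).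
    apply: tends0_sum => i _; apply: tends0Z; first exact: TI.
    by move=> n; apply: nrm_ge0.
  have [m hm] := h (1 / 2) ltac:(by rewrite divr_gt0).
  exists (1 / 2); first by rewrite ltr_pdivrMr // mul1r ltr1n.
  exists m => u; set v := \sum_(i < r) _.
  have -> : T m v - v = \sum_(i < r) u i *: (T m (b i) - b i).
    rewrite /v lin_sum // -sumrB; apply: eq_bigr => i _.
    by rewrite linZ // scalerBr.
  apply: le_trans (nrm_sum _ _ _) _.
  apply: le_trans (_ : \sum_(i < r) k' * nrm (T m (b i) - b i) * nrm v <= _).
    apply: ler_sum => i _; rewrite nrmZ mulrAC ler_wpM2r ?nrm_ge0 //.
    exact: hk'.
  by rewrite -mulr_suml ler_wpM2r ?nrm_ge0 // hm.
have [s [p [_ [q [k2 [k20 _ TE _ qP]]]]]] := finite_operator_factor (fT m).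
have [_ [w bTm]] := (fT m).1.
pose A : 'M[K]_(r, s) := \matrix_(j, l) q l (b j).
have qlin i (u : nat -> K) n : (i < s)%N ->
    q i (\sum_(j < n) u j *: b j) = \sum_(j < n) u j * q i (b j).
  move=> si; have [ql _] := qP i si.
  have q0 : q i 0 = 0.
    have := ql 1 0 0; rewrite scale1r addr0 mul1r => e.
    by apply: (addrI (q i 0)); rewrite -e addr0.
  elim: n => [|n ih]; first by rewrite !big_ord0.
  by rewrite !big_ord_recr /= addrC ql ih addrC.
(* Row [j] lists the coordinates of [T m (b j)], so a vanishing combination of rows is a vector in
   the range of [f] killed by [T m]. *)
have A_free : row_free A.
  apply: inj_row_free => v vA0.
  pose u (i : nat) : K := match insub i with Some j => v 0 j | None => 0 end.
  have uE (i : 'I_r) : u i = v 0 i by rewrite /u valK.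
  pose y := \sum_(i < r) u i *: b i.
  have qy i : (i < s)%N -> q i y = 0.
    move=> si; rewrite qlin //.
    have /matrixP/(_ 0 (Ordinal si)) := vA0; rewrite !mxE => h; rewrite -[RHS]h.
    by apply: eq_bigr => j _; rewrite uE mxE.
  have Ty : T m y = 0 by rewrite TE big1 // => i _; rewrite qy // scale0r.
  have y0 : y = 0.
    apply: nrm_eq0; have := hm u; rewrite -/y Ty sub0r nrmN.
    have := nrm_ge0 y; rewrite le_eqVlt => /orP[/eqP<- //|yp].
    by rewrite ler_pMl // leNgt d0.
  by apply/rowP => j; rewrite !mxE -uE; apply: bi y0 j (ltn_ord j).
(* The right inverse of [A] turns the coordinates of [T m] into functionals biorthogonal to [b]. *)
pose M := pinvmx A.
pose e (i : 'I_r) x := \sum_(l < s) q l x * M l i.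
have eb (i j : 'I_r) : e i (b j) = (j == i)%:R.
  have /matrixP/(_ j i) := mulmxVp A_free; rewrite !mxE => <-.
  by rewrite /e; apply: eq_bigr => l _; rewrite ?mxE.
pose P x := \sum_(i < r) e i x *: b i.
have lP : linear P.
  move=> a x y; rewrite scaler_sumr -big_split; apply: eq_bigr => i _ /=.
  rewrite scalerA -scalerDl; congr (_ *: _).
  rewrite mulr_sumr -big_split; apply: eq_bigr => l _ /=.
  by have [-> _] := qP l (ltn_ord l); rewrite mulrDl mulrA.
pose z := \sum_(i < r) (\sum_(l < s) k2 * absr (M l i)) * nrm (b i).
have z0 : 0 <= z.
  apply: sumr_ge0 => i _; rewrite mulr_ge0 ?nrm_ge0 // sumr_ge0 // => l _.
  by rewrite mulr_ge0 ?absr_ge0 // ltW.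
have Pb x : nrm (P x) <= z * nrm (T m x).
  rewrite mulr_suml; apply: le_trans (nrm_sum _ _ _) _.
  apply: ler_sum => i _; rewrite nrmZ mulrAC ler_wpM2r ?nrm_ge0 //.
  rewrite mulr_suml.
  have abs_sum n (f' : 'I_n ->
    K) : absr (\sum_(l < n) f' l) <= \sum_(l < n) absr (f' l).
    elim/big_ind2: _ => [|x1 x2 y1 y2 h1 h2|//]; first by rewrite absr0.
    by rewrite (le_trans (absrD _ _)) // lerD.
  apply: le_trans (abs_sum _ _) _; apply: ler_sum => l _.
  rewrite absrM mulrAC ler_wpM2r ?absr_ge0 //.
  by have [_ ->] := qP l (ltn_ord l).
exists P, m, z; split=> // [|x].
  split; last by exists r, (fun i => b i) => x; exists (fun i => e i x).
  split=> //; exists (z * w) => x; apply: le_trans (Pb x) _.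
  by rewrite -mulrA ler_wpM2l.
have Pbi (j : 'I_r) : P (b j) = b j.
  rewrite /P (bigD1 j) //= eb eqxx scale1r big1 ?addr0 // => i ij.
  by rewrite eb eq_sym (negbTE ij) scale0r.
rewrite (fE x) lin_sum //; apply: eq_bigr => i _.
by rewrite linZ // Pbi.
Qed.

Section step.
Variable T : nat -> X -> X.
Hypotheses (fT : forall m, finite_operator (T m)) (TI : strongly_to_id T).

(** [g] is T m + (Id - T m) P, where [P] fixes the range of [f]; the second summand is small because
    T m -> Id uniformly on the finite-dimensional range of [P]. It serves [umap_left_chain], where
    absorption is not yet available. *)
Lemma left_perturbation f th M : finite_operator f -> 0 < th ->
  exists m g, [/\ (M <= m)%N, finite_operator g, forall x, g (f x) = f x &
    opbound th (fun x => g x - T m x)].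
Proof.
move=> ff th0; have [P [k [c [fP Pf _]]]] := left_identity ff fT TI.
have lT m : linear (T m) by have [[]] := fT m.
have [N hN] := finite_operator_uniform fP lT TI th0.
exists (maxn M N), (fun x => T (maxn M N) x + (P x - T (maxn M N) (P x))).
split=> [|| x | x]; first exact: leq_maxl.
- apply/finite_operatorD/finite_operatorB => //.
  by apply: finite_operator_compl fP; have [] := fT (maxn M N).
- by rewrite Pf addrC subrK.
- by rewrite addrAC subrr add0r nrm_subC; apply/hN/leq_maxr.
Qed.

Hypothesis aT : forall n, absorbed T (T n).

(* [g = T1 + Q (Id - T1)] with [T1 = T m + (Id - T m) P], where [P] is a left
   and [Q] a right identity for [f]. *)
Lemma perturbation f th M : finite_operator f -> absorbed T f -> 0 < th ->
  exists m g, [/\ (M <= m)%N, finite_operator g, absorbed T g,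
    (forall x, g (f x) = f x) /\ (forall x, f (g x) = f x) &
    opbound th (fun x => g x - T m x)].
Proof.
move=> ff af th0; have [P [k [c [fP Pf Pk]]]] := left_identity ff fT TI.
have [Q [d [fQ Qf Qd]]] := right_identity ff.
have lT m : linear (T m) by have [[]] := fT m.
have lP : linear P by case: fP => -[].
have lQ : linear Q by case: fQ => -[].
have lf : linear f by case: ff => -[].
have aQ : absorbed T Q by apply: absorbed_dominated Qd _.
have aP : absorbed T P by apply: absorbed_dominated Pk _.
have [p p0 bP] := bounded_opbound fP.1.2.
have p1 : 0 < 1 + p by rewrite ltr_wpDr // ltW.
have th2 : 0 < th / 2 by rewrite divr_gt0.
have [N1 hN1] := finite_operator_uniform fP lT TI th2.
have [N2 hN2] := aQ _ (divr_gt0 th2 p1).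
pose m := maxn M (maxn N1 N2).
have [Mm N1m N2m] : [/\ (M <= m)%N, (N1 <= m)%N & (N2 <= m)%N].
  by split; rewrite !leq_max leqnn ?orbT.
pose T1 x := T m x + (P x - T m (P x)).
have bTm : bounded_linear (T m) by have [] := fT m.
have fT1 : finite_operator T1.
  by apply/finite_operatorD/finite_operatorB => //; apply: finite_operator_compl.
have aT1 : absorbed T T1.
  by apply/absorbedD/absorbedB => //; apply: absorbed_compl.
have lT1 : linear T1 by case: fT1 => -[].
have T1f x : T1 (f x) = f x by rewrite /T1 Pf addrC subrK.
exists m, (fun x => T1 x + Q (x - T1 x)); split=> //.
- apply: finite_operatorD => //;
  apply: (@finite_operator_compr _ _ _ Q (fun x => x - T1 x)) => //.
  by apply: bounded_linearB; [exact: bounded_linear_id | case: fT1].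
- apply: absorbedD => //.
  have -> : (fun x => Q (x - T1 x)) = (fun x => Q x - Q (T1 x)).
    by apply/funext => x; rewrite linB.
  by apply: absorbedB => //; apply: absorbed_compl => //; case: fQ.
- split=> x; first by rewrite T1f subrr lin0 // addr0.
  by rewrite linD // Qf linB // addrC subrK.
(* Since Id - T1 = (Id - T m)(Id - P), the term with [Q] is Q (Id - T m)(Id - P), which is small
   because [Q] is absorbed. *)
- have e x : T1 x + Q (x - T1 x) - T m x =
      (P x - T m (P x)) + Q ((x - P x) - T m (x - P x)).
    have -> : x - P x - T m (x - P x) = x - T1 x.
      by rewrite /T1 linB // !opprD !opprK -addrA [- P x + _]addrCA.
    by rewrite addrAC {1}/T1 [T m x + _]addrC addrK.
  move=> x; rewrite e; apply: le_trans (nrmD _ _) _.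
  rewrite [th]splitr mulrDl; apply: lerD.
    by rewrite nrm_subC; apply: hN1.
  apply: le_trans (hN2 _ N2m _) _; rewrite -[leRHS]mulrA -[leLHS]mulrA.
  rewrite -[leLHS]mulrA !ler_pM2l ?invr_gt0 //.
  rewrite ler_pdivrMl //; apply: le_trans (nrmB _ _) _.
  by rewrite mulrDl mul1r lerD2l bP.
Qed.

(** Each operator arises from its predecessor alone. The relations with earlier ones propagate: for
    i < j, S_i S_(j+1) = S_i S_j S_(j+1) = S_i S_j = S_i, and similarly on the other side. The S_j
    need not be projections. *)
Lemma perturbed_chain (th : nat -> R) : (forall j, 0 < th j) ->
  exists (n : nat -> nat) (S : nat -> X -> X),
  [/\ n 0%N = 0%N /\ forall j, (n j < n j.+1)%N, forall j, finite_operator (S j),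
      forall x, S 0%N x = 0,
      forall i j x, (i < j)%N -> S j (S i x) = S i x /\ S i (S j x) = S i x &
      forall j, (0 < j)%N -> opbound (th j) (fun x => S j x - T (n j) x)].
Proof.
move=> th0.
have /choice[st hst] : forall js : nat * (nat * (X -> X)),
    exists ng : nat * (X -> X), finite_operator js.2.2 -> absorbed T js.2.2 ->
    [/\ (js.2.1 < ng.1)%N, finite_operator ng.2, absorbed T ng.2,
      (forall x, ng.2 (js.2.2 x) = js.2.2 x) /\
      (forall x, js.2.2 (ng.2 x) = js.2.2 x) &
      opbound (th js.1) (fun x => ng.2 x - T ng.1 x)].
  move=> [j [n f]] /=.
  (* Default values outside the domain of [perturbation]; by [sP] the recursion never reaches
     them. *)
  have [ff|] := pselect (finite_operator f); last by exists (0%N, f).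
  have [af|] := pselect (absorbed T f); last by exists (0%N, f).
  have [m [g hg]] := perturbation n.+1 ff af (th0 j).
  by exists (m, g).
pose s := fix s j := match j with 0%N => (0%N, fun _ : X => 0 : X)
                      | j'.+1 => st (j, s j') end.
have sP j : finite_operator (s j).2 /\ absorbed T (s j).2.
  elim: j => [|j [ih1 ih2]] /=; last by have [] := hst (j.+1, s j) ih1 ih2.
  split; first exact: finite_operator_zero.
  by move=> e e0; exists 0%N => m _ x; rewrite nrm0 mulr_ge0 ?nrm_ge0 // ltW.
have sS j := hst (j.+1, s j) (sP j).1 (sP j).2.
exists (fun j => (s j).1), (fun j => (s j).2); split=> //.
- by split=> // j; have [] := sS j.
- by move=> j; have [] := sP j.
- move=> i j + ij; elim: j ij => // j ih; rewrite ltnS leq_eqVlt => /orP[/eqP->|ij] x.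
    by have [_ _ _ [h1 h2] _] := sS j.
  have [_ _ _ [h1 h2] _] := sS j; have [i1 _] := ih ij x.
  split; first by rewrite -{1}i1 h1 i1.
  have [_ i2] := ih ij x; have [_ i3] := ih ij ((s j.+1).2 x).
  by rewrite -i3 h2 i2.
- by case=> // j _; have [] := sS j.
Qed.

End step.
End perturbation.

(** * Approximating sequences *)

Section interface.
Variables (R : realType) (F : scalar_field).
Local Notation K := (scalars R F).
Variables (S : set K).

(** What the real and the complex case have in common: a multiplicative group of unimodular scalars
    containing -1. *)
Definition sign_group : Prop :=
  [/\ S 1, S (-1), forall e, S e -> absr e = 1,
      forall e f, S e -> S f -> S (e * f) & forall e, S e -> S e^-1].

Lemma sign_groupP :
  S = real_signs K \/ F = ComplexScalars /\ S = unit_circle K -> sign_group.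
Proof.
rewrite /sign_group; case=> [->|[_ ->]].
  split; [by left|by right| | |].
  - by move=> e [->|->]; rewrite ?absrN absr1.
  - move=> e f [->|->] [->|->]; rewrite ?mulrNN ?mul1r ?mulr1; by [left|right].
  - by move=> e [->|->]; rewrite ?invrN invr1; [left|right].
have aP (e : K) : unit_circle K e <-> absr e = 1.
  rewrite /unit_circle /= absE -(of_real1 R F).
  split=> [h|-> //]; exact: (can_inj (@of_realK R F)).
split; [apply/aP; exact: absr1|by apply/aP; rewrite absrN absr1| | |].
- by move=> e /aP.
- by move=> e f /aP e1 /aP f1; apply/aP; rewrite absrM e1 f1 mulr1.
- by move=> e /aP e1; apply/aP; rewrite absrV e1 invr1.
Qed.

Variable X : normedModType K.

Definition linear_pack (f : X -> X) (lf : linear f) : {linear X -> X} :=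
  HB.pack f (GRing.isLinear.Build _ _ _ _ f lf).

Lemma linear_seq (f : nat -> X -> X) : (forall k, linear (f k)) ->
  exists T : nat -> {linear X -> X}, forall k, T k =1 f k.
Proof. by move=> lf; exists (fun k => linear_pack (lf k)). Qed.

Lemma linear_fun_linear (f : {linear X -> X}) : linear f.
Proof. exact: linearP. Qed.

Lemma has_sup_opnorm (f : X -> X) : bounded_operator f ->
  has_sup [set nrm (f x) | x in @unit_ball R F X].
Proof.
move=> /bounded_opbound[c c0 bf]; split.
  by exists (nrm (f 0)), 0 => //; rewrite /unit_ball /= nrm0.
exists c => _ [x x1 <-]; apply: le_trans (bf x) _.
by rewrite -[leRHS]mulr1 ler_wpM2l // ltW.
Qed.

Lemma opnorm_bound (f : X -> X) : bounded_linear f -> opbound (opnorm f) f.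
Proof.
move=> [lf bf] x; have [x0|x0] := eqVneq (nrm x) 0.
  by rewrite x0 mulr0 (nrm_eq0 x0) lin0 // nrm0.
have xp : 0 < nrm x by rewrite lt_neqAle eq_sym x0 nrm_ge0.
rewrite -ler_pdivrMr // mulrC; have [_ ub] := has_sup_opnorm bf.
apply: (ub_le_sup ub); exists (of_real F (nrm x)^-1 *: x).
  rewrite /unit_ball /= nrmZ absr_of_real ger0_norm ?invr_ge0 ?nrm_ge0 //.
  by rewrite mulVf.
by rewrite linZ // nrmZ absr_of_real ger0_norm ?invr_ge0 ?nrm_ge0.
Qed.

Lemma opnorm_le c (f : X -> X) : 0 <= c -> opbound c f -> opnorm f <= c.
Proof.
move=> c0 bf; apply: ge_sup.
  by exists (nrm (f 0)), 0 => //; rewrite /unit_ball /= nrm0.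
move=> _ [x x1 <-]; apply: le_trans (bf x) _.
by rewrite -[leRHS]mulr1 ler_wpM2l.
Qed.

Definition signed_sum (T : nat -> X -> X) (e : nat -> K) (n : nat) (x : X) : X :=
  \sum_(k < n) e k.+1 *: (T k.+1 x - T k x).

Definition unconditional_bound (C : R) (T : nat -> X -> X) : Prop :=
  forall n e, (forall k, S (e k)) -> opbound C (signed_sum T e n).

Lemma signed_sumE (T : nat -> {linear X -> X}) e n x :
  \sum_(1 <= k < n.+1) e k *: Delta T k x = signed_sum T e n x.
Proof. by rewrite big_add1 big_mkord. Qed.

Lemma bounded_linear_signed_sum (T : nat -> X -> X) e n :
  (forall k, bounded_linear (T k)) -> bounded_linear (signed_sum T e n).
Proof.
move=> bT; elim: n => [|n ih].
  have -> : signed_sum T e 0 = (fun _ : X => 0 : X).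
    by apply/funext => x; rewrite /signed_sum big_ord0.
  by have [] := @finite_operator_zero R F X.
have -> : signed_sum T e n.+1 =
    (fun x => signed_sum T e n x + e n.+1 *: (T n.+1 x - T n x)).
  by apply/funext => x; rewrite /signed_sum big_ord_recr.
by apply/bounded_linearD/bounded_linearZ/bounded_linearB.
Qed.

Lemma approximating_sequenceP (T : nat -> {linear X -> X}) :
  approximating_sequence T <->
  [/\ forall x, T 0%N x = 0, forall k, finite_operator (T k) &
      strongly_to_id (fun k => T k : X -> X)].
Proof.
split=> [[T0 bT fT TI]|[T0 fT TI]].
  split=> // [k|x]; first by split=> //; split=> //; exact: linear_fun_linear.
  by apply/tends0P => // n; apply: nrm_ge0.
split=> // [k|k|x]; [by case: (fT k) => -[]|by case: (fT k)|].
by apply/tends0P => [n|]; [apply: nrm_ge0|apply: TI].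
Qed.

Lemma unconditional_withP C (T : nat -> {linear X -> X}) : sign_group ->
  (forall k, bounded_linear (T k)) ->
  unconditional_with S C T <-> 0 <= C /\ unconditional_bound C (fun k => T k : X -> X).
Proof.
move=> [S1 _ _ _ _] bT.
have E n (e : nat -> K) : (fun x => \sum_(1 <= k < n.+1) e k *: Delta T k x) =
    signed_sum (fun k => T k) e n.
  by apply/funext => x; apply: signed_sumE.
split=> [h|[C0 h] n e Se]; last by rewrite E; apply: opnorm_le => //; apply: h.
have C0 : 0 <= C.
  apply: le_trans (h 0%N (fun=> 1) (fun=> S1)); rewrite E.
  have [_ ub] := has_sup_opnorm (bounded_linear_signed_sum (fun=> 1) 0 bT).2.
  apply: (ub_le_sup ub); exists 0; first by rewrite /unit_ball /= nrm0.
  by rewrite /signed_sum big_ord0 nrm0.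
split=> // n e Se; apply: (@opboundW _ _ _ (opnorm (signed_sum (fun k => T k) e n))).
  by rewrite -E; apply: h.
exact/opnorm_bound/bounded_linear_signed_sum.
Qed.

Lemma signed_sum1 (T : nat -> X -> X) n x : (forall y, T 0%N y = 0) ->
  signed_sum T (fun=> 1) n x = T n x.
Proof.
move=> T0; rewrite /signed_sum.
under eq_bigr do rewrite scale1r.
by rewrite -(big_mkord xpredT (fun k => T k.+1 x - T k x)) telescope_sumr // T0 subr0.
Qed.

Lemma signed_sum_cat (T : nat -> X -> X) e th n m x :
  signed_sum T (fun k => if (k <= n)%N then e k else th) (n + m) x =
  signed_sum T e n x + th *: (T (n + m)%N x - T n x).
Proof.
rewrite /signed_sum big_split_ord /=; congr (_ + _).
  by apply: eq_bigr => k _; rewrite ltn_ord.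
have -> : T (n + m)%N x - T n x = \sum_(i < m) (T (n + i.+1)%N x - T (n + i)%N x).
  rewrite -(big_mkord xpredT (fun i => T (n + i.+1)%N x - T (n + i)%N x)).
  by rewrite (telescope_sumr (fun i => T (n + i)%N x)) // addn0.
rewrite scaler_sumr; apply: eq_bigr => k _.
by rewrite -addnS leqNgt -addSnnS leq_addr.
Qed.

(** Signs on the increments of a subsequence are signs on all increments that are constant between
    its indices. *)
Lemma unconditional_subsequence C (T : nat -> X -> X) (n : nat -> nat) :
  n 0%N = 0%N -> (forall j, (n j < n j.+1)%N) ->
  unconditional_bound C T -> unconditional_bound C (fun j => T (n j)).
Proof.
move=> n0 nS uT N e Se x.
suff [f Sf ->] : exists2 f, forall k, S (f k) &
    signed_sum (fun j => T (n j)) e N x = signed_sum T f (n N) x by apply: uT.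
elim: N => [|N [f Sf ih]].
  by exists e => //; rewrite n0 /signed_sum !big_ord0.
exists (fun k => if (k <= n N)%N then f k else e N.+1).
  by move=> k; case: ifP.
rewrite -(subnKC (ltnW (nS N))) signed_sum_cat subnKC ?(ltnW (nS N)) // -ih.
by rewrite /signed_sum big_ord_recr.
Qed.

Lemma unconditional_norm C (T : nat -> X -> X) : S 1 ->
  (forall y, T 0%N y = 0) -> unconditional_bound C T -> forall n, opbound C (T n).
Proof.
move=> S1 T0 h n x; rewrite -signed_sum1 //; exact: h.
Qed.

End interface.

(** * From skipped blocking decompositions to umap *)

Section cotype.
Variables (R : realType) (F : scalar_field).
Local Notation K := (scalars R F).
Variable X : normedModType K.

Definition signs (th : nat -> K) : Prop := forall j, th j = 1 \/ th j = -1.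

(** A bound [M] on all signed sums bounds their quadratic average, which removes the average from
    the cotype inequality. *)
Lemma cotype_powR q : 2 <= q -> has_cotype X q ->
  exists2 c, 0 <= c & forall (N : nat) (d : nat -> X) (M : R),
    (forall th, signs th -> nrm (\sum_(j < N) th j *: d j) <= M) ->
    \sum_(j < N) nrm (d j) `^ q <= (c * M) `^ q.
Proof.
move=> q2 [C hC]; exists `|C| => // N d M hM.
have q0 : 0 < q by apply: lt_le_trans q2.
have M0 : 0 <= M by apply: le_trans (nrm_ge0 _) (hM (fun=> 1) (fun=> or_introl erefl)).
have s0 : 0 <= \sum_(j < N) nrm (d j) `^ q.
  by apply: sumr_ge0 => j _; apply: powR_ge0.
have := hC N (fun j => d j); set s := Num.sqrt _ => h.
have sM : s <= M.
  rewrite -[M]ger0_norm // -sqrtr_sqr; apply: ler_wsqrtr.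
  rewrite ler_pdivrMl ?exprn_gt0 //.
  apply: le_trans (_ : \sum_(e : {ffun 'I_N -> bool}) M ^+ 2 <= _).
    apply: ler_sum => e _; rewrite lerXn2r ?nnegrE ?nrm_ge0 //.
    pose th j : K := match insub j with Some i => (-1) ^+ e i | None => 1 end.
    have -> : \sum_(i < N) (-1) ^+ e i *: d i = \sum_(i < N) th i *: d i.
      by apply: eq_bigr => i _; rewrite /th valK.
    apply: hM => j; rewrite /th; case: insubP => [i _ _|_]; last by left.
    by case: (e i); [right|left].
  by rewrite sumr_const card_ffun card_bool card_ord -natrX mulr_natl.
have h2 : (\sum_(j < N) nrm (d j) `^ q) `^ q^-1 <= `|C| * M.
  apply: le_trans h _; apply: le_trans (_ : `|C| * s <= _).
    by rewrite ler_wpM2r ?sqrtr_ge0 // ler_norm.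
  by rewrite ler_wpM2l.
rewrite -[leLHS]powRr1 // -(mulVf (lt0r_neq0 q0)) powRrM.
by rewrite ge0_ler_powR ?nnegrE ?powR_ge0 ?mulr_ge0 // ltW.
Qed.

(** Terms above a fixed fraction of [M] are few: by cotype their number is bounded independently of
    [N], so they contribute little to the mean. *)
Lemma cotype_average : finite_cotype X -> forall beta : R, 0 < beta ->
  exists N0, forall N (d : nat -> X) (M : R), (N0 <= N)%N ->
    (forall th, signs th -> nrm (\sum_(j < N) th j *: d j) <= M) ->
    \sum_(j < N) nrm (d j) <= N%:R * (beta * M).
Proof.
move=> [q q2 /(cotype_powR q2)[c c0 hc]] beta b0.
have q0 : 0 < q by apply: lt_le_trans q2.
pose de := beta / 2.
have de0 : 0 < de by rewrite divr_gt0.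
pose A := (c / de) `^ q.
have A0 : 0 <= A by apply: powR_ge0.
(* [A] bounds the number of large terms; from this [N] on, it is at most [N * de]. *)
exists (Num.bound (A / de)) => N d M NN hM.
have M0 : 0 <= M by apply: le_trans (nrm_ge0 _) (hM (fun=> 1) (fun=> or_introl erefl)).
(* Flipping the sign of [d j] alone changes the sum by 2 d j. *)
have dM (j : 'I_N) : nrm (d j) <= M.
  pose th (i : nat) : K := if i == j then -1 else 1.
  have e : \sum_(i < N) (1 : K) *: d i - \sum_(i < N) th i *: d i = 2 *: d j.
    rewrite -sumrB (bigD1 j) //= big1 => [|i ij]; last first.
      by rewrite /th (_ : (val i == val j) = false) ?subrr //; apply/negbTE.
    by rewrite /th eqxx scaleN1r scale1r opprK addr0 scaler_nat mulr2n.
  have : nrm (2 *: d j) <= M + M.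
    rewrite -e; apply: le_trans (nrmB _ _) _; apply: lerD.
      by apply: (hM (fun=> 1)) => i; left.
    by apply: (hM th) => i; rewrite /th; case: eqP; [right|left].
  by rewrite nrmZ absr_nat => h; lra.
have [M00|Mp] := eqVneq M 0.
  rewrite M00 !mulr0 big1 // => j _; apply/eqP.
  by rewrite eq_le nrm_ge0 -M00 dM.
have {Mp}Mp : 0 < M by rewrite lt_neqAle eq_sym Mp.
have deM : 0 < de * M by rewrite mulr_gt0.
(* Markov's inequality in pointwise form: a term above [de * M] is still at most [M], and the
   quotient of powers is then at least 1. *)
have t_le (j : 'I_N) : nrm (d j) <= de * M + M * (nrm (d j) `^ q / (de * M) `^ q).
  have [h|h] := leP (nrm (d j)) (de * M).
    by rewrite (le_trans h) // lerDl mulr_ge0 // divr_ge0 ?powR_ge0.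
  rewrite (le_trans (dM j)) // (@le_trans _ _ (M * 1)) ?mulr1 //.
  apply: le_trans (_ : M * (nrm (d j) `^ q / (de * M) `^ q) <= _); last first.
    by rewrite lerDr ltW.
  rewrite -[leLHS]mulr1 ler_pM2l // ler_pdivlMr ?powR_gt0 // mul1r.
  by rewrite ge0_ler_powR ?nnegrE ?nrm_ge0 // ltW.
apply: le_trans (ler_sum _ (fun j _ => t_le j)) _.
rewrite big_split /= sumr_const card_ord -mulr_sumr -mulr_suml.
have h1 : (\sum_(j < N) nrm (d j) `^ q) / (de * M) `^ q <= A.
  have cd0 : 0 <= c / de by apply: divr_ge0 => //; apply: ltW.
  rewrite ler_pdivrMr ?powR_gt0 // /A -powRM ?(ltW deM) //.
  by rewrite mulrA divfK ?lt0r_neq0 //; exact: (hc N d M hM).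
have h2 : A <= N%:R * de.
  rewrite -ler_pdivrMr //; apply: le_trans (ler_norm _) _.
  have a0 : 0 <= A / de by rewrite divr_ge0 // ltW.
  rewrite ger0_norm // (le_trans (ltW (archi_boundP a0))) // ler_nat //.
apply: le_trans (_ : N%:R * (de * M) + M * (N%:R * de) <= _).
  apply: lerD; first by rewrite mulr_natl.
  by rewrite ler_wpM2l // (le_trans h1).
by rewrite le_eqVlt; apply/orP; left; apply/eqP; rewrite /de; field.
Qed.

End cotype.

Section averaging.
Variables (R : realType) (F : scalar_field).
Local Notation K := (scalars R F).
Variables (S : set K) (X : normedModType K).
Hypothesis gS : sign_group S.
Implicit Types T : nat -> X -> X.

Definition skipped_bound (eps : R) T : Prop :=
  forall a b : nat -> nat, (forall k, (a k < b k < a k.+1)%N) ->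
  forall (N : nat) (x : nat -> X) (e : nat -> K), (forall k, S (e k)) ->
    (forall k, (k < N)%N -> exists z, x k = T (b k) z - T (a k) z) ->
    nrm (\sum_(k < N) e k *: x k) <= (1 + eps) * nrm (\sum_(k < N) x k).

Lemma sum_mul_ord (N n : nat) (g : nat -> X) :
  \sum_(k < n) \sum_(j < N) g (k * N + j)%N = \sum_(m < n * N) g m.
Proof.
elim: n => [|n ih]; first by rewrite !big_ord0.
by rewrite big_ord_recr /= ih mulSnr big_split_ord.
Qed.

Variables (T : nat -> X -> X) (C eps : R) (M : nat).
Hypothesis T0 : forall x, T 0%N x = 0.
Hypotheses (C0 : 0 <= C) (uT : unconditional_bound S C T).
Hypotheses (eps0 : 0 <= eps) (kT : skipped_bound eps T).

(** At least 2, so that a block stays nonempty when one of its increments is deleted. The indices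
    [a j] start at 0 in order that the increments telescope from [T 0 = 0]; the [k]-th block ends at
    [b j k], one index before [a j k.+1]. *)
Local Notation N := M.+2.
Let b (j k : nat) : nat := (k * N + j + M.+1)%N.
Let a (j k : nat) : nat := if k is 0 then 0%N else (k * N + j)%N.

Let aS j k : a j k.+1 = (b j k).+1.
Proof. by rewrite /a /b mulSn; lia. Qed.

(* Deleting the increments [T (b j k).+1 - T (b j k)] from the [j]-th shifted
   subsequence leaves skipped blocks. *)
Definition averaged (k : nat) (x : X) : X := N%:R^-1 *: \sum_(j < N) T (a j k) x.

Let d (e : nat -> K) n x (j : nat) : X :=
  \sum_(k < n) e k.+1 *: (T (b j k).+1 x - T (b j k) x).

(** Different [j] and [k] delete different increments of [T], and division by [N] recovers [j] and
    [k] from the index. Signs in [j] and signs in [k] therefore combine to signs on a segment of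
    [T], a difference of two signed sums. *)
Lemma deleted_signs e n x th : (forall k, S (e k)) -> signs th ->
  nrm (\sum_(j < N) th j *: d e n x j) <= 2 * C * nrm x.
Proof.
have [S1 Sm1 _ SM _] := gS; move=> Se sth.
pose E (m : nat) := th (m %% N)%N * e (m %/ N)%N.
have SE m : S (E m) by apply: SM => //; case: (sth (m %% N)%N) => ->.
pose G m := E m.+1 *: (T m.+1 x - T m x).
have -> : \sum_(j < N) th j *: d e n x j =
    signed_sum T E (M.+1 + n * N) x - signed_sum T E M.+1 x.
  rewrite /signed_sum big_split_ord /= [X in X + _ - _](_ : _ =
    signed_sum T E M.+1 x) //.
  rewrite addrAC subrr add0r -(sum_mul_ord N n (fun m => G (M.+1 + m)%N)).
  rewrite exchange_big /=; apply: eq_bigr => j _; rewrite scaler_sumr.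
  apply: eq_bigr => k _; rewrite scalerA /G /E.
  have -> : (M.+1 + (k * N + j))%N = b j k by rewrite /b; lia.
  have -> : ((b j k).+1 = k.+1 * N + j)%N by rewrite /b mulSn; lia.
  by rewrite modnMDl divnMDl // modn_small // divn_small // addn0.
apply: le_trans (nrmB _ _) _; rewrite mulr2n mulrDl mul1r mulrDl.
by apply: lerD; apply: uT.
Qed.

Variable alpha : R.
Hypothesis alphaP : forall (d : nat -> X) (B : R),
  (forall th, signs th -> nrm (\sum_(j < N) th j *: d j) <= B) ->
  \sum_(j < N) nrm (d j) <= N%:R * (alpha * B).

(** For each [j] the signs are removed from the skipped blocks at the cost [1 + eps]. The deleted
    increments enter once with signs, and once with factor [1 + eps] when the blocks are completed
    to [T (a j n) x]; hence [2 + eps]. *)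
Lemma averaged_signed_sum e n x : (forall k, S (e k)) ->
  nrm (signed_sum averaged e n x) <=
  (1 + eps) * (N%:R^-1 * \sum_(j < N) nrm (T (a j n) x)) +
  (2 + eps) * alpha * (2 * C) * nrm x.
Proof.
move=> Se; have [S1 _ _ _ _] := gS.
have -> : signed_sum averaged e n x = N%:R^-1 *: \sum_(j < N)
    \sum_(k < n) e k.+1 *: (T (a j k.+1) x - T (a j k) x).
  rewrite exchange_big /= scaler_sumr; apply: eq_bigr => k _.
  rewrite /averaged -scalerBr -sumrB scalerA mulrC -scalerA scaler_sumr.
  by [].
rewrite nrmZ absrV absr_nat.
have N0 : 0 < (N%:R : R) by rewrite ltr0n.
rewrite -ler_pdivlMl ?invr_gt0 // invrK mulrDr.
apply: le_trans (nrm_sum _ _ _) _.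
have h (j : 'I_N) : nrm (\sum_(k < n) e k.+1 *: (T (a j k.+1) x - T (a j k) x)) <=
    (1 + eps) * nrm (T (a j n) x) + ((1 + eps) * nrm (d (fun=> 1) n x j) +
      nrm (d e n x j)).
  have -> : \sum_(k < n) e k.+1 *: (T (a j k.+1) x - T (a j k) x) =
      \sum_(k < n) e k.+1 *: (T (b j k) x - T (a j k) x) + d e n x j.
    rewrite -big_split; apply: eq_bigr => k _; rewrite [RHS]/=.
    by rewrite -scalerDr aS [X in _ = _ *: X]addrC addrA subrK.
  rewrite addrA; apply: le_trans (nrmD _ _) _; rewrite lerD2r -mulrDr.
  have hab k : (a j k < b j k < a j k.+1)%N.
    by rewrite aS leqnn andbT /a /b; case: k => [|k]; lia.
  have := @kT _ _ hab n (fun k => T (b j k) x - T (a j k) x) (fun k => e k.+1)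
    (fun k => Se k.+1) (fun k _ => ex_intro _ x erefl).
  move=> /le_trans; apply.
  rewrite ler_wpM2l ?addr_ge0 //.
  have -> : \sum_(k < n) (T (b j k) x - T (a j k) x) = T (a j n) x - d (fun=> 1) n x j.
    have -> : T (a j n) x = \sum_(k < n) (T (a j k.+1) x - T (a j k) x).
      rewrite -(big_mkord xpredT (fun k => T (a j k.+1) x - T (a j k) x)).
      by rewrite (telescope_sumr (fun k => T (a j k) x)) // T0 subr0.
    rewrite /d -sumrB.
    by apply: eq_bigr => k _; rewrite aS scale1r opprB [RHS]addrC addrA subrK.
  exact: nrmB.
apply: le_trans (ler_sum _ (fun j _ => h j)) _.
rewrite big_split /= -mulr_sumr.
apply: lerD; first by rewrite mulrCA mulrA mulrA mulfK // lt0r_neq0.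
rewrite big_split /= -mulr_sumr.
have h1 := alphaP (fun th => @deleted_signs (fun=> 1) n x th (fun=> S1)).
have h2 := alphaP (fun th => @deleted_signs e n x th Se).
apply: le_trans (lerD (ler_wpM2l _ h1) h2) _; first by rewrite addr_ge0.
rewrite le_eqVlt; apply/orP; left; apply/eqP; ring.
Qed.

(** The norms of [T (a j n) x] are controlled only by [C]. Extending the signs beyond [n] by 1 and
    by -1 and averaging leaves the sum up to [n] unchanged, while [T (a j (n + m)) x] tends to [x]
    as [m] grows. *)
Lemma averaged_bound e n x : (forall k, S (e k)) -> strongly_to_id T ->
  nrm (signed_sum averaged e n x) <=
  (1 + eps + (2 + eps) * alpha * (2 * C)) * nrm x.
Proof.
move=> Se TI; have [S1 Sm1 _ _ _] := gS.
pose ex th k := if (k <= n)%N then e k else th.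
have Sex th : S th -> forall k, S (ex th k) by move=> Sth k; rewrite /ex; case: ifP.
have split_sum th m : signed_sum averaged (ex th) (n + m) x =
    signed_sum averaged e n x + th *: (averaged (n + m) x - averaged n x).
  exact: signed_sum_cat.
have main m : nrm (signed_sum averaged e n x) <=
  (1 + eps) * (N%:R^-1 * \sum_(j < N) nrm (T (a j (n + m)) x)) +
  (2 + eps) * alpha * (2 * C) * nrm x.
  have h1 := averaged_signed_sum (n + m) x (Sex _ S1).
  have h2 := averaged_signed_sum (n + m) x (Sex _ Sm1).
  have : nrm (2 *: signed_sum averaged e n x) <=
     nrm (signed_sum averaged (ex 1) (n + m) x) +
       nrm (signed_sum averaged (ex (-1)) (n + m) x).
    apply: le_trans (nrmD _ _); rewrite !split_sum scale1r scaleN1r addrACA subrr addr0.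
    by rewrite scaler_nat mulr2n.
  rewrite nrmZ absr_nat => h3; have := le_trans h3 (lerD h1 h2).
  by rewrite -mulr2n -[leRHS]mulr_natl ler_pM2l ?ltr0n.
rewrite mulrDl; apply/ler_addgt0Pr => ep ep0.
have e10 : 0 < ep / (1 + eps) by rewrite divr_gt0 // ltr_pwDl.
have [m0 hm] : exists m0, forall m, (m0 <= m)%N ->
  nrm (T m x) <= nrm x + ep / (1 + eps).
  have [m0 hm] := TI x _ e10; exists m0 => m mm; rewrite addrC.
  by rewrite -lerBlDr (le_trans _ (hm m mm)) // lerBlDl nrm_le_dist.
apply: le_trans (main m0.+1) _; rewrite [leRHS]addrAC lerD2r.
have -> : (1 + eps) * nrm x + ep = (1 + eps) * (nrm x + ep / (1 + eps)).
  by rewrite mulrDr mulrCA mulfV ?mulr1 // lt0r_neq0 // ltr_pwDl.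
rewrite ler_wpM2l ?addr_ge0 // ler_pdivrMl ?ltr0n //.
rewrite mulr_natl -[N in leRHS]card_ord -sumr_const; apply: ler_sum => j _.
apply: hm; rewrite /a addnS mulSn; lia.
Qed.

Lemma averaged_finite : (forall k, finite_operator (T k)) ->
  forall k, finite_operator (averaged k).
Proof.
by move=> fT k; apply: finite_operatorZ; apply: finite_operator_sum.
Qed.

Lemma averaged_strongly : strongly_to_id T -> strongly_to_id averaged.
Proof.
move=> TI x e e0; have [m hm] := TI x e e0; exists m.+1 => n mn.
have -> : averaged n x - x = N%:R^-1 *: \sum_(j < N) (T (a j n) x - x).
  rewrite sumrB scalerBr sumr_const card_ord -[x *+ N]scaler_nat scalerA.
  by rewrite mulVf ?scale1r // pnatr_eq0.
rewrite nrmZ absrV absr_nat ler_pdivrMl ?ltr0n //.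
apply: le_trans (nrm_sum _ _ _) _.
rewrite mulr_natl -[N in leRHS]card_ord -sumr_const; apply: ler_sum => j _.
by apply: hm; case: n mn => // n; rewrite /a mulSn; nia.
Qed.

Lemma averaged0 x : averaged 0 x = 0.
Proof. by rewrite /averaged /= big1 ?scaler0. Qed.

End averaging.

Section blocking_umap.
Variables (R : realType) (F : scalar_field).
Local Notation K := (scalars R F).
Variables (S : set K) (X : normedModType K).
Hypothesis gS : sign_group S.

Lemma skipped_blocking_bound (eps : R) (T : nat -> {linear X -> X}) :
  (forall (a b : nat -> nat), (forall k, (a k < b k < a k.+1)%N) ->
    forall (N : nat) (x : nat -> X),
      (forall k, (k < N)%N -> range (fun z => T (b k) z - T (a k) z) (x k)) ->
        sup [set nrm (\sum_(k < N) e k *: x k)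
              | e in [set e : nat -> K | forall k, S (e k)]]
          <= (1 + eps) * nrm (\sum_(k < N) x k)) ->
  skipped_bound S eps (fun k => T k : X -> X).
Proof.
have [S1 _ Sa _ _] := gS.
move=> h a b ab N x e Se hx.
apply: le_trans (h a b ab N x _); last first.
  by move=> k kN; have [z ->] := hx k kN; exists z.
apply: ub_le_sup; last by exists e.
exists (\sum_(k < N) nrm (x k)) => _ [f Sf <-].
apply: le_trans (nrm_sum _ _ _) _; apply: ler_sum => k _.
by rewrite nrmZ Sa // mul1r.
Qed.

Theorem skipped_blocking_umap : finite_cotype X ->
  unconditional_skipped_blocking S X -> umap S X.
Proof.
move=> cX bX eps eps0.
(* As [e1 <= 1], the factor [2 + e1] is at most 3; this fixes [al] below, and each of the two errors
   is at most [eps / 2]. *)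
pose e1 := Num.min (eps / 2) 1.
have e10 : 0 < e1 by rewrite lt_min ltr01 divr_gt0.
have [T [/approximating_sequenceP[T0 fT TI] [C uC] /skipped_blocking_bound kT]]
  := bX e1 e10.
have bT k : bounded_linear (T k) by have [] := fT k.
have [C0 uT] := (unconditional_withP _ gS bT).1 uC.
pose al := eps / 2 / (3 * (2 * (C + 1))).
have al0 : 0 < al.
  by rewrite !divr_gt0 // !mulr_gt0 // ltr_pwDr.
have [N0 hN0] := cotype_average cX al0.
pose A := averaged (fun k => T k : X -> X) N0.
have fA := averaged_finite N0 fT.
have [Q QA] := linear_seq (fun k => (fA k).1.1).
have QE k : (Q k : X -> X) = A k by apply/funext => x; rewrite QA.
have QE' : (fun k => Q k : X -> X) = A by apply/funext => k; apply: QE.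
exists Q; split.
  apply/approximating_sequenceP; split.
  - by move=> x; rewrite QA averaged0.
  - by move=> k; rewrite QE.
  - by rewrite QE'; apply: averaged_strongly.
apply/unconditional_withP => // [k|]; first by rewrite QE; case: (fA k).
split; first by rewrite addr_ge0 // ltW.
rewrite QE' => n e Se x.
have hal (d : nat -> X) B : (forall th, signs th ->
    nrm (\sum_(j < N0.+2) th j *: d j) <= B) ->
    \sum_(j < N0.+2) nrm (d j) <= N0.+2%:R * (al * B).
  by apply: hN0; lia.
apply: le_trans (averaged_bound gS T0 C0 uT (ltW e10) kT hal n x Se TI) _.
rewrite ler_wpM2r ?nrm_ge0 // -addrA lerD2l.
have h1 : e1 <= eps / 2 by rewrite ge_min lexx.
have h2 : e1 <= 1 by rewrite ge_min lexx orbT.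
rewrite [leRHS]splitr lerD //.
have hC : al * (3 * (2 * (C + 1))) = eps / 2.
  by rewrite /al divfK // lt0r_neq0 // !mulr_gt0 // ltr_pwDr.
rewrite -hC mulrAC mulrC; apply: ler_wpM2l; first exact: ltW.
by apply: ler_pM; lra.
Qed.

End blocking_umap.

(** * The properties (u(tau)) and (u(T_k)) *)

Section oscillation.
Variables (R : realType) (F : scalar_field).
Local Notation K := (scalars R F).
Variables (S : set K) (X : normedModType K).
Hypothesis gS : sign_group S.
Implicit Types x y : X.

Definition osc_le (c : R) x y : Prop :=
  forall e f, S e -> S f -> nrm (e *: x + y) <= nrm (f *: x + y) + c.

Lemma oscP c x y : osc S (fun e => nrm (e *: x + y)) <= c <-> osc_le c x y.
Proof.
have [S1 _ Sa _ _] := gS; rewrite /osc.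
set A := _ @` _.
have A0 : A !=set0 by exists (nrm (1 *: x + y)), 1.
have uA : has_ubound A.
  exists (nrm x + nrm y) => _ [e Se <-].
  by rewrite (le_trans (nrmD _ _)) // nrmZ Sa // mul1r.
have lA : has_lbound A by exists 0 => _ [e Se <-]; apply: nrm_ge0.
split=> [h e f Se Sf|h].
  rewrite -lerBlDl; apply: le_trans h; apply: lerB.
    by apply: ub_le_sup => //; exists e.
  by apply: ge_inf => //; exists f.
rewrite lerBlDr; apply: ge_sup => // _ [e Se <-].
rewrite -lerBlDl; apply: lb_le_inf => // _ [f Sf <-].
by rewrite lerBlDl [leRHS]addrC h.
Qed.

Lemma osc_ge0 x y : 0 <= osc S (fun e => nrm (e *: x + y)).
Proof.
have [S1 _ _ _ _] := gS; have /oscP/(_ _ _ S1 S1) :=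
  lexx (osc S (fun e => nrm (e *: x + y))).
by rewrite lerDl.
Qed.

Lemma osc_le_perturb c d x x' y y' : osc_le c x y ->
  nrm (x' - x) + nrm (y' - y) <= d -> osc_le (c + (d + d)) x' y'.
Proof.
have [_ _ Sa _ _] := gS; move=> h hd.
have near e : S e -> nrm (e *: x' + y' - (e *: x + y)) <= d.
  move=> Se; rewrite opprD addrACA -scalerBr; apply: le_trans hd.
  by apply: le_trans (nrmD _ _) _; rewrite nrmZ Sa // mul1r.
move=> e f Se Sf.
have h1 := nrm_le_dist (e *: x' + y') (e *: x + y).
have h2 := nrm_le_dist (f *: x + y) (f *: x' + y').
have h3 := near e Se; have := near f Sf; rewrite nrm_subC => h4.
have := h e f Se Sf; lra.
Qed.

Lemma osc_leZ c (r : R) x y : 0 < r -> osc_le c x y ->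
  osc_le (r * c) (of_real F r *: x) (of_real F r *: y).
Proof.
move=> r0 h e f Se Sf; rewrite !scalerA ![_ * of_real _ _]mulrC -!scalerA.
rewrite -!scalerDr !nrmZ absr_of_real gtr0_norm // -mulrDr.
by rewrite ler_pM2l // h.
Qed.

Lemma osc_leW c d x y : c <= d -> osc_le c x y -> osc_le d x y.
Proof. by move=> cd h e f Se Sf; rewrite (le_trans (h e f Se Sf)) // lerD2l. Qed.

End oscillation.

(** * Total boundedness of the image of the ball under a finite rank operator *)

Section totally_bounded.
Variables (R : realType) (F : scalar_field).
Local Notation K := (scalars R F).
Variable X : normedModType K.

Lemma real_net (M e : R) : 0 < e -> exists (I : finType) (w : I -> R),
  forall z, `|z| <= M -> exists i, `|z - w i| <= e.
Proof.
move=> e0.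
have cover k z : - M <= z -> z <= - M + k%:R * e ->
    exists2 i, (i <= k)%N & `|z - (- M + i%:R * e)| <= e.
  elim: k => [|k ih] z1 z2.
    exists 0%N => //; rewrite mul0r addr0 in z2 *.
    by rewrite (_ : z = - M) ?subrr ?normr0 ?ltW //; apply/eqP; rewrite eq_le z1 z2.
  have [h|h] := leP z (- M + k%:R * e).
    by have [i ik hi] := ih z1 h; exists i => //; apply: leq_trans ik _.
  exists k.+1 => //; rewrite -addn1 natrD mulrDl mul1r in z2 *.
  by rewrite ler_norml; apply/andP; split; lra.
pose k := Num.bound `|2 * M / e|.
exists ('I_k.+1 : finType), (fun i : 'I_k.+1 => - M + i%:R * e) => z;
  rewrite ler_norml => /andP[z1 z2].
have hk : 2 * M <= k%:R * e.
  rewrite -ler_pdivrMr //; apply: le_trans (ler_norm _) _.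
  by apply/ltW/archi_boundP.
have [|i ik hi] := cover k z z1; first by lra.
by exists (inord i); rewrite inordK.
Qed.

Lemma scalars_net (M e : R) : 0 < e -> exists (I : finType) (w : I -> K),
  forall z, absr z <= M -> exists i, absr (z - w i) <= e.
Proof.
move=> e0; have e2 : 0 < e / 2 by rewrite divr_gt0.
rewrite /absr /real_part; case: F => /=; first exact: real_net.
have [I [w hw]] := real_net M e2.
exists (I * I)%type, (fun p => (w p.1 +i* w p.2)%C) => z zM.
have [i hi] := hw _ (le_trans (normc_ge_absRe z) zM).
have [j hj] := hw _ (le_trans (normc_ge_absIm z) zM).
exists (i, j); apply: le_trans (normc_le_ReIm _) _; rewrite [e]splitr.
by case: z hi hj {zM} => p q /= hi hj; apply: lerD.
Qed.

Lemma finite_operator_net (f : X -> X) (e : R) : finite_operator f -> 0 < e ->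
  exists (I : finType) (u : I -> X), forall x, unit_ball x ->
    exists i, nrm (f x - u i) <= e.
Proof.
move=> ff e0.
have [r [b [g [c [k [k0 _ fE _ cP]]]]]] := finite_operator_factor ff.
have [C C0 bf] := bounded_opbound ff.1.2.
pose B := \sum_(i < r) nrm (b i) + 1.
have B0 : 0 < B by rewrite ltr_pwDr // sumr_ge0 // => i _; apply: nrm_ge0.
have [I [w hw]] := scalars_net (k * C) (divr_gt0 e0 B0).
exists {ffun 'I_r -> I}, (fun p : {ffun 'I_r ->
  I} => \sum_(i < r) w (p i) *: b i) => x x1.
have cb (i : 'I_r) : exists j, absr (c i x - w j) <= e / B.
  apply: hw; have [_ h] := cP i (ltn_ord i); apply: le_trans (h x) _.
  rewrite ler_pM2l //; apply: le_trans (bf x) _.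
  by rewrite -[leRHS]mulr1 ler_pM2l.
have [p hp] := choice cb; exists [ffun i => p i].
rewrite fE -sumrB; apply: le_trans (nrm_sum _ _ _) _.
apply: le_trans (_ : \sum_(i < r) e / B * nrm (b i) <= _).
  apply: ler_sum => i _; rewrite ffunE -scalerBl nrmZ.
  by rewrite ler_wpM2r ?nrm_ge0.
rewrite -mulr_sumr -[leRHS](divfK (lt0r_neq0 B0)) ler_wpM2l ?divr_ge0 ?ltW //.
by rewrite ltrDl.
Qed.

End totally_bounded.

(** * The vector space topology of the seminorms nrm (T n x) *)

Section seminorm_topology.
Variables (R : realType) (F : scalar_field).
Local Notation K := (scalars R F).
Variables (X : normedModType K) (T : nat -> {linear X -> X}).

Definition seminorm_ball (n : nat) (d : R) (x : X) : set X :=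
  [set y | forall i, (i <= n)%N -> nrm (T i (y - x)) < d].

Definition seminorm_open (A : set X) : Prop :=
  forall x, A x -> exists n d, 0 < d /\ seminorm_ball n d x `<=` A.

Lemma seminorm_openT : seminorm_open setT.
Proof. by move=> x _; exists 0%N, 1. Qed.

Lemma seminorm_openI (A B : set X) :
  seminorm_open A -> seminorm_open B -> seminorm_open (A `&` B).
Proof.
move=> oA oB x [/oA[n [d [d0 hA]]] /oB[m [c [c0 hB]]]].
exists (maxn n m), (Num.min d c); split; first by rewrite lt_min d0.
move=> y hy; split; [apply: hA|apply: hB] => i ik.
  have := hy i (leq_trans ik (leq_maxl _ _)).
  by rewrite lt_min => /andP[].
have := hy i (leq_trans ik (leq_maxr _ _)).
by rewrite lt_min => /andP[].
Qed.

Lemma seminorm_open_bigcup (I : Type) (f : I -> set X) :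
  (forall i, seminorm_open (f i)) -> seminorm_open (\bigcup_i f i).
Proof.
move=> of_ x [i _ /of_[n [d [d0 h]]]]; exists n, d; split=> // y /h fy.
by exists i.
Qed.

Definition seminorm_topology : topology_on X :=
  TopologyOn seminorm_openT seminorm_openI seminorm_open_bigcup.

Local Notation E := (with_topology seminorm_topology).

Lemma seminorm_nbhsP (x : E) (U : set E) : nbhs x U <->
  exists n d, 0 < d /\ seminorm_ball n d x `<=` U.
Proof.
rewrite nbhsE /=; split.
  move=> [A [oA Ax] AU]; have [n [d [d0 h]]] := oA x Ax.
  by exists n, d; split=> // y /h/AU.
move=> [n [d [d0 h]]]; exists (seminorm_ball n d x) => //; split; last first.
  by move=> i _; rewrite subrr linear0 nrm0.
move=> y hy.
(* The least slack at [y] among the finitely many seminorms shows that the ball is open. *)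
pose m := \big[Num.min/d]_(i < n.+1) (d - nrm (T i (y - x))).
exists n, m; split.
  rewrite /m; elim/big_ind: _ => // [a b a0 b0|i _]; first by rewrite lt_min a0.
  by rewrite subr_gt0; apply: hy; rewrite -ltnS.
move=> z hz i ik.
have mi : m <= d - nrm (T i (y - x)).
  exact: (@bigmin_le _ _ _ d (Ordinal (ik : (i < n.+1)%N))
    (fun i : 'I_n.+1 => d - nrm (T i (y - x)))).
have -> : z - x = (z - y) + (y - x) by rewrite addrA subrK.
rewrite linearD; apply: le_lt_trans (nrmD _ _) _.
by have := hz i ik; move: mi; lra.
Qed.

Lemma seminorm_vector_space : vector_space_topology seminorm_topology.
Proof.
split.
- move=> [x y] U /seminorm_nbhsP[n [d [d0 h]]].
  have d2 : 0 < d / 2 by rewrite divr_gt0.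
  exists (seminorm_ball n (d / 2) x, seminorm_ball n (d / 2) y).
    by split; apply/seminorm_nbhsP; exists n, (d / 2); split => //= z.
  move=> [x' y'] [/= hx hy]; apply: h => i ik.
  have -> : x' + y' - (x + y) = (x' - x) + (y' - y) by rewrite opprD addrACA.
  rewrite linearD; apply: le_lt_trans (nrmD _ _) _.
  by have := hx i ik; have := hy i ik; lra.
- move=> [a x] U /seminorm_nbhsP[n [d [d0 h]]].
  pose B := \sum_(i < n.+1) nrm (T i x) + 1.
  have B0 : 0 < B by rewrite ltr_pwDr // sumr_ge0 // => i _; apply: nrm_ge0.
  have xB i : (i <= n)%N -> nrm (T i x) <= B.
    move=> ik; rewrite /B (bigD1 (Ordinal (ik : (i < n.+1)%N))) //= -addrA lerDl.
    by rewrite addr_ge0 // sumr_ge0 // => j _; apply: nrm_ge0.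
  (* The terms (b - a)(y - x) + (b - a) x cost less than [e (B + 1)], and a (y - x) costs at most
     [absr a * c]; each bound is at most [d / 2]. *)
  pose e := Num.min 1 (d / 2 / (B + 1)).
  have e0 : 0 < e by rewrite lt_min ltr01 !divr_gt0 // addr_gt0.
  pose c := d / 2 / (absr a + 1).
  have a1 : 0 < absr a + 1 by rewrite ltr_pwDr // absr_ge0.
  have c0 : 0 < Num.min 1 c by rewrite lt_min ltr01 !divr_gt0.
  exists ([set b : K^o | absr (b - a) < e], seminorm_ball n (Num.min 1 c) x).
    split; last by apply/seminorm_nbhsP; exists n, (Num.min 1 c); split => //= z.
    apply/nbhs_normP; exists (of_real F e);
      first by rewrite /= -(of_real0 R F) ltr_of_real.
    by move=> b /=; rewrite absE ltr_of_real -absrN opprB.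
  move=> [b y] [/= hb hy]; apply: h => i ik.
  have -> : b *: y - a *: x = (b - a) *: (y - x) + (b - a) *: x + a *: (y - x).
    by rewrite -scalerDr subrK scalerBl scalerBr addrA subrK.
  have : nrm (T i (y - x)) < Num.min 1 c := hy i ik.
  generalize (y - x) => w hyi.
  rewrite !linearD !linearZ /=; apply: le_lt_trans (nrmD _ _) _.
  rewrite lt_min in hyi; case/andP: hyi => hy1 hyc.
  rewrite /= lt_min in hb; case/andP: hb => hb1 hbd.
  have B10 : 0 < B + 1 by rewrite addr_gt0.
  have h1 : nrm ((b - a) *: T i w + (b - a) *: T i x) < d / 2.
    rewrite -scalerDr nrmZ.
    apply: le_lt_trans (_ : absr (b - a) * (B + 1) < _); last by rewrite -ltr_pdivlMr.
    rewrite ler_wpM2l ?absr_ge0 //; apply: le_trans (nrmD _ _) _.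
    by rewrite addrC lerD ?xB // ltW.
  have h2 : nrm (a *: T i w) <= d / 2.
    rewrite nrmZ -[leRHS](divfK (lt0r_neq0 a1)) -/c mulrC.
    by apply: ler_pM; rewrite ?absr_ge0 ?nrm_ge0 ?lerDl // ltW.
  by rewrite [d]splitr; apply: ltr_leD.
Qed.

End seminorm_topology.

(** * Equivalence of (u(tau)) and (u(T_k)) *)

Section topology_sequence.
Variables (R : realType) (F : scalar_field).
Local Notation K := (scalars R F).
Variables (S : set K) (X : normedModType K).
Hypothesis gS : sign_group S.

Theorem u_topology_u_sequence : admits_u_topology S X -> admits_u_sequence S X.
Proof.
have [S1 _ _ _ _] := gS.
move=> [T [tau [[aT cT uT] [vtau utau Ttau]]]]; exists T; split=> //.
have /approximating_sequenceP[T0 fT TI] := aT.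
have bT k : bounded_linear (T k) by have [] := fT k.
have [C uC] := uT; have [C0 uB] := (unconditional_withP _ gS bT).1 uC.
have TC k := unconditional_norm S1 T0 uB k.
move=> eps n eps0 n1.
have e3 : 0 < eps / 3 by rewrite divr_gt0.
have [I [u hu]] := finite_operator_net (fT n) e3.
(* If no [M] worked for [u i], counterexamples with indices m_j >= j would give a bounded sequence
   z_j - T_(m_j) z_j, null in tau by uniformity, against (u(tau)). *)
have /choice[M hM] : forall i : I, exists M, forall m, (M <= m)%N ->
    forall z, unit_ball z -> osc S (fun e => nrm (e *: u i + (z - T m z))) <= eps / 3.
  move=> i; apply: contrapT => /forallNP h.
  have /choice[mz hmz] : forall M, exists mz : nat * X, [/\ (M <= mz.1)%N,
      unit_ball mz.2 & eps / 3 < osc S (fun e => nrm (e *: u i +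
        (mz.2 - T mz.1 mz.2)))].
    move=> M; have /existsNP[m /not_implyP[Mm /existsNP[z /not_implyP[z1 hz]]]] := h M.
    by exists (m, z); split=> //=; rewrite ltNge; apply/negP.
  pose v j := (mz j).2 - T (mz j).1 (mz j).2.
  have /tends0P : (fun j => osc S (fun e => nrm (e *: u i + v j))) @ \oo --> (0 : R).
    apply: utau.
      exists (1 + C) => j; have [_ z1 _] := hmz j.
      apply: le_trans (nrmB _ _) (lerD z1 _); apply: le_trans (TC _ _) _.
      by rewrite -[leRHS]mulr1 ler_wpM2l.
    move=> U nU; have [N _ hN] := Ttau U nU.
    exists N => // j Nj; have [jm z1 _] := hmz j.
    have := hN (mz j).1 (leq_trans Nj jm) (- (mz j).2).
    rewrite /unit_ball /= nrmN => /(_ z1).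
    by rewrite linearN opprK addrC.
  move=> /(_ (fun j => osc_ge0 gS _ _)) /(_ _ e3)[N /(_ N (leqnn _))].
  by have [_ _] := hmz N; rewrite ltNge => /negP.
exists (maxn n (\max_(i : I) M i)); first exact: leq_maxl.
set m := maxn _ _ => x y [x' x'1 <-] [z z1 <-].
have [i hi] := hu x' x'1.
have Mm : (M i <= m)%N by rewrite leq_max (leq_bigmax_cond i) // orbT.
apply/(oscP gS); have /(oscP gS) h := hM i m Mm z z1.
have := osc_le_perturb gS (d := eps / 3) h (x' := T n x') (y' := z - T m z).
rewrite subrr nrm0 addr0 => /(_ hi); apply: osc_leW.
by rewrite le_eqVlt; apply/orP; left; apply/eqP; field.
Qed.

Theorem u_sequence_u_topology : admits_u_sequence S X -> admits_u_topology S X.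
Proof.
move=> [T [aT cT uT hT]]; exists T, (seminorm_topology T); split=> //.
have /approximating_sequenceP[T0 fT TI] := aT.
have lT k := linear_fun_linear (T k).
split; first exact: seminorm_vector_space.
- move=> u v [M vM] v0; apply/tends0P; first by move=> j; apply: osc_ge0.
  move=> e e0.
  (* Scaling by [L] moves [u] and all [v j] into the unit ball. *)
  pose L := nrm u + `|M| + 1.
  have L0 : 0 < L by rewrite ltr_pwDr // addr_ge0 ?nrm_ge0.
  have e4 : 0 < e / 8 by rewrite divr_gt0.
  have [n' hn'] := TI u _ e4; pose n := n'.+1.
  have [m nm hm] := hT (e / 2 / L) n ltac:(by rewrite !divr_gt0) isT.
  have [N _ hN] : (v @ \oo) (seminorm_ball T m (e / 8) 0).
    apply: v0; apply/seminorm_nbhsP; exists m, (e / 8); split=> //.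
  exists N => j Nj; apply/(oscP gS).
  have Li (z : X) : of_real F L *: (of_real F L^-1 *: z) = z.
    by rewrite scalerA -of_realM mulfV ?lt0r_neq0 // of_real1 scale1r.
  have Lb (z : X) : nrm z <= L -> unit_ball (of_real F L^-1 *: z).
    move=> zL; rewrite /unit_ball /= nrmZ absr_of_real ger0_norm ?invr_ge0 ?(ltW L0) //.
    by rewrite ler_pdivrMl // mulr1.
  have uL : nrm u <= L by rewrite /L -addrA lerDl addr_ge0.
  have vL : nrm (v j) <= L.
    rewrite (le_trans (vM j)) // (le_trans (ler_norm M)) // /L addrAC lerDr.
    by rewrite addr_ge0 ?nrm_ge0.
  have /(oscP gS) h := hm (T n (of_real F L^-1 *: u))
      ((of_real F L^-1 *: v j) - T m (of_real F L^-1 *: v j))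
      (ex_intro2 _ _ _ (Lb _ uL) erefl) (ex_intro2 _ _ _ (Lb _ vL) erefl).
  have {}h := osc_leZ L0 h.
  rewrite scalerBr -(linZ _ _ (lT n)) -(linZ _ _ (lT m)) !Li in h.
  have := osc_le_perturb gS (d := e / 4) h (x' := u) (y' := v j).
  have hu : nrm (u - T n u) <= e / 8 by rewrite nrm_subC hn' // /n ltnW.
  have hv : nrm (v j - (v j - T m (v j))) <= e / 8.
    by rewrite opprB addrC subrK ltW //; have := hN j Nj m (leqnn _); rewrite subr0.
  have h8 : nrm (u - T n u) + nrm (v j - (v j - T m (v j))) <= e / 4 by lra.
  move=> /(_ h8); apply: osc_leW.
  by rewrite mulrC divfK ?lt0r_neq0 //; lra.
(* By commutation T_i (T_k x - x) = (T_k - Id) T_i x, which is uniformly small on the ball because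
   T_i has finite rank. *)
- move=> U /seminorm_nbhsP[n [d [d0 h]]].
  have d2 : 0 < d / 2 by rewrite divr_gt0.
  have /choice[N hN] : forall i, exists N, forall k, (N <= k)%N ->
      opbound (d / 2) (fun x => T k (T i x) - T i x).
    move=> i; exact: (finite_operator_uniform (fT i) lT TI d2).
  exists (\max_(i < n.+1) N i) => // k Nk x x1; apply: h => i ik.
  rewrite subr0 linearB /= cT; apply: le_lt_trans (_ : d / 2 < d); last by lra.
  have Nik : (N i <= k)%N.
    apply: leq_trans Nk; exact: (leq_bigmax_cond (Ordinal (ik : (i < n.+1)%N))).
  apply: le_trans (hN i k Nik x) _.
  by rewrite -[leRHS]mulr1 ler_wpM2l // ltW.
Qed.

End topology_sequence.

(** * From (u(T_k)) to skipped blocking decompositions *)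

Section half_powers.
Variable R : realType.

Lemma half_pow_gt0 j : 0 < (2^-1 : R) ^+ j.
Proof. by rewrite exprn_gt0 // invr_gt0. Qed.

Lemma half_pow_sum N : \sum_(k < N) (2^-1 : R) ^+ k <= 2.
Proof.
suff -> : \sum_(k < N) (2^-1 : R) ^+ k = 2 - 2 * 2^-1 ^+ N.
  by rewrite gerBl mulr_ge0 // ltW // half_pow_gt0.
elim: N => [|N ih]; first by rewrite big_ord0 mulr1 subrr.
by rewrite big_ord_recr /= ih exprS; field.
Qed.

Lemma half_pow_tends0 : tends0 (fun j => (2^-1 : R) ^+ j).
Proof.
apply: tends0_le (@tends0_inv R) => n.
rewrite exprVn lef_pV2 ?posrE ?exprn_gt0 ?ltr0n // -natrX ler_nat.
exact: ltn_expl.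
Qed.

End half_powers.

Section chains.
Variables (R : realType) (F : scalar_field).
Local Notation K := (scalars R F).
Variables (S : set K) (X : normedModType K).
Hypothesis gS : sign_group S.
Implicit Types T U : nat -> X -> X.

Definition chain T : Prop :=
  forall i j x, (i < j)%N -> T j (T i x) = T i x /\ T i (T j x) = T i x.

(** A multiplicative form of (u(T_k)), with the kernel of [T j] in place of the range of Id - T
    m. *)
Definition splits T (i j : nat) (d : R) : Prop := forall e x y, S e ->
  T j y = 0 -> nrm (e *: T i x + y) <= (1 + d) * nrm (T i x + y).

Section perturbed.
Variables (T U : nat -> X -> X) (n : nat -> nat) (C : R).
Hypotheses (T0 : forall x, T 0%N x = 0) (U0 : forall x, U 0%N x = 0).
Hypotheses (n0 : n 0%N = 0%N) (nS : forall j, (n j < n j.+1)%N).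
Hypotheses (fT : forall j, finite_operator (T j)) (lU : forall j, linear (U j)).
Hypothesis UT : forall j, (0 < j)%N ->
  opbound (2^-1 ^+ j) (fun x => U j x - T (n j) x).

Let UT' j x : nrm (U j x - T (n j) x) <= 2^-1 ^+ j * nrm x.
Proof.
case: j => [|j]; last exact: UT.
by rewrite U0 n0 T0 subrr nrm0 mul1r nrm_ge0.
Qed.

Let n_ge j : (j <= n j)%N.
Proof. by elim: j => // j ih; apply: leq_ltn_trans ih (nS j). Qed.

Lemma perturbed_strongly : strongly_to_id T -> strongly_to_id U.
Proof.
move=> TI x.
apply: tends0_le (tends0D (tends0Z (nrm x) (@half_pow_tends0 R) (fun j => ltW
  (half_pow_gt0 R j)))
  (tends0_sub n_ge (TI x))) => j /=.
have -> : U j x - x = (U j x - T (n j) x) + (T (n j) x - x) by rewrite addrA subrK.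
by apply: le_trans (nrmD _ _) _; rewrite lerD2r mulrC.
Qed.

(** The [k]-th increment moves by at most 2 * 2^-k, and these bounds sum to at most 4. *)
Lemma perturbed_unconditional : unconditional_bound S C T ->
  unconditional_bound S (C + 4) U.
Proof.
have [_ _ Sa _ _] := gS; move=> uT N e Se x.
have := unconditional_subsequence n0 nS uT N Se x.
set V := signed_sum _ _ _ _ => hV.
have -> : signed_sum U e N x = V + \sum_(k < N) e k.+1 *:
    ((U k.+1 x - T (n k.+1) x) - (U k x - T (n k) x)).
  rewrite /V /signed_sum -big_split; apply: eq_bigr => k _ /=.
  rewrite -scalerDr; congr (_ *: _); rewrite opprB addrACA addKr.
  by rewrite [T _ _ + (_ - T _ _)]addrC subrK.
apply: le_trans (nrmD _ _) _; rewrite mulrDl; apply: lerD => //.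
apply: le_trans (nrm_sum _ _ _) _.
apply: le_trans (_ : \sum_(k < N) 2 * 2^-1 ^+ k * nrm x <= _).
  apply: ler_sum => k _; rewrite nrmZ Sa // mul1r.
  apply: le_trans (nrmB _ _) _; rewrite mulr2n mulrDl mul1r mulrDl lerD //.
  apply: le_trans (UT' _ _) _; rewrite ler_wpM2r ?nrm_ge0 // exprS.
  by rewrite ler_piMl ?invf_le1 ?ler1n // ltW // half_pow_gt0.
rewrite -mulr_suml ler_wpM2r ?nrm_ge0 // -mulr_sumr.
have := half_pow_sum R N; lra.
Qed.

Hypothesis TC : forall j, opbound C (T j).
Hypothesis C0 : 0 <= C.
Hypothesis chU : chain U.
Hypothesis aT : forall j, absorbed T (T j).
Hypothesis uT : forall (eps : R) (n : nat), 0 < eps -> (1 <= n)%N ->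
  exists2 m, (n <= m)%N & forall x z, unit_ball x -> unit_ball z ->
    osc_le S eps (T n x) (z - T m z).

(** (u(T_k)) gives an error proportional to [nrm u + nrm y]. It becomes multiplicative because
    [U i.+1] fixes [u] and kills [y], so that both norms are bounded by multiples of
    [nrm (u + y)]. *)
Lemma perturbed_splits i d : 0 < d ->
  exists2 j, (i < j)%N & splits U i j d.
Proof.
have [S1 _ Sa _ _] := gS; have C_ge0 := C0.
(* [A * nrm (u + y)] will bound [L]. The errors are [d1 L] from (u(T_k)) and twice [d1 (2 + C) L]
   from replacing [u] by T (n l) u and [y] by y - T m y, together [d1 (5 + 2 C) L]. *)
move=> d0; pose A := 2 * (C + 1) + 1.
have A0 : 0 < A by rewrite /A; lra.
pose d1 := d / A / (7 + 2 * C).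
have d10 : 0 < d1 by rewrite !divr_gt0 //; lra.
have [l0 hl0] := @half_pow_tends0 R d1 d10.
pose l := maxn i.+1 l0.
have hl : 2^-1 ^+ l <= d1 by apply: hl0; apply: leq_maxr.
have il : (i < l)%N by apply: leq_maxl.
have nl : (1 <= n l)%N by apply: leq_trans (n_ge l); apply: leq_trans il.
have [m nm hm] := uT d10 nl.
have [j0 hj0] := aT m d10.
have [j1 hj1] := @half_pow_tends0 R d1 d10.
(* From [i.+2] on, the kernel of [U j] lies in that of [U i.+1]. *)
pose j := maxn (maxn i.+2 j0) j1.
have ij : (i.+1 < j)%N by rewrite !leq_max leqnn.
exists j; first exact: ltnW.
move=> e x y Se Ujy; set u := U i x.
have Uu : U i.+1 u = u by rewrite /u (chU x (ltnSn i)).1.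
have Uy : U i.+1 y = 0 by rewrite -(chU y ij).2 Ujy lin0.
have UC k : opbound (C + 1) (U k).
  move=> z; have -> : U k z = T (n k) z + (U k z - T (n k) z) by rewrite addrC subrK.
  apply: le_trans (nrmD _ _) _; rewrite mulrDl lerD ?TC //.
  by apply: le_trans (UT' _ _) _;
    rewrite ler_wpM2r ?nrm_ge0 // exprn_ile1 ?invr_ge0 ?invf_le1 ?ler1n.
have hu : nrm u <= (C + 1) * nrm (u + y).
  by have := UC i.+1 (u + y); rewrite linD // Uu Uy addr0.
have hy : nrm y <= nrm (u + y) + nrm u.
  by have := nrmB (u + y) u; rewrite addrC addKr.
pose L := nrm u + nrm y.
have LA : L <= A * nrm (u + y) by rewrite /L /A; lra.
have := nrm_ge0 u; have := nrm_ge0 y; move=> y0 u0.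
have [L0|L0] := eqVneq L 0.
  have -> : u = 0 by apply: nrm_eq0; move: L0; rewrite /L; lra.
  have -> : y = 0 by apply: nrm_eq0; move: L0; rewrite /L; lra.
  by rewrite scaler0 addr0 nrm0 mulr0.
have {L0}L0 : 0 < L by rewrite lt_neqAle eq_sym L0 addr_ge0.
have Lb (z : X) : nrm z <= L -> unit_ball (of_real F L^-1 *: z).
  move=> zL; rewrite /unit_ball /= nrmZ absr_of_real ger0_norm ?invr_ge0 ?(ltW L0) //.
  by rewrite ler_pdivrMl // mulr1.
have Li (z : X) : of_real F L *: (of_real F L^-1 *: z) = z.
  by rewrite scalerA -of_realM mulfV ?lt0r_neq0 // of_real1 scale1r.
have lT k : linear (T k) by have [[]] := fT k.
have uL : nrm u <= L by rewrite /L; lra.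
have yL : nrm y <= L by rewrite /L; lra.
have := osc_leZ L0 (hm _ _ (Lb u uL) (Lb y yL)).
rewrite scalerBr -!(linZ _ _ (lT _)) !Li => h1.
have e1 : nrm (u - T (n l) u) <= d1 * L.
  have {1}-> : u = U l u by rewrite /u (chU x il).1.
  by apply: le_trans (UT' _ _) _; apply: ler_pM => //; exact/ltW/half_pow_gt0.
have e2 : nrm (y - (y - T m y)) <= d1 * (1 + C) * L.
  rewrite opprB addrC subrK.
  (* The first term is small by absorption of [T m], the second because [T (n j)] is close to [U j];
     the equation uses [U j y = 0]. *)
  have -> : T m y = T m (y - T (n j) y) - T m (U j y - T (n j) y).
    by rewrite Ujy sub0r [X in _ = _ - X]linN // opprK -linD // subrK.
  apply: le_trans (nrmB _ _) _; rewrite (mulrDr d1 1 C) mulr1 mulrDl; apply: lerD.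
    have : (j0 <= n j)%N by apply: leq_trans (n_ge j); rewrite !leq_max leqnn orbT.
    by move=> /hj0/(_ y) h; apply: le_trans h _; rewrite ler_pM2l.
  apply: le_trans (TC _ _) _; rewrite mulrAC mulrC; apply: ler_wpM2r => //.
  apply: le_trans (UT' _ _) _; apply: ler_pM => //.
  by apply: hj1; rewrite /j leq_maxr.
have := osc_le_perturb gS (d := d1 * (2 + C) * L) h1 (x' := u) (y' := y).
have e3 : nrm (u - T (n l) u) + nrm (y - (y - T m y)) <= d1 * (2 + C) * L.
  by apply: le_trans (lerD e1 e2) _; rewrite le_eqVlt; apply/orP; left; apply/eqP; ring.
move=> /(_ e3 e 1 Se S1); rewrite scale1r => /le_trans; apply.
rewrite [leRHS]mulrDl mul1r lerD2l.
have -> : L * d1 + (d1 * (2 + C) * L + d1 * (2 + C) * L) = d1 * (5 + 2 * C) * L by ring.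
apply: le_trans (_ : d1 * (7 + 2 * C) * L <= _).
  apply: ler_wpM2r; first exact: ltW.
  by apply: ler_wpM2l; [exact: ltW | lra].
have -> : d1 * (7 + 2 * C) = d / A by rewrite /d1 divfK // lt0r_neq0 //; lra.
by rewrite -mulrA ler_pM2l // ler_pdivrMl.
Qed.

End perturbed.

Section telescoping.
Variables (T : nat -> X -> X) (g : nat -> R) (k : nat -> nat).
Hypotheses (lT : forall j, linear (T j)) (chT : chain T).
Hypotheses (g0 : g 0%N = 1) (g_mono : forall i j, (i <= j)%N -> g i <= g j).
Hypothesis g_gt0 : forall i, 0 < g i.
Hypothesis kS : forall i, (k i < k i.+1)%N.
Hypothesis splitT : forall i, exists2 j, (j < k i.+1)%N &
  splits T (k i) j (g i.+1 / g i - 1).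

Let k_lt i j : (i < j)%N -> (k i < k j)%N.
Proof.
elim: j => // j ih; rewrite ltnS leq_eqVlt => /orP[/eqP->//|/ih h].
exact: ltn_trans h (kS j).
Qed.

(** Dividing by [e r] reduces step [r] to changing one common sign of the first [r.+1] blocks, whose
    sum lies in the range of [T (k (b r))], against the later blocks, which are killed by a [T j]
    with [j < k (b r).+1]. The factors g i.+1 / g i telescope, and monotonicity of [g] bridges
    skipped indices. *)
Lemma telescoped_signs (a b : nat -> nat) (N : nat) (x : nat -> X) :
  (forall i, (a i < b i < a i.+1)%N) ->
  (forall i, (i < N)%N -> exists z, x i = T (k (b i)) z - T (k (a i)) z) ->
  forall r, (r <= N)%N -> forall e, (forall i, S (e i)) ->
    nrm (\sum_(0 <= i < r) e i *: x i + \sum_(r <= i < N) x i) <=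
    (if r is s.+1 then g (b s).+1 else 1) * nrm (\sum_(0 <= i < N) x i).
Proof.
have [S1 _ Sa SM SV] := gS.
move=> ab hx.
have b_mono i j : (i < j)%N -> (b i < a j)%N.
  elim: j => // j ih; rewrite ltnS leq_eqVlt => /orP[/eqP->|/ih h].
    by have /andP[] := ab j.
  by have /andP[h1 h2] := ab j; apply: ltn_trans h2; apply: ltn_trans h1.
elim=> [|r ih] rN e Se; first by rewrite big_nil add0r mul1r.
have er0 : e r != 0.
  by apply/eqP => er; have := Sa _ (Se r); rewrite er absr0 => /eqP;
    rewrite eq_sym oner_eq0.
pose f i := e i / e r.
have Sf i : S (f i) by apply/SM/SV.
set y := \sum_(r.+1 <= i < N) x i.
pose u := \sum_(0 <= i < r) f i *: x i + x r.
have -> : \sum_(0 <= i < r.+1) e i *: x i = e r *: u.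
  rewrite big_nat_recr //= /u scalerDr; congr (_ + _).
  rewrite scaler_sumr; apply: eq_bigr => i _.
  by rewrite scalerA /f mulrC divfK.
have hu : exists z, u = T (k (b r)) z.
  pose V w := exists z, w = T (k (b r)) z.
  have VD p w w' : V w -> V w' -> V (p *: w + w').
    by move=> [z ->] [z' ->]; exists (p *: z + z'); rewrite lT.
  have V0 : V 0 by exists 0; rewrite lin0.
  have Vx i : (i <= r)%N -> V (x i).
    move=> ir; have [z ->] := hx i (leq_ltn_trans ir rN).
    have /andP[abi _] := ab i.
    move: ir; rewrite leq_eqVlt => /orP[/eqP->|ir].
      exists (z - T (k (a r)) z); rewrite linB //.
      by have /andP[abr _] := ab r; rewrite (chT z (k_lt abr)).1.
    have h := b_mono _ _ ir; have /andP[h' _] := ab r.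
    have bb := ltn_trans h h'.
    exists (T (k (b i)) z - T (k (a i)) z); rewrite linB //.
    by rewrite (chT z (k_lt bb)).1 (chT z (k_lt (ltn_trans abi bb))).1.
  have -> : u = 1 *: u + 0 by rewrite scale1r addr0.
  apply: (VD) => //; rewrite /u addrC -[x r]scale1r; apply: (VD); first exact: Vx.
  rewrite big_nat; elim/big_ind: _ => // [w w' Vw Vw'|i /andP[_ ir]].
    by rewrite -[w]scale1r; apply: VD.
  by rewrite -[_ *: _]addr0; apply: VD => //; apply: Vx; apply: ltnW.
have [z uz] := hu.
have [j jk hj] := splitT (b r).
have Tjy : T j y = 0.
  rewrite lin_sum // big_nat big1 // => i /andP[ri iN].
  have [w ->] := hx i iN; rewrite linB //.
  have h := b_mono _ _ ri.
  have ja : (j < k (a i))%N.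
    apply: leq_trans jk _; move: h; rewrite leq_eqVlt => /orP[/eqP->//|h].
    exact/ltnW/k_lt.
  have /andP[abi _] := ab i.
  by rewrite (chT w ja).2 (chT w (ltn_trans ja (k_lt abi))).2 subrr.
rewrite uz; apply: le_trans (hj (e r) z y (Se r) Tjy) _.
rewrite addrC subrK -uz.
have := ih (ltnW rN) f Sf; rewrite [\sum_(r <= i < N) _]big_ltn // addrA -/u -/y => h.
apply: le_trans (ler_wpM2l _ h) _; first by rewrite divr_ge0 // ltW.
rewrite mulrA ler_wpM2r ?nrm_ge0 //.
rewrite mulrAC ler_pdivrMr // ler_pM2l //.
case: r rN {ih h uz hu z hj jk Tjy er0 Sf u y f j} => [|r] rN;
  first by rewrite -g0 g_mono.
apply: g_mono; have h := b_mono _ _ (ltnSn r); have /andP[h' _] := ab r.+1.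
exact: ltn_trans h h'.
Qed.

End telescoping.

End chains.

Section skipped_blocking.
Variables (R : realType) (F : scalar_field).
Local Notation K := (scalars R F).
Variables (S : set K) (X : normedModType K).
Hypothesis gS : sign_group S.

Theorem u_sequence_skipped_blocking :
  admits_u_sequence S X -> unconditional_skipped_blocking S X.
Proof.
have [S1 _ Sa _ _] := gS.
move=> [T [aT cT uncT hT]] eps eps0.
have /approximating_sequenceP[T0 fT TI] := aT.
have lT k := linear_fun_linear (T k).
have bT k : bounded_linear (T k) by have [] := fT k.
have [C uC] := uncT; have [C0 uT] := (unconditional_withP _ gS bT).1 uC.
have TC k := unconditional_norm S1 T0 uT k.
have abT k : absorbed (fun m => T m : X -> X) (T k).
  move=> e e0; have [N hN] := finite_operator_uniform (fT k) lT TI e0.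
  exists N => m Nm x; rewrite (linB _ _ (lT k)) (cT k m) nrm_subC.
  exact: hN.
have [n [U [[n0 nS] fU U0 chU UT]]] :=
  perturbed_chain fT TI abT (half_pow_gt0 R).
have lU j : linear (U j) by have [[]] := fU j.
have UI := perturbed_strongly T0 U0 n0 nS UT TI.
have uU := perturbed_unconditional gS T0 U0 n0 nS UT uT.
(* Strictly increasing from 1 and below [1 + eps], so each ratio leaves room for [perturbed_splits]
   and their product stays admissible. *)
pose g i : R := 1 + eps * (1 - 2^-1 ^+ i).
have half1 i : (2^-1 : R) ^+ i <= 1.
  by rewrite exprn_ile1 ?invr_ge0 ?invf_le1 ?ler1n.
have g_ge1 i : 1 <= g i by rewrite lerDl mulr_ge0 ?subr_ge0 // ltW.
have g_gt0 i : 0 < g i by apply: lt_le_trans (g_ge1 i).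
have g_lt i : g i < g i.+1.
  rewrite ltrD2l ltr_pM2l // ltrD2l ltrN2 exprS gtr_pMl ?half_pow_gt0 //.
  by rewrite invf_lt1 // ltr1n.
have g_mono i j : (i <= j)%N -> g i <= g j.
  elim: j => [|j ih]; first by rewrite leqn0 => /eqP->.
  rewrite leq_eqVlt => /orP[/eqP->//|/ih h].
  exact: le_trans h (ltW (g_lt j)).
have hu (e : R) m : 0 < e -> (1 <= m)%N -> exists2 m', (m <= m')%N &
    forall x z, unit_ball x -> unit_ball z -> osc_le S e (T m x) (z - T m' z).
  move=> e0 m1; have [m' mm' h] := hT e m e0 m1; exists m' => // x z x1 z1.
  by apply/(oscP gS); apply: h; [exists x|exists z].
have /choice[J hJ] : forall p : nat * nat, exists j, (p.1 < j)%N /\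
    splits S U p.1 j (g p.2.+1 / g p.2 - 1).
  move=> [i r]; have d0 : 0 < g r.+1 / g r - 1.
    by rewrite subr_gt0 ltr_pdivlMr // mul1r.
  have [j ij sj] := perturbed_splits gS T0 U0 n0 nS fT lU UT TC C0 chU abT hu i d0.
  by exists j.
pose k := fix k i := if i is i'.+1 then (J (k i', i')).+1 else 0%N.
have kS i : (k i < k i.+1)%N by have [/= h _] := hJ (k i, i); apply: ltnW.
have [Q QE] := linear_seq (fun i => lU (k i)).
have QE' : (fun i => Q i : X -> X) = (fun i => U (k i)).
  by apply/funext => i; apply/funext => x; rewrite QE.
have QE1 i : (Q i : X -> X) = U (k i) by apply/funext => x; rewrite QE.
have fQ i : finite_operator (Q i) by rewrite QE1.
have k_ge i : (i <= k i)%N by elim: i => // i ih; apply: leq_ltn_trans ih (kS i).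
exists Q; split.
- apply/approximating_sequenceP; split=> //.
    by move=> x; rewrite QE.
  by rewrite QE' => x; apply: tends0_sub k_ge (UI x).
- exists (C + 4); apply/(unconditional_withP _ gS); first by move=> i; case: (fQ i).
  split; first by rewrite addr_ge0.
  by rewrite QE'; apply: unconditional_subsequence.
- move=> a b ab N x hx.
  apply: ge_sup.
    by exists (nrm (\sum_(i < N) 1 *: x i)), (fun=> 1) => // i.
  move=> _ [e Se <-].
  have split' i : exists2 j, (j < k i.+1)%N & splits S U (k i) j (g i.+1 / g i - 1).
    by have [_ h] := hJ (k i, i); exists (J (k i, i)).
  have hx' i : (i < N)%N -> exists z, x i = U (k (b i)) z - U (k (a i)) z.
    by move=> /hx[z _ <-]; exists z; rewrite !QE.
  have g0 : g 0%N = 1 by rewrite /g expr0 subrr mulr0 addr0.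
  have := telescoped_signs gS lU chU g0 g_mono g_gt0 kS split' ab hx' (leqnn N) Se.
  rewrite [X in _ + X]big_geq // addr0 !big_mkord => /le_trans; apply.
  rewrite ler_wpM2r ?nrm_ge0 //.
  case: (N) => [|m]; first by rewrite lerDl ltW.
  by rewrite /g lerD2l ger_pMr // gerBl.
Qed.

End skipped_blocking.

(** * From umap to a commuting sequence *)

Section near_reflections.
Variables (R : realType) (F : scalar_field).
Local Notation K := (scalars R F).
Variables (S : set K) (X : normedModType K).
Hypothesis gS : sign_group S.
Implicit Types T : nat -> X -> X.
Implicit Types f g : X -> X.

(** For [e = -1] the operator is Id - 2 f, a reflection when [f] is a projection. *)
Definition near_reflection (h : R) f : Prop :=
  forall e, S e -> opbound (1 + h) (fun x => e *: f x + (x - f x)).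

Lemma near_reflectionW h h' f :
  h <= h' -> near_reflection h f -> near_reflection h' f.
Proof. by move=> hh nf e Se; apply: opboundW (nf e Se); rewrite lerD2l. Qed.

Lemma near_reflection_perturb h th f g : near_reflection h f ->
  opbound th (fun x => g x - f x) -> near_reflection (h + (th + th)) g.
Proof.
have [_ _ Sa _ _] := gS; move=> nf gf e Se x.
have -> : e *: g x + (x - g x) =
    (e *: f x + (x - f x)) + (e *: (g x - f x) - (g x - f x)).
  rewrite addrACA -scalerDr [f x + _]addrC subrK; congr (_ + _).
  by rewrite opprB addrA subrK.
apply: le_trans (nrmD _ _) _; rewrite (addrA 1 h) mulrDl.
apply: lerD; first exact: nf.
by apply: le_trans (nrmB _ _) _; rewrite nrmZ Sa // mul1r mulrDl lerD.
Qed.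

Lemma near_reflection_bound h f : near_reflection h f -> opbound (1 + h / 2) f.
Proof.
have [_ Sm1 _ _ _] := gS; move=> nf x.
have : nrm (2 *: f x) <= nrm x + nrm (-1 *: f x + (x - f x)).
  have -> : 2 *: f x = x - (-1 *: f x + (x - f x)).
    by rewrite scaleN1r addrCA -opprD opprB addrC subrK scaler_nat mulr2n.
  exact: nrmB.
rewrite nrmZ absr_nat; have := nf _ Sm1 x; lra.
Qed.

Lemma near_reflection_average h (N : nat) (f : nat -> X -> X) : (0 < N)%N ->
  (forall i, (i < N)%N -> near_reflection h (f i)) ->
  near_reflection h (fun x => N%:R^-1 *: \sum_(i < N) f i x).
Proof.
move=> N0 nf e Se x.
have N00 : (N%:R : K) != 0 by rewrite pnatr_eq0 -lt0n.
have -> : e *: (N%:R^-1 *: \sum_(i < N) f i x) +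
    (x - N%:R^-1 *: \sum_(i < N) f i x) =
    N%:R^-1 *: \sum_(i < N) (e *: f i x + (x - f i x)).
  rewrite big_split sumrB /= sumr_const card_ord -scaler_sumr !scalerDr scalerN.
  by rewrite -[x *+ N]scaler_nat !scalerA mulVf // scale1r [e * _]mulrC.
rewrite nrmZ absrV absr_nat ler_pdivrMl ?ltr0n //.
apply: le_trans (nrm_sum _ _ _) _.
rewrite mulr_natl -[N in leRHS]card_ord -sumr_const; apply: ler_sum => i _.
exact: nf.
Qed.

(** The signs are [e] up to [j] and 1 from there to a large [n], where [T n x] is close to [x]. *)
Lemma unconditional_reflection C T j : (forall x, T 0%N x = 0) ->
  strongly_to_id T -> unconditional_bound S C T -> forall e, S e ->
  opbound C (fun x => e *: T j x + (x - T j x)).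
Proof.
have [S1 _ _ _ _] := gS; move=> T0 TI uT e Se x.
apply/ler_addgt0Pr => d d0; have [N hN] := TI x d d0.
pose n := (j + N)%N.
have h := uT n (fun k => if (k <= j)%N then e else 1) _ x.
rewrite signed_sum_cat scale1r in h.
have e1 : signed_sum T (fun=> e) j x = e *: T j x.
  rewrite -(signed_sum1 j x T0) /signed_sum scaler_sumr.
  by apply: eq_bigr => i _; rewrite scale1r.
rewrite e1 in h.
have -> : e *: T j x + (x - T j x) = (e *: T j x + (T n x - T j x)) - (T n x - x).
  by rewrite -addrA; congr (_ + _); rewrite addrAC opprB [T n x + _]addrC subrK.
apply: le_trans (nrmB _ _) _; apply: lerD; last by apply: hN; apply: leq_addl.
by apply: h => k; case: ifP.
Qed.

(** The half of [chain] that [left_perturbation] yields. *)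
Definition left_chain T : Prop := forall i j x, (i < j)%N -> T j (T i x) = T i x.

(** Each step draws on a new sequence from umap, with a constant adapted to [h]. Strong convergence
    is secured by one fixed sequence [V]: the [k]-th operator is also chosen to be almost the
    identity on the range of [V k]. *)
Lemma umap_left_chain (h : nat -> R) : (forall j, 0 < h j <= 1) ->
  umap S X ->
  exists T, [/\ forall x, T 0%N x = 0, forall j, finite_operator (T j),
    left_chain T, forall j, near_reflection (h j) (T j) & strongly_to_id T].
Proof.
have [_ _ Sa _ _] := gS; move=> h01 uX.
have h0 j : 0 < h j by case/andP: (h01 j).
have [V [/approximating_sequenceP[V0 fV VI] _]] := uX 1 ltr01.
have step k f : finite_operator f -> exists g, [/\ finite_operator g,
    forall x, g (f x) = f x, near_reflection (h k) g &
    opbound (2^-1 ^+ k) (fun x => g (V k x) - V k x)].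
  move=> ff; have h2 : 0 < h k / 2 by rewrite divr_gt0.
  have [T [/approximating_sequenceP[T0 fT TI] uT']] := uX _ h2.
  have bT j : bounded_linear (T j) by have [] := fT j.
  have [_ uT] := (unconditional_withP _ gS bT).1 uT'.
  have [c c0 Vc] := bounded_opbound (fV k).1.2.
  have p0 : 0 < (2^-1 : R) ^+ k / 2 by rewrite divr_gt0 // half_pow_gt0.
  pose th := Num.min (h k / 4) (2^-1 ^+ k / 2 / c).
  have th0 : 0 < th by rewrite lt_min !divr_gt0 // half_pow_gt0.
  have [M hM] := finite_operator_uniform (fV k) (fun j => linear_fun_linear (T
    j)) TI p0.
  have [m [g [Mm fg gf gT]]] := left_perturbation fT TI M ff th0.
  exists g; split=> //.
    have n1 : near_reflection (h k / 2) (T m).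
      by move=> e Se; apply: (unconditional_reflection m T0 TI uT Se).
    apply: near_reflectionW (near_reflection_perturb n1 gT).
    have : th <= h k / 4 by rewrite ge_min lexx.
    lra.
  move=> x; have -> : g (V k x) - V k x =
    (g (V k x) - T m (V k x)) + (T m (V k x) - V k x).
    by rewrite addrA subrK.
  apply: le_trans (nrmD _ _) _; rewrite [2^-1 ^+ k]splitr mulrDl.
  apply: lerD; last exact: hM.
  apply: le_trans (gT _) _; apply: le_trans (_ : th * (c * nrm x) <= _).
    by rewrite ler_pM2l.
  rewrite mulrA ler_wpM2r ?nrm_ge0 // -ler_pdivlMr //.
  by rewrite ge_min lexx orbT.
have /choice[st hst] : forall p : nat * (X -> X), exists g, finite_operator p.2 ->
    [/\ finite_operator g, forall x, g (p.2 x) = p.2 x, near_reflection (h p.1) g &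
    opbound (2^-1 ^+ p.1) (fun x => g (V p.1 x) - V p.1 x)].
  move=> [k f] /=; have [/(step k)[g hg]|] := pselect (finite_operator f).
    by exists g.
  by exists f.
pose T := fix T j := if j is j'.+1 then st (j, T j') else fun _ : X => 0 : X.
have fT j : finite_operator (T j).
  elim: j => [|j ih] /=; first exact: finite_operator_zero.
  by have [] := hst (j.+1, T j) ih.
have TS j := hst (j.+1, T j) (fT j).
have nT j : near_reflection (h j) (T j).
  case: j => [|j]; last by have [] := TS j.
  by move=> e Se x; rewrite /= scaler0 add0r subr0 ler_peMl ?nrm_ge0 // lerDl ltW.
exists T; split=> //.
- move=> i j + ij; elim: j ij => // j ih; rewrite ltnS leq_eqVlt => /orP[/eqP->|ij] x.
    by have [_ h1 _ _] := TS j; apply: h1.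
  have [_ h1 _ _] := TS j; rewrite -{1}(ih ij x).
  by apply: etrans (h1 _) _; apply: ih.
- move=> x e e0.
  (* As [h <= 1], the operator [T k.+1] has norm at most 3/2, and 3/2 + 1 <= 3. *)
  have bound k : nrm (T k.+1 x - x) <= 3 * nrm (V k.+1 x - x) + nrm x * 2^-1 ^+ k.+1.
    have lT : linear (T k.+1) by have [[]] := fT k.+1.
    have -> : T k.+1 x - x = - T k.+1 (V k.+1 x - x) +
        (T k.+1 (V k.+1 x) - V k.+1 x) + (V k.+1 x - x).
      by rewrite (linB _ _ lT) opprB !addrA !subrK.
    have h1 := near_reflection_bound (nT k.+1) (V k.+1 x - x).
    have [_ _ _ h2] := TS k.
    have h3 := nrmD (- T k.+1 (V k.+1 x - x) +
      (T k.+1 (V k.+1 x) - V k.+1 x)) (V k.+1 x - x).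
    have h4 := nrmD (- T k.+1 (V k.+1 x - x)) (T k.+1 (V k.+1 x) - V k.+1 x).
    rewrite nrmN in h4; have {}h2 := h2 x; rewrite /= in h2 h1 h3 h4 *.
    have /andP[_ h5] := h01 k.+1.
    have : nrm (V k.+1 x - x) * h k.+1 <= nrm (V k.+1 x - x).
      by rewrite ler_piMr // nrm_ge0.
    have := nrm_ge0 (V k.+1 x - x); lra.
  have h1 := tends0D (tends0Z 3 (VI x) (fun _ => nrm_ge0 _))
    (tends0Z (nrm x) (@half_pow_tends0 R) (fun j => ltW (half_pow_gt0 R j))).
  have [N hN] := h1 e e0; exists N.+1 => -[//|n] Nn.
  by apply: le_trans (bound n) _; apply: hN; apply: ltnW.
Qed.

End near_reflections.

(** * Products of the constants of near reflections *)

Section growth.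
Variable R : realType.

(** A closed form that dominates the products of the factors [1 + 2^-1 ^+ k.+2] and stays below
    2. *)
Definition growth (k : nat) : R := 2 - 2^-1 ^+ k.

Lemma growth_ge1 k : 1 <= growth k.
Proof.
have : (2^-1 : R) ^+ k <= 1 by rewrite exprn_ile1 ?invr_ge0 ?invf_le1 ?ler1n.
rewrite /growth; lra.
Qed.

Lemma growth_le2 k : growth k <= 2.
Proof. by rewrite gerBl ltW // half_pow_gt0. Qed.

Lemma growthS k : (1 + 2^-1 ^+ k.+2) * growth k <= growth k.+1.
Proof.
have := half_pow_gt0 R k; rewrite /growth !exprS; set t := _ ^+ k => t0.
have -> : (1 + 2^-1 * (2^-1 * t)) * (2 - t) = 2 - 2^-1 * t - t * t / 4 by field.
by rewrite gerBl divr_ge0 // mulr_ge0 // ltW.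
Qed.

(** Convexity gives (1 + t)^L <= 1 + (2^L - 1) t for t between 0 and 1; take t = 2^-j. *)
Lemma half_pow_word L j : (L <= j)%N -> (1 + 2^-1 ^+ j : R) ^+ L <= 2.
Proof.
move=> Lj.
suff h : (1 + 2^-1 ^+ j : R) ^+ L <= 1 + (2 ^+ L - 1) * 2^-1 ^+ j.
  apply: le_trans h _; have : (2 : R) ^+ L * 2^-1 ^+ j <= 1.
    rewrite exprVn -ler_pdivlMr ?invr_gt0 ?exprn_gt0 // invrK mul1r.
    by rewrite ler_eXn2l // ltr1n.
  have := half_pow_gt0 R j; lra.
have t0 := half_pow_gt0 R j.
have t1 : (2^-1 : R) ^+ j <= 1 by rewrite exprn_ile1 ?invr_ge0 ?invf_le1 ?ler1n.
elim: L {Lj} => [|L ih]; first by rewrite !expr0 subrr mul0r addr0.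
rewrite exprS; move: t0 t1 ih; set t := _ ^+ j => t0 t1 ih.
have w1 : (1 : R) <= 2 ^+ L by rewrite exprn_ege1 // ler1n.
apply: le_trans (ler_wpM2l _ ih) _; first by rewrite addr_ge0 // ltW.
rewrite exprS; move: w1; set w := (2 : R) ^+ L => w1.
have : (w - 1) * (t * t) <= (w - 1) * t.
  by rewrite ler_wpM2l ?subr_ge0 // ler_piMr // ltW.
nra.
Qed.

End growth.

Section sign_averaging.
Variables (R : realType) (F : scalar_field).
Local Notation K := (scalars R F).
Variable X : normedModType K.

(* Averaging over the sign of the last term kills the off-diagonal products
   with that term; [A0] and [B0] collect the terms with a fixed sign. *)
Lemma sign_average (N : nat) (A : nat -> X -> X) (B : nat -> X) A0 B0 c :
  (forall i, linear (A i)) -> linear A0 ->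
  (forall th : nat -> K, signs th ->
     nrm (A0 (B0 + \sum_(j < N) th j *: B j) +
          \sum_(i < N) th i *: A i (B0 + \sum_(j < N) th j *: B j)) <= c) ->
  nrm (A0 B0 + \sum_(i < N) A i (B i)) <= c.
Proof.
move=> lA; elim: N A0 B0 => [|N ih] A0 B0 lA0 h.
  by have := h (fun=> 1) (fun=> or_introl erefl); rewrite !big_ord0 !addr0.
have half s : s = 1 \/ s = -1 -> nrm (A0 (B0 + s *: B N) + s *: A N (B0 + s *: B N) +
    \sum_(i < N) A i (B i)) <= c.
  move=> s1; apply: (ih (fun x => A0 x + s *: A N x) (B0 + s *: B N)).
    by apply/linear_add/linear_scale.
  move=> th sth; have := h (fun i => if (i < N)%N then th i else s) _.
  rewrite !big_ord_recr /= ltnn.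
  have e1 : \sum_(j < N) (if (j < N)%N then th j else s) *: B j =
    \sum_(j < N) th j *: B j.
    by apply: eq_bigr => j _; rewrite ltn_ord.
  rewrite e1 -(addrA B0) [_ *: B N + _]addrC; set v := B0 + _.
  have -> : \sum_(i < N) (if (i < N)%N then th i else s) *: A i v =
    \sum_(i < N) th i *: A i v.
    by apply: eq_bigr => j _; rewrite ltn_ord.
  rewrite -addrA [\sum_(i < N) _ + _]addrC; apply => j.
  by case: ifP.
have h1 := half 1 (or_introl erefl); have h2 := half (-1) (or_intror erefl).
rewrite !scale1r !scaleN1r in h1 h2; set s := \sum_(i < N) _ in h1 h2.
rewrite big_ord_recr /= -/s.
rewrite (linD _ _ lA0) (linD _ _ (lA N)) in h1.
rewrite (linB _ _ lA0) (linB _ _ (lA N)) opprB [A N (B N) - _]addrC in h2.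
move: h1 h2; set p := A0 B0; set q := A0 (B N); set r := A N B0; set t := A N (B N).
have -> : p + q + (r + t) + s = p + (s + t) + (q + r).
  by rewrite (AC ((2*2)*1)%AC ((1*(5*4))*(2*3))%AC).
have -> : p - q + (- r + t) + s = p + (s + t) - (q + r).
  by rewrite opprD (AC ((2*2)*1)%AC ((1*(5*4))*(2*3))%AC).
move=> h1 h2; have : nrm (2 *: (p + (s + t))) <= c + c.
  apply: le_trans (lerD h1 h2); move: (p + (s + t)) (q + r) => v w.
  have -> : 2 *: v = (v + w) + (v - w).
    by rewrite addrACA subrr addr0 scaler_nat mulr2n.
  exact: nrmD.
rewrite nrmZ absr_nat; lra.
Qed.

End sign_averaging.

(** * Averages over triples of a left chain *)

Section left_chain.
Variables (R : realType) (F : scalar_field).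
Local Notation K := (scalars R F).
Variables (S : set K) (X : normedModType K).
Hypothesis gS : sign_group S.
Variable T : nat -> X -> X.
Hypotheses (lT : forall j, linear (T j)) (T0 : forall x, T 0%N x = 0).
Hypotheses (chT : left_chain T).
Hypothesis nT : forall j, near_reflection S (2^-1 ^+ j.+2) (T j).

(** The operator e_(n+1) T_(n+1) + (Id - T_(n+1)) maps the expression for [n] with signs e_k /
    e_(n+1) to the expression for [n.+1], because T_(n+1) fixes the ranges of its predecessors. *)
Lemma left_chain_signs e n x : (forall k, S (e k)) ->
  nrm (signed_sum T e n x + (x - T n x)) <= growth R n * nrm x.
Proof.
have [S1 _ Sa SM SV] := gS.
elim: n e => [|n ih] e Se.
  by rewrite /signed_sum big_ord0 T0 subr0 add0r ler_peMl ?nrm_ge0 ?growth_ge1.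
have w0 : e n.+1 != 0.
  by apply/eqP => er; have := Sa _ (Se n.+1); rewrite er absr0 => /eqP;
    rewrite eq_sym oner_eq0.
pose f k := e k / e n.+1.
have Sf k : S (f k) by apply/SM/SV.
set v := signed_sum T f n x; pose a := v + (x - T n x).
have Tv : T n.+1 v = v.
  rewrite /v /signed_sum (lin_sum _ _ _ (lT _)); apply: eq_bigr => k _.
  rewrite (linZ _ _ (lT _)) (linB _ _ (lT _)) !chT //.
    by rewrite ltnS ltnW.
  by rewrite ltnS.
have Ta : T n.+1 a = v + (T n.+1 x - T n x).
  by rewrite /a (linD _ _ (lT _)) (linB _ _ (lT _)) Tv chT.
have -> : signed_sum T e n.+1 x + (x - T n.+1 x) = e n.+1 *: T n.+1 a + (a - T n.+1 a).
  rewrite Ta /a opprD addrACA subrr add0r opprB [x - _ + _]addrA subrK.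
  congr (_ + _); rewrite scalerDr /signed_sum big_ord_recr /=; congr (_ + _).
  rewrite /v /signed_sum scaler_sumr; apply: eq_bigr => k _.
  by rewrite scalerA /f mulrC divfK.
have := nT n.+1 (Se n.+1) a => /le_trans; apply.
apply: le_trans (ler_wpM2l _ (ih f Sf)) _.
  by rewrite addr_ge0 // ltW // half_pow_gt0.
rewrite mulrA ler_wpM2r ?nrm_ge0 //; apply: le_trans (growthS R n).
rewrite ler_wpM2r ?(le_trans ler01 (growth_ge1 R n)) // lerD2l.
by rewrite [leLHS]exprS ler_piMl ?invf_le1 ?ler1n // ltW // half_pow_gt0.
Qed.

(** Twice the sum is a difference of two sums from [left_chain_signs]: where the coefficient is 0
    both have the sign 1, and these terms cancel, as does x - T n x. *)
Lemma coefficients_bound c n : (forall k, c k = 0 \/ (c k = 1 \/ c k = -1)) ->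
  opbound 2 (signed_sum T c n).
Proof.
have [S1 Sm1 _ _ _] := gS.
move=> hc x; pose e (s : K) k := if c k == 0 then 1 else s * c k.
have Se s k : s = 1 \/ s = -1 -> S (e s k).
  move=> [->|->]; rewrite /e; case: eqP => // ck.
    by rewrite mul1r; have [/ck|[->|->]] := hc k.
  by rewrite mulN1r; have [/ck|[->|->]] := hc k; rewrite ?opprK.
have h1 := left_chain_signs n x (fun k => Se 1 k (or_introl erefl)).
have h2 := left_chain_signs n x (fun k => Se (-1) k (or_intror erefl)).
have : nrm (2 *: signed_sum T c n x) <= growth R n * nrm x + growth R n * nrm x.
  have -> : 2 *: signed_sum T c n x = (signed_sum T (e 1) n x + (x - T n x)) -
     (signed_sum T (e (-1)) n x + (x - T n x)).
    rewrite opprD addrACA subrr addr0 scaler_sumr -sumrB; apply: eq_bigr => k _.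
    rewrite -scalerBl scalerA; congr (_ *: _); rewrite /e; case: eqP => [->|_].
      by rewrite subrr mulr0.
    by rewrite mul1r mulN1r opprK mulr_natl mulr2n.
  exact: le_trans (nrmB _ _) (lerD h1 h2).
rewrite nrmZ absr_nat; have : growth R n * nrm x <= 2 * nrm x.
  by rewrite ler_wpM2r ?nrm_ge0 ?growth_le2.
lra.
Qed.

(** An instance of [coefficients_bound], with coefficient [th i] at increment number P + 3 i + o + 1
    and 0 at the other two offsets of each triple. *)
Lemma block_signs (P N o : nat) (th : nat -> K) x : (o < 3)%N -> signs th ->
  nrm (\sum_(i < N) th i *: (T (P + 3 * i + o).+1 x - T (P + 3 * i + o)%N x))
  <= 2 * nrm x.
Proof.
move=> o3 sth.
pose c m := if (P < m)%N && ((m - P.+1) %% 3 == o)%N then th ((m - P.+1) %/ 3)%N else 0.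
suff -> : \sum_(i < N) th i *: (T (P + 3 * i + o).+1 x - T (P + 3 * i + o)%N x) =
    signed_sum T c (P + 3 * N) x.
  apply: coefficients_bound => k; rewrite /c; case: ifP => _; last by left.
  by right; apply: sth.
elim: N => [|N ih].
  rewrite big_ord0 muln0 addn0 /signed_sum big1 // => k _.
  by rewrite /c ltnNge ltn_ord /= scale0r.
have cE r : (r < 3)%N -> c (P + 3 * N + r).+1 = if r == o then th N else 0.
  move=> r3; rewrite /c subSS -addnA leq_addr addKn mulnC modnMDl divnMDl //.
  by rewrite modn_small // divn_small // addn0.
rewrite big_ord_recr /= ih mulnS [(3 + _)%N]addnC addnA.
rewrite [in RHS]/signed_sum addn3 !big_ord_recr /= -/(signed_sum T c (P + 3 * N) x).
rewrite -!addrA; congr (_ + _).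
have := cE 0%N isT; rewrite addn0 => ->.
have := cE 1%N isT; rewrite addn1 => ->.
have := cE 2%N isT; rewrite addn2 => ->.
case: o o3 {c ih cE} => [|[|[|]]] // _ /=; rewrite !scale0r ?add0r ?addr0.
- by rewrite addn0.
- by rewrite addn1.
- by rewrite addn2.
Qed.

Section groups.
Variables P N : nat.

Let c (i : nat) : nat := (P + 3 * i)%N.

Definition low_block i (x : X) : X := T (c i).+1 x - T (c i) x.
Definition high_block i (x : X) : X := T (c i).+2 x - T (c i).+1 x.

(* The triple of indices [c i < (c i).+1 < (c i).+2] defines the blocks. On the
   kernel of [T m], the [k]-th power of [(Id - 2 T m) (Id - 2 T (c i).+1)] is
   [Id + 2 k T (c i) + 2 correction 1 (- 2) k i] (lemma [refl_word]), and
   [(Id - T (c i).+1)^k = Id - T (c i) - correction 0 1 k i]. *)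
Fixpoint correction (p q : K) (k i : nat) (x : X) : X :=
  if k is k'.+1 then
    low_block i x + p *: correction p q k' i x +
    q *: high_block i (correction p q k' i x)
  else 0.

Fixpoint correction_bound (p q : K) (k : nat) : R :=
  if k is k'.+1 then
    2 + absr p * correction_bound p q k' + absr q * (2 * correction_bound p q k')
  else 0.

Lemma correction_bound_ge0 p q k : 0 <= correction_bound p q k.
Proof.
elim: k => //= k ih.
by rewrite !addr_ge0 // ?mulr_ge0 ?absr_ge0 // mulr_ge0.
Qed.

Lemma correction_fixed p q k i x :
  T (c i).+2 (correction p q k i x) = correction p q k i x.
Proof.
elim: k => [|k ih] /=; first by rewrite lin0.
rewrite 2!(linD _ _ (lT _)) 2!(linZ _ _ (lT _)) ih; congr (_ + _ + _ *: _).
  by rewrite /low_block (linB _ _ (lT _)) !chT.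
by rewrite /high_block (linB _ _ (lT _)) ih ih chT.
Qed.

(** The third index of the triple serves here: it turns the complement of [T (c i).+1] into an
    increment, to which [block_signs] applies. *)
Lemma correction_high p q k i x :
  high_block i (correction p q k i x) =
  correction p q k i x - T (c i).+1 (correction p q k i x).
Proof. by rewrite /high_block correction_fixed. Qed.

(** The bound is independent of [N]. The term with [q] pairs each high block with a vector of the
    same index; [sign_average] passes from this diagonal sum to a product of two signed sums, the
    outer one bounded by [block_signs] and the inner one by induction. *)
Lemma correction_signs p q k th x : signs th ->
  nrm (\sum_(i < N) th i *: correction p q k i x) <= correction_bound p q k * nrm x.
Proof.
elim: k th => [|k ih] th sth /=.
  by rewrite big1 ?nrm0 ?mul0r // => i _; rewrite scaler0.
have -> : \sum_(i < N) th i *: (low_block i x + p *: correction p q k i x +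
      q *: high_block i (correction p q k i x)) =
    \sum_(i < N) th i *: low_block i x +
    p *: \sum_(i < N) th i *: correction p q k i x +
    q *: (0 + \sum_(i < N) high_block i (th i *: correction p q k i x)).
  rewrite add0r !scaler_sumr -!big_split; apply: eq_bigr => i _ /=.
  rewrite 2!scalerDr; congr (_ + _ + _); first by rewrite !scalerA mulrC.
  by rewrite /high_block !(linZ _ _ (lT _)) -scalerBr !scalerA mulrC.
apply: le_trans (nrmD _ _) _; rewrite mulrDl; apply: lerD; last first.
  rewrite nrmZ -mulrA ler_wpM2l ?absr_ge0 //.
  apply: (@sign_average _ _ _ N high_block (fun i => th i *: correction p q k i
    x) (fun=> 0) 0).
  - by move=> i; apply: linear_sub.
  - exact: linear_zero.
  - move=> d sd; rewrite !add0r;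
    apply: le_trans (_ : 2 * nrm (\sum_(j < N) d j *: (th j *: correction p q k
    j x)) <= _).
      have := block_signs P N (\sum_(j < N) d j *: (th j *: correction p q k j
        x)) (isT : (1 < 3)%N) sd.
      congr (nrm _ <= _); apply: eq_bigr => i _.
      by rewrite /high_block /c addn1.
    rewrite -mulrA ler_wpM2l //.
    have sdt : signs (fun i => d i * th i).
      move=> i; case: (sd i) (sth i) => -> [] ->;
        rewrite ?mulN1r ?mul1r ?opprK; by [left|right].
    have := ih _ sdt; congr (nrm _ <= _); apply: eq_bigr => i _.
    by rewrite scalerA.
apply: le_trans (nrmD _ _) _; rewrite mulrDl; apply: lerD.
  have := block_signs P N x (isT : (0 < 3)%N) sth.
  congr (nrm _ <= _); apply: eq_bigr => i _.
  by rewrite /low_block /c addn0.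
by rewrite nrmZ -mulrA ler_wpM2l ?absr_ge0 // ih.
Qed.

Definition group_average (x : X) : X := N%:R^-1 *: \sum_(i < N) T (c i) x.

Definition refl (f : X -> X) (x : X) : X := x - 2 *: f x.

Lemma linear_refl f : linear f -> linear (refl f).
Proof. by move=> lf; apply/linear_sub/linear_scale. Qed.

Let b : R := 1 + 2^-1 ^+ P.

Let b_ge1 : 1 <= b.
Proof. by rewrite lerDl ltW // half_pow_gt0. Qed.

Lemma refl_bound j : (P <= j)%N -> opbound b (refl (T j)).
Proof.
have [_ Sm1 _ _ _] := gS; move=> Pj x.
have -> : refl (T j) x = -1 *: T j x + (x - T j x).
  by rewrite scaleN1r addrCA -opprD /refl scaler_nat mulr2n.
apply: le_trans (nT j Sm1 x) _; rewrite ler_wpM2r ?nrm_ge0 // lerD2l.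
rewrite -(subnKC Pj) -addnS -addnS exprD ler_piMr ?(ltW (half_pow_gt0 _ _)) //.
by rewrite exprn_ile1 ?invr_ge0 ?invf_le1 ?ler1n.
Qed.

(** Another application of [G] sends [z] to z + 2 T (c i) z + 2 low_block i z - 2 T m z, fixes
    [T (c i) z], and sends a correction [E] to E - 2 high_block i E: this is the recursion of
    [correction] for 1 and -2. The terms with [T m z] go into [r]. *)
Lemma refl_word m i k z : (i < N)%N -> (P + 3 * N <= m)%N -> exists2 r : X,
  iter k (fun v => refl (T m) (refl (T (c i).+1) v)) z =
    z + (2 * k)%:R *: T (c i) z + 2 *: correction 1 (- 2) k i z + r &
  nrm r <= (2 * k)%:R * b ^+ (2 * k) * nrm (T m z).
Proof.
move=> iN mN; pose G v := refl (T m) (refl (T (c i).+1) v); rewrite -/G.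
have cm : ((c i).+2 < m)%N by rewrite /c; lia.
have Pc : (P <= (c i).+1)%N by rewrite /c; lia.
have Pm : (P <= m)%N by lia.
have lG : linear G by apply: linear_comp; apply: linear_refl.
have bG : opbound (b * b) G.
  apply: opbound_comp; [exact: le_trans ler01 b_ge1 | exact: refl_bound..].
have Gz : G z = z + 2 *: T (c i).+1 z - 2 *: T m z.
  rewrite /G /refl (linB _ _ (lT m)) (linZ _ _ (lT m)) chT; last exact: ltnW.
  by rewrite scalerBr opprB [2 *: (2 *: _)]scaler_nat mulr2n !addrA subrK.
(* [refl (T m)] is -Id on vectors fixed by [T m]. *)
have Gfix u : T m u = u -> T m (T (c i).+1 u) = T (c i).+1 u ->
    G u = 2 *: T (c i).+1 u - u.
  move=> u1 u2; rewrite /G; set v := refl _ u.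
  have Tv : T m v = v by rewrite /v /refl (linB _ _ (lT m)) (linZ _ _ (lT m)) u1 u2.
  by rewrite /refl Tv scaler_nat mulr2n opprD addrA subrr add0r opprB.
pose t := T (c i) z.
have Gt : G t = t.
  have pt : T (c i).+1 t = t by rewrite /t chT.
  have h1 : T m t = t by rewrite /t chT // (ltn_trans _ cm) // ltnW.
  have h2 : T m (T (c i).+1 t) = T (c i).+1 t by rewrite pt.
  by rewrite (Gfix t h1 h2) pt scaler_nat mulr2n addrK.
elim: k => [|k [r rE rb]].
  exists 0; last by rewrite nrm0 !mul0r.
  by rewrite /= muln0 scale0r scaler0 !addr0.
set E := correction 1 (-2) k i z in rE.
have TE : T m E = E by rewrite /E -(correction_fixed 1 (-2) k i z) chT.
have GE : G E = E - 2 *: high_block i E.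
  have h2 : T m (T (c i).+1 E) = T (c i).+1 E by rewrite chT // ltnW.
  rewrite (Gfix E TE h2).
  rewrite [high_block _ _]correction_high -/E; move: (T _ E) => p.
  rewrite scalerBr opprB addrCA; congr (_ + _).
  by rewrite scaler_nat mulr2n opprD addrA subrr add0r.
exists (G r - 2 *: T m z); last first.
  have bz := bG r; have n0 := nrm_ge0 (T m z).
  apply: le_trans (nrmB _ _) _; rewrite nrmZ absr_nat.
  apply: le_trans (lerD (le_trans bz (ler_wpM2l _ rb)) (lexx _)) _.
    by rewrite mulr_ge0 // (le_trans ler01 b_ge1).
  rewrite mulnS natrD exprD expr2.
  have b1 : 1 <= b * b * b ^+ (2 * k).
    by rewrite -expr2 -exprD exprn_ege1 // b_ge1.
  have h2 : 2 * nrm (T m z) <= 2 * (b * b * b ^+ (2 * k)) * nrm (T m z).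
    by apply: ler_wpM2r => //; rewrite ler_peMr.
  move: h2; move: (b ^+ _) (nrm _) ((2 * k)%:R) => B n' kk h2.
  have -> : (2 + kk) * (b * b * B) * n' = b * b * (kk * B * n') + 2 * (b * b * B) * n'.
    by ring.
  by rewrite lerD2l.
rewrite /= rE -/t -/E !(linD _ _ lG) !(linZ _ _ lG) Gt GE Gz.
have -> : T (c i).+1 z = t + low_block i z by rewrite /low_block addrC subrK.
rewrite -/E; move: (low_block i z) (high_block i E) (G r) (T m z) => lb hb gr tm.
rewrite mulnS natrD [1 *: E]scale1r !scalerDr !scalerN scaleNr scalerN (scalerDl t 2).
by rewrite [LHS](AC (1*2*1*1*2*1)%AC (1*(2*5)*((3*6)*7)*(8*4))%AC).
Qed.

(* Powers of a near contraction stay bounded while the term [2 n T (c i) z] grows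
   linearly in [n]; averaging over [i] makes the corrections negligible. *)
Lemma average_small n m z : (0 < n)%N -> (0 < N)%N -> (2 * n <= P)%N ->
  (P + 3 * N <= m)%N ->
  nrm (group_average z) <=
    (3 / (2 * n%:R) + correction_bound 1 (- 2) n / (n%:R * N%:R)) * nrm z +
    2 * nrm (T m z).
Proof.
move=> n0 N0 nP mN; set kap := correction_bound _ _ _.
have bn : b ^+ (2 * n) <= 2 by apply: half_pow_word.
have b0 : 0 <= b by apply: le_trans ler01 b_ge1.
pose G i v := refl (T m) (refl (T (c i).+1) v).
have /choice[r hr] : forall i, exists r, (i < N)%N ->
    iter n (G i) z = z + (2 * n)%:R *: T (c i) z + 2 *: correction 1 (- 2) n i z + r /\
    nrm r <= (2 * n)%:R * b ^+ (2 * n) * nrm (T m z).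
  move=> i; have [iN|iN] := ltnP i N; last by exists 0.
  by have [r h1 h2] := refl_word n z iN mN; exists r.
have itb i : (i < N)%N -> nrm (iter n (G i) z) <= 2 * nrm z.
  move=> iN; have bG : opbound (b * b) (G i).
    by apply: opbound_comp => //; apply: refl_bound; rewrite /c; lia.
  apply: le_trans (opbound_iter n _ bG z) _; first exact: mulr_ge0.
  by rewrite ler_wpM2r ?nrm_ge0 // -expr2 -exprM.
have main : nrm ((2 * n)%:R *: \sum_(i < N) T (c i) z) <=
    N%:R * (3 * nrm z) + 2 * (kap * nrm z) + N%:R * ((2 * n)%:R * 2 * nrm (T m z)).
  have -> : (2 * n)%:R *: \sum_(i < N) T (c i) z =
     \sum_(i < N) (iter n (G i) z - z) - 2 *: \sum_(i < N) correction 1 (- 2) n i z -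
     \sum_(i < N) r i.
    rewrite !scaler_sumr -!sumrB; apply: eq_bigr => i _ /=.
    have [-> _] := hr i (ltn_ord i).
    move: (T _ z) (correction _ _ _ _ _) (r i) => p q t.
    generalize ((2 * n)%:R *: p) (2 *: q) => u v.
    have -> : z + u + v + t - z - v - t = (z - z) + (u + (v - v) + (t - t)).
      by rewrite [LHS](AC (1*1*1*1*1*1*1)%AC ((1*5)*(2*(3*6)*(4*7)))%AC).
    by rewrite !subrr !addr0 add0r.
  apply: le_trans (nrmB _ _) _; apply: lerD.
    apply: le_trans (nrmB _ _) _; apply: lerD.
      apply: le_trans (nrm_sum _ _ _) _.
      rewrite mulr_natl -[N in leRHS]card_ord -sumr_const; apply: ler_sum => i _.
      by apply: le_trans (nrmB _ _) _; have := itb i (ltn_ord i); lra.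
    rewrite nrmZ absr_nat ler_pM2l //.
    have := @correction_signs 1 (-2) n (fun=> 1) z (fun=> or_introl erefl).
    by congr (nrm _ <= _); apply: eq_bigr => i _; rewrite scale1r.
  apply: le_trans (nrm_sum _ _ _) _.
  rewrite mulr_natl -[N in leRHS]card_ord -sumr_const; apply: ler_sum => i _.
  have [_ h] := hr i (ltn_ord i); apply: le_trans h _.
  by rewrite ler_wpM2r ?nrm_ge0 // ler_wpM2l.
have nR : 0 < (n%:R : R) by rewrite ltr0n.
have NR : 0 < (N%:R : R) by rewrite ltr0n.
rewrite /group_average nrmZ absrV absr_nat ler_pdivrMl //.
rewrite nrmZ absr_nat in main.
have h2n : 0 < ((2 * n)%:R : R) by rewrite ltr0n muln_gt0.
rewrite -(ler_pM2l h2n); apply: le_trans main _.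
rewrite le_eqVlt; apply/orP; left; apply/eqP; rewrite natrM.
by field; rewrite !lt0r_neq0.
Qed.

Let D i (x : X) : X := x - T (c i).+1 x.

(** [D i] kills [T (c i) x] and sends a correction to its high block, which is the recursion for 0
    and 1. The formula starts at the first power, since power 0 lacks the term [T (c i) x]. *)
Lemma complement_iter k i x :
  iter k.+1 (D i) x = x - T (c i) x - correction 0 1 k.+1 i x.
Proof.
elim: k => [|k ih].
  rewrite /= /D scaler0 scale1r [high_block _ _](_ : _ = 0).
    by rewrite !addr0 /low_block opprB addrA subrK.
  by rewrite /high_block !(lin0 (lT _)) subrr.
rewrite iterS ih; set E := correction 0 1 k.+1 i x.
have -> : correction 0 1 k.+2 i x = low_block i x + (E - T (c i).+1 E).
  by rewrite -correction_high -/E [LHS]/= scale0r addr0 scale1r.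
clearbody E; rewrite /D !(linB _ _ (lT _)) chT // /low_block.
generalize (T (c i).+1 E) (T (c i) x) (T (c i).+1 x) => q t p.
rewrite !opprD !opprK !addrA.
by rewrite [LHS](AC (1*1*1*1*1*1)%AC (1*2*4*5*3*6)%AC).
Qed.

Let D_bound i : opbound b (D i).
Proof.
move=> x; have Pc : (P <= (c i).+1)%N by rewrite /c; lia.
have : nrm (2 *: D i x) <= nrm x + b * nrm x.
  have -> : 2 *: D i x = x + refl (T (c i).+1) x.
    by rewrite /D /refl scalerBr [2 *: x]scaler_nat mulr2n addrA.
  by apply: le_trans (nrmD _ _) _; rewrite lerD2l refl_bound.
rewrite nrmZ absr_nat => h; have := b_ge1; have := nrm_ge0 x => x0 b1.
have : nrm x <= b * nrm x by rewrite ler_peMl.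
lra.
Qed.

(* [M i] is a Cesaro mean of powers of [Id - T (c i).+1], so that [T (c i).+1 M i]
   telescopes. *)
Lemma complement_average j : (0 < j)%N -> (0 < N)%N -> (j.+1 <= P)%N ->
  exists M : nat -> X -> X, forall x,
  (forall i, (i < N)%N -> nrm (M i x) <= 2 * nrm x /\
     nrm (T (c i).+1 (M i x)) <= 4 / j%:R * nrm x) /\
  nrm (x - group_average x - N%:R^-1 *: \sum_(i < N) M i x) <=
     (\sum_(k < j) correction_bound 0 1 k.+1) / N%:R * nrm x.
Proof.
move=> j0 N0 jP.
have jR : 0 < (j%:R : R) by rewrite ltr0n.
have NR : 0 < (N%:R : R) by rewrite ltr0n.
have b0 : 0 <= b by apply: le_trans ler01 b_ge1.
have Db i k x : (k <= j.+1)%N -> nrm (iter k (D i) x) <= 2 * nrm x.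
  move=> kj; apply: le_trans (opbound_iter k b0 (@D_bound i) x) _.
  rewrite ler_wpM2r ?nrm_ge0 //; apply: half_pow_word.
  exact: leq_trans kj jP.
exists (fun i x => j%:R^-1 *: \sum_(k < j) iter k.+1 (D i) x) => x; split.
  move=> i iN; split; rewrite ?(linZ _ _ (lT _)) nrmZ absrV absr_nat.
    rewrite ler_pdivrMl //; apply: le_trans (nrm_sum _ _ _) _.
    rewrite [j%:R * _]mulr_natl -[j in leRHS]card_ord -sumr_const;
      apply: ler_sum => k _.
    by apply: Db; rewrite ltnS ltnW.
  rewrite (lin_sum _ _ _ (lT _)).
  have -> : \sum_(k < j) T (c i).+1 (iter k.+1 (D i) x) =
    iter 1 (D i) x - iter j.+1 (D i) x.
    transitivity (\sum_(k < j) (iter k.+1 (D i) x - iter k.+2 (D i) x)).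
      by apply: eq_bigr => k _; rewrite [iter k.+2 _ _]iterS {3}/D opprB addrC subrK.
    rewrite -(big_mkord xpredT (fun k => iter k.+1 (D i) x - iter k.+2 (D i) x)).
    have := telescope_sumr (fun k => - iter k.+1 (D i) x) (leq0n j).
    rewrite opprK addrC => <-; apply: eq_bigr => k _; by rewrite opprK addrC.
  rewrite [4 / _]mulrC -mulrA ler_pM2l ?invr_gt0 //.
  apply: le_trans (nrmB _ _) _.
  have := Db i 1%N x (ltnW (leqnn _ : (1 < 2)%N) : (1 <= j.+1)%N);
    have := Db i j.+1 x (leqnn _).
  lra.
have -> : x - group_average x - N%:R^-1 *: \sum_(i < N) (j%:R^-1 *: \sum_(k <
  j) iter k.+1 (D i) x)
   = N%:R^-1 *: (j%:R^-1 *: \sum_(k < j) \sum_(i < N) correction 0 1 k.+1 i x).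
  have ave (l : nat) (v : X) : (0 < l)%N -> l%:R^-1 *: \sum_(i < l) v = v.
    move=> l0; rewrite sumr_const card_ord -[v *+ l]scaler_nat scalerA mulVf
      ?scale1r //.
    by rewrite pnatr_eq0 -lt0n.
  have xN := ave N x N0.
  rewrite -{1}xN /group_average -!scalerBr -!sumrB; congr (_ *: _).
  rewrite exchange_big scaler_sumr; apply: eq_bigr => i _ /=.
  rewrite -{1}(ave j (x - T (c i) x) j0) -scalerBr -sumrB; congr (_ *: _);
    apply: eq_bigr => k _.
  by rewrite -iterS complement_iter opprB addrC subrK.
rewrite !nrmZ !absrV !absr_nat ler_pdivrMl // mulrA mulrCA mulfV ?mulr1 ?lt0r_neq0 //.
rewrite ler_pdivrMl //; apply: le_trans (nrm_sum _ _ _) _.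
apply: le_trans (_ : (\sum_(k < j) correction_bound 0 1 k.+1) * nrm x <= _).
  rewrite mulr_suml; apply: ler_sum => k _.
  have := @correction_signs 0 1 k.+1 (fun=> 1) x (fun=> or_introl erefl).
  by congr (nrm _ <= _); apply: eq_bigr => i _; rewrite scale1r.
rewrite ler_peMl ?ler1n // mulr_ge0 ?nrm_ge0 // sumr_ge0 // => k _.
exact: correction_bound_ge0.
Qed.

End groups.

(** [n] of order 1/d makes 3 / (2 n) and 4 / n small. The corrections for words of length governed
    by [n] are bounded independently of [N], which is then chosen to divide them away. [P] exceeds
    the word lengths, so that the words have norm at most 2. *)
Lemma good_average (d : R) (Q : nat) : 0 < d ->
  exists P N, [/\ (Q <= P)%N, (0 < N)%N,
    forall m z, (P + 3 * N <= m)%N ->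
      nrm (group_average P N z) <= d * nrm z + 2 * nrm (T m z) &
    exists M : nat -> X -> X, forall x,
      (forall i, (i < N)%N -> nrm (M i x) <= 2 * nrm x /\
        nrm (T (P + 3 * i).+1 (M i x)) <= d * nrm x) /\
      nrm (x - group_average P N x - N%:R^-1 *: \sum_(i < N) M i x) <= d * nrm x].
Proof.
move=> d0; pose n := (Num.bound (4 / d)).+1.
have nR : 0 < (n%:R : R) by rewrite ltr0n.
have hn : 4 / d <= n%:R.
  apply: le_trans (ltW (archi_boundP _)) _; first by rewrite divr_ge0 // ltW.
  by rewrite ler_nat.
pose k1 := correction_bound 1 (- 2) n.
pose k2 := \sum_(k < n) correction_bound 0 1 k.+1.
have k10 : 0 <= k1 by apply: correction_bound_ge0.
have k20 : 0 <= k2 by apply: sumr_ge0 => k _; apply: correction_bound_ge0.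
pose N := (Num.bound ((4 * k1 + k2) / d)).+1.
have NR : 0 < (N%:R : R) by rewrite ltr0n.
have hN : (4 * k1 + k2) / d <= N%:R.
  apply: le_trans (ltW (archi_boundP _)) _.
    by rewrite divr_ge0 ?(ltW d0) // addr_ge0 // mulr_ge0.
  by rewrite ler_nat.
rewrite ler_pdivrMr // in hn; rewrite ler_pdivrMr // in hN.
exists (Q + 2 * n)%N, N; split=> //; first exact: leq_addr.
  move=> m z hm.
  have := average_small (P :=
    (Q + 2 * n)%N) z (isT : (0 < n)%N) (isT : (0 < N)%N) (leq_addl _ _) hm.
  move=> /le_trans; apply; rewrite lerD2r ler_wpM2r ?nrm_ge0 //.
  have h1 : 3 / (2 * n%:R) <= d / 2.
    rewrite ler_pdivrMr ?mulr_gt0 // mulrA divfK //; nra.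
  have h2 : correction_bound 1 (-2) n / (n%:R * N%:R) <= d / 2.
    rewrite -/k1 ler_pdivrMr ?mulr_gt0 //.
    have n1 : 1 <= (n%:R : R) by rewrite ler1n.
    have : d / 2 * N%:R <= d / 2 * (n%:R * N%:R).
      by rewrite ler_wpM2l ?divr_ge0 ?(ltW d0) // ler_peMl // ltW.
    lra.
  lra.
have nP : (n.+1 <= Q + 2 * n)%N.
  by rewrite mul2n -addnn addnA -addn1 leq_add // leq_addl.
have [M hM] := complement_average (isT : (0 < n)%N) (isT : (0 < N)%N) nP.
exists M => x; have [h1 h2] := hM x; split.
  move=> i iN; have [h3 h4] := h1 i iN; split=> //; apply: le_trans h4 _.
  by rewrite ler_wpM2r ?nrm_ge0 // ler_pdivrMr // mulrC.
apply: le_trans h2 _; rewrite ler_wpM2r ?nrm_ge0 // ler_pdivrMr //.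
rewrite -/k2; lra.
Qed.

End left_chain.

(** * Infinite products of the averages *)

Section geometric_limit.
Variables (R : realType) (F : scalar_field).
Local Notation K := (scalars R F).
Variable X : completeNormedModType K.

(** Completeness of [X] enters here. *)
Lemma geometric_limit (u : nat -> X) (c : R) : 0 <= c ->
  (forall k, nrm (u k.+1 - u k) <= c * 2^-1 ^+ k) ->
  exists l, forall k, nrm (l - u k) <= 2 * c * 2^-1 ^+ k.
Proof.
move=> c0 hu.
have h k m : nrm (u (k + m)%N - u k) <= 2 * c * 2^-1 ^+ k.
  have -> : u (k + m)%N - u k = \sum_(i < m) (u (k + i.+1)%N - u (k + i)%N).
    rewrite -(big_mkord xpredT (fun i => u (k + i.+1)%N - u (k + i)%N)).
    by rewrite (telescope_sumr (fun i => u (k + i)%N)) // addn0.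
  apply: le_trans (nrm_sum _ _ _) _.
  apply: le_trans (_ : \sum_(i < m) c * 2^-1 ^+ k * 2^-1 ^+ i <= _).
    by apply: ler_sum => i _; rewrite -mulrA -exprD addnS; apply: hu.
  rewrite -mulr_sumr; apply: le_trans (ler_wpM2l _ (half_pow_sum R m)) _.
    by rewrite mulr_ge0 // ltW // half_pow_gt0.
  by rewrite le_eqVlt; apply/orP; left; apply/eqP; ring.
have sm (e : R) : 0 < e -> exists N, forall n, (N <= n)%N -> nrm (u n - u N) <= e.
  move=> e0.
  have [N hN] := @half_pow_tends0 R (e / (2 * c +
    1)) ltac:(by rewrite divr_gt0 // ltr_pwDr // mulr_ge0).
  exists N => n Nn; rewrite -(subnKC Nn); apply: le_trans (h _ _) _.
  have c1 : 0 < 2 * c + 1 by rewrite ltr_pwDr // mulr_ge0.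
  have := hN N (leqnn _); rewrite ler_pdivlMr // => hh.
  have := half_pow_gt0 R N; nra.
have cu : cvg (u @ \oo).
  apply/cauchy_cvgP/cauchyP => e e0.
  have eE : e = of_real F (real_part e) by apply: of_real_ge0; apply: ltW.
  have re0 : 0 < real_part e by rewrite -(@ltr_of_real _ F) of_real0 -eE.
  have [N hN] := sm (real_part e / 2) ltac:(by rewrite divr_gt0).
  exists (u N); exists N => // n Nn /=.
  rewrite -ball_normE /= normE eE ltr_of_real nrm_subC.
  apply: le_lt_trans (hN n Nn) _; by rewrite ltr_pdivrMr // ltr_pMr // ltr1n.
exists (lim (u @ \oo)) => k; apply/ler_addgt0Pr => e e0.
have /cvgrPdist_le/(_ (of_real F e)) := cu.
rewrite -(of_real0 R F) ltr_of_real => /(_ e0)[N _ hN].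
have := hN (k + N)%N (leq_addl _ _); rewrite /= normE ler_of_real => h1.
rewrite -(subrK (u (k + N)%N) (lim _)) -addrA addrC.
by apply: le_trans (nrmD _ _) _; apply: lerD.
Qed.

End geometric_limit.

Section infinite_product.
Variables (R : realType) (F : scalar_field).
Local Notation K := (scalars R F).
Variables (S : set K) (X : completeNormedModType K).
Hypothesis gS : sign_group S.
Variable W : nat -> X -> X.
Hypothesis fW : forall l, finite_operator (W l).
Hypothesis nW : forall l, near_reflection S (2^-1 ^+ l.+2) (W l).
Hypothesis WI : strongly_to_id W.
Hypothesis stepW : forall l, opbound (4 * 2^-1 ^+ l) (fun x => W l (x - W l.+1 x)).

Let lW l : linear (W l). Proof. by have [[]] := fW l. Qed.

Let bW l : opbound (1 + 2^-1 ^+ l.+2) (W l).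
Proof.
apply: opboundW (near_reflection_bound gS (nW l)).
by rewrite lerD2l ler_pdivrMr // ler_pMr ?half_pow_gt0 // ler1n.
Qed.

Let bW2 l : opbound 2 (W l).
Proof.
apply: opboundW (bW l); have : (2^-1 : R) ^+ l.+2 <=
  1 by rewrite exprn_ile1 ?invr_ge0 ?invf_le1 ?ler1n.
lra.
Qed.

Fixpoint partial_product (n k : nat) (x : X) : X :=
  if k is k'.+1 then partial_product n k' (W (n + k') x) else x.

Let pr := partial_product.

Lemma linear_partial_product n k : linear (pr n k).
Proof. by elim: k => [|k ih] //=; apply: linear_comp. Qed.

Lemma partial_productS n k x : pr n k.+1 x = W n (pr n.+1 k x).
Proof.
rewrite /pr; elim: k x => [|k ih] x; first by rewrite /= addn0.
by transitivity (partial_product n k.+1 (W (n + k.+1) x)); rewrite // ih addnS.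
Qed.

Lemma partial_product_bound n k : opbound 2 (pr n k).
Proof.
apply: (@opboundW _ _ _ (growth R (n + k))); first exact: growth_le2.
elim: k => [|k ih] x /=; first by rewrite ler_peMl ?nrm_ge0 ?growth_ge1.
apply: le_trans (ih _) _.
apply: le_trans (ler_wpM2l _ (bW _ x)) _; first exact: le_trans ler01 (growth_ge1 _ _).
rewrite mulrA ler_wpM2r ?nrm_ge0 // mulrC addnS; exact: growthS.
Qed.

(** The difference is W (n + k) (Id - W (n + k).+1) followed by a product of norm at most 2. *)
Lemma partial_product_step n k x :
  nrm (pr n k.+2 x - pr n k.+1 x) <= 8 * 2^-1 ^+ n * nrm x * 2^-1 ^+ k.
Proof.
have lp := linear_partial_product n k.
rewrite nrm_subC.
have -> : pr n k.+1 x - pr n k.+2 x = pr n k (W (n + k) (x - W (n + k).+1 x)).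
  by rewrite (linB _ _ (lW _)) (linB _ _ lp) /pr /= addnS.
apply: le_trans (partial_product_bound n k _) _.
apply: le_trans (ler_wpM2l _ (stepW _ x)) _ => //.
by rewrite le_eqVlt; apply/orP; left; apply/eqP; rewrite exprD; ring.
Qed.

(** Finite rank comes from Q_n = W_n Q_(n+1). For absorption, Q_n is close to a partial product
    whose last factor is W_(m-1), and W_(m-1) (Id - Q_m) is close to W_(m-1) (Id - W_m), which is
    small by [stepW]. *)
Lemma infinite_product : exists Q : nat -> X -> X,
  [/\ forall n, finite_operator (Q n),
      forall n, opbound (16 * 2^-1 ^+ n) (fun x => Q n x - W n x),
      strongly_to_id Q & forall n, absorbed Q (Q n)].
Proof.
have /choice[Q' hQ'] : forall p : nat * X, exists l, forall k,
    nrm (l - pr p.1 k.+1 p.2) <= 2 * (8 * 2^-1 ^+ p.1 * nrm p.2) * 2^-1 ^+ k.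
  move=> [n x] /=; apply: (geometric_limit (u := fun k => pr n k.+1 x)).
    by rewrite !mulr_ge0 ?nrm_ge0 // ltW // half_pow_gt0.
  by move=> k; apply: partial_product_step.
pose Q n x := Q' (n, x).
have hQ n x k : nrm (Q n x - pr n k.+1 x) <= 16 * 2^-1 ^+ n * nrm x * 2^-1 ^+ k.
  have := hQ' (n, x) k; rewrite /= -/(Q n x) => /le_trans; apply.
  by rewrite le_eqVlt; apply/orP; left; apply/eqP; ring.
have eq0 (y : X) (c : R) : 0 <= c -> (forall k, nrm y <= c * 2^-1 ^+ k) -> y = 0.
  move=> c0 h; apply: nrm_eq0; apply/eqP; rewrite eq_le nrm_ge0 andbT.
  apply/ler_addgt0Pr => e e0; rewrite add0r.
  have [N hN] := @half_pow_tends0 R (e / (c +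
    1)) ltac:(by rewrite divr_gt0 // ltr_pwDr).
  apply: le_trans (h N) _; have c1 : 0 < c + 1 by rewrite ltr_pwDr.
  have := hN N (leqnn _); rewrite ler_pdivlMr // => hh.
  have := half_pow_gt0 R N; nra.
have lQ n : linear (Q n).
  move=> a x y; apply/eqP; rewrite -subr_eq0; apply/eqP.
  pose c := 16 * 2^-1 ^+ n * nrm (a *: x + y) +
    absr a * (16 * 2^-1 ^+ n * nrm x) + 16 * 2^-1 ^+ n * nrm y.
  have p0 z : 0 <= 16 * 2^-1 ^+ n * nrm (z : X).
    by rewrite !mulr_ge0 ?nrm_ge0 // ltW // half_pow_gt0.
  apply: (eq0 _ c); first by rewrite !addr_ge0 // mulr_ge0 ?absr_ge0.
  move=> k; have lp := linear_partial_product n k.+1.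
  have -> : Q n (a *: x + y) - (a *: Q n x + Q n y) =
     (Q n (a *: x + y) - pr n k.+1 (a *: x + y)) -
     (a *: (Q n x - pr n k.+1 x) + (Q n y - pr n k.+1 y)).
    rewrite lp scalerBr [a *: Q n x - _ + _]addrACA -opprD opprB.
    by rewrite addrA subrK.
  apply: le_trans (nrmB _ _) _; rewrite /c -addrA mulrDl; apply: lerD; first exact: hQ.
  apply: le_trans (nrmD _ _) _; rewrite mulrDl; apply: lerD; last exact: hQ.
  by rewrite nrmZ -mulrA ler_wpM2l ?absr_ge0.
have QW n : opbound (16 * 2^-1 ^+ n) (fun x => Q n x - W n x).
  by move=> x; have := hQ n x 0%N; rewrite mulr1 /pr /= addn0.
have bQ n : opbound 18 (Q n).
  move=> x; have -> : Q n x = W n x + (Q n x - W n x) by rewrite addrC subrK.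
  apply: le_trans (nrmD _ _) _; have h1 := bW2 n x.
  have h2 : nrm (Q n x - W n x) <= 16 * nrm x.
    apply: le_trans (QW n x) _; rewrite ler_wpM2r ?nrm_ge0 //.
    by rewrite ler_piMr // exprn_ile1 ?invr_ge0 ?invf_le1 ?ler1n.
  lra.
have QS n x : Q n x = W n (Q n.+1 x).
  apply/eqP; rewrite -subr_eq0; apply/eqP.
  have p0 m : 0 <= 16 * 2^-1 ^+ m * nrm x.
    by rewrite !mulr_ge0 ?nrm_ge0 // ltW // half_pow_gt0.
  apply: (eq0 _ (16 * 2^-1 ^+ n * nrm x + 2 * (16 * 2^-1 ^+ n.+1 * nrm x))).
    by rewrite addr_ge0 // mulr_ge0.
  move=> k.
  have -> : Q n x - W n (Q n.+1 x) =
    (Q n x - pr n k.+2 x) - W n (Q n.+1 x - pr n.+1 k.+1 x).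
    by rewrite (linB _ _ (lW _)) partial_productS opprB addrA subrK.
  apply: le_trans (nrmB _ _) _; rewrite mulrDl; apply: lerD.
    apply: le_trans (hQ n x k.+1) _; rewrite ler_wpM2l // exprS.
    by rewrite ler_piMl ?invf_le1 ?ler1n // ltW // half_pow_gt0.
  by apply: le_trans (bW2 _ _) _; rewrite -[leRHS]mulrA ler_wpM2l.
have fQ n : finite_operator (Q n).
  split; first by split=> //; exists 18; exact: bQ.
  have -> : Q n = (fun x => W n (Q n.+1 x)) by apply/funext => x; apply: QS.
  by apply: finite_rank_compr; case: (fW n).
exists Q; split=> //.
- move=> x; have h := tends0D (tends0Z (16 * nrm x) (@half_pow_tends0 R) (fun j
  => ltW (half_pow_gt0 R j))) (WI x).
  apply: tends0_le h => n; rewrite -(subrK (W n x) (Q n x)) -addrA.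
  apply: le_trans (nrmD _ _) _; rewrite lerD2r.
  by rewrite mulrAC; apply: QW.
- move=> n e e0.
  (* 376 = 304 + 72, where 304 = 16 * 19 comes from replacing [Q n] by a partial product at [v], and
     72 = 2 (4 + 2 * 16) from [stepW] and the distance from [Q m] to [W m]. *)
  have [N hN] := @half_pow_tends0 R (e / 376) ltac:(by rewrite divr_gt0).
  exists (n + N).+1 => m hm x; pose k := (m - n.+1)%N.
  have mE : m = (n + k).+1 by rewrite -addSn subnKC // (leq_trans _ hm) // ltnS
    leq_addr.
  have Nk : (N <= k)%N by move: hm; rewrite mE ltnS leq_add2l.
  have half1 i : (2^-1 : R) ^+ i <= 1 by rewrite exprn_ile1 ?invr_ge0 ?invf_le1 ?ler1n.
  have kp : (2^-1 : R) ^+ (n + k) <= 2^-1 ^+ k.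
    by rewrite exprD ler_piMl // ltW // half_pow_gt0.
  have mp : (2^-1 : R) ^+ m <= 2^-1 ^+ k.
    apply: le_trans kp; rewrite mE exprS ler_piMl ?(ltW (half_pow_gt0 R _)) //.
    by rewrite invf_le1 ?ler1n.
  have x0 := nrm_ge0 x; pose v := x - Q m x.
  have vb : nrm v <= 19 * nrm x by have := nrmB x (Q m x); have := bQ m x;
    rewrite /v; lra.
  have e1 : nrm (Q n v - pr n k.+1 v) <= 304 * 2^-1 ^+ k * nrm x.
    apply: le_trans (hQ n v k) _.
    apply: le_trans (_ : 16 * 1 * (19 * nrm x) * 2^-1 ^+ k <= _).
      apply: ler_wpM2r; first exact/ltW/half_pow_gt0.
      apply: ler_pM; [|exact: nrm_ge0| |exact: vb]; last by rewrite ler_wpM2l.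
      by rewrite mulr_ge0 // ltW // half_pow_gt0.
    by rewrite le_eqVlt; apply/orP; left; apply/eqP; ring.
  have e2 : nrm (pr n k.+1 v) <= 72 * 2^-1 ^+ k * nrm x.
    apply: le_trans (partial_product_bound n k _) _.
    have -> : W (n + k) v = W (n + k) (x - W (n + k).+1 x) - W (n + k) (Q m x - W m x).
      rewrite -(linB _ _ (lW _)) /v mE; congr (W _ _).
      by rewrite opprB addrA subrK.
    have h1 := stepW (n + k) x; rewrite /= in h1.
    have h2 : nrm (W (n + k) (Q m x - W m x)) <= 2 * (16 * 2^-1 ^+ m * nrm x).
      by apply: le_trans (bW2 (n + k) _) _; rewrite ler_wpM2l //; apply: QW.
    have h3 := nrmB (W (n + k) (x - W (n + k).+1 x)) (W (n + k) (Q m x - W m x)).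
    have h4 : 4 * 2^-1 ^+ (n + k) * nrm x <= 4 * 2^-1 ^+ k * nrm x.
      by rewrite ler_wpM2r // ler_wpM2l.
    have h5 : 2 * (16 * 2^-1 ^+ m * nrm x) <= 2 * (16 * 2^-1 ^+ k * nrm x).
      by rewrite ler_wpM2l // ler_wpM2r // ler_wpM2l.
    lra.
  have -> : Q n (x - Q m x) = (Q n v - pr n k.+1 v) + pr n k.+1 v by rewrite subrK.
  apply: le_trans (nrmD _ _) _.
  have h6 : 2^-1 ^+ k * nrm x <= e / 376 * nrm x by rewrite ler_wpM2r // hN.
  lra.
Qed.

End infinite_product.

(** * Averages with summable one-sided defects *)

Section average_sequence.
Variables (R : realType) (F : scalar_field).
Local Notation K := (scalars R F).
Variables (S : set K) (X : normedModType K).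
Hypothesis gS : sign_group S.
Variable T : nat -> X -> X.
Hypotheses (fT : forall j, finite_operator (T j)) (T0 : forall x, T 0%N x = 0).
Hypotheses (chT : left_chain T) (TI : strongly_to_id T).
Hypothesis nT : forall j, near_reflection S (2^-1 ^+ j.+2) (T j).

(** Up to a small error Id - W_(l+1) is a mean of the [M i] of [good_average]. Their values are
    almost killed by some T_m with m beyond the triples of W_l, so the first estimate of
    [good_average] makes W_l small on them. In units of 2^-l the constant is 4 = 2 + 1 + 1, from the
    norm of M i x, from T_m, and from the error. *)
Lemma average_sequence : exists W : nat -> X -> X,
  [/\ forall l, finite_operator (W l),
      forall l, near_reflection S (2^-1 ^+ l.+2) (W l), strongly_to_id W &
      forall l, opbound (4 * 2^-1 ^+ l) (fun x => W l (x - W l.+1 x))].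
Proof.
have lT j : linear (T j) by have [[]] := fT j.
have /choice[PN hPN] : forall lQ : nat * nat, exists PN : nat * nat,
    [/\ (lQ.2 <= PN.1)%N, (0 < PN.2)%N,
    forall m z, (PN.1 + 3 * PN.2 <= m)%N ->
      nrm (group_average T PN.1 PN.2 z) <= 2^-1 ^+ lQ.1 * nrm z + 2 * nrm (T m z) &
    exists M : nat -> X -> X, forall x,
      (forall i, (i < PN.2)%N -> nrm (M i x) <= 2 * nrm x /\
        nrm (T (PN.1 + 3 * i).+1 (M i x)) <= 2^-1 ^+ lQ.1 * nrm x) /\
      nrm (x - group_average T PN.1 PN.2 x - PN.2%:R^-1 *: \sum_(i < PN.2) M i x)
        <= 2^-1 ^+ lQ.1 * nrm x].
  move=> [l Q] /=.
  have [P [N h]] := good_average gS lT T0 chT nT Q (half_pow_gt0 R l).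
  by exists (P, N).
pose s := fix s l : nat * nat := if l is l'.+1 then
  PN (l'.+1, (s l').1 + 3 * (s l').2 + 1)%N else PN (0, 0)%N.
pose P l := (s l).1; pose N l := (s l).2.
have PS l : (P l + 3 * N l < P l.+1)%N.
  by have [h _ _ _] := hPN (l.+1, (s l).1 + 3 * (s l).2 + 1)%N; rewrite /P /N -addn1.
have hs l : exists q, s l = PN (l, q).
  by case: l => [|l]; [exists 0%N | exists ((s l).1 + 3 * (s l).2 + 1)%N].
have N0 l : (0 < N l)%N.
  by rewrite /N; have [q ->] := hs l; have [] := hPN (l, q).
have Pge l : (l <= P l)%N.
  elim: l => // l ih; apply: leq_ltn_trans (PS l).
  exact: leq_trans ih (leq_addr _ _).
pose W l := group_average T (P l) (N l).
have NR l : (N l)%:R != 0 :> K by rewrite pnatr_eq0 -lt0n.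
have fW l : finite_operator (W l).
  by apply: finite_operatorZ; apply: finite_operator_sum.
have lW l : linear (W l) by have [[]] := fW l.
have ave l (v : X) : (N l)%:R^-1 *: \sum_(i < N l) v = v.
  by rewrite sumr_const card_ord -[v *+ _]scaler_nat scalerA mulVf ?scale1r.
have norm_ave l (f : nat -> X) (B : R) : (forall i, (i < N l)%N -> nrm (f i) <= B) ->
    nrm ((N l)%:R^-1 *: \sum_(i < N l) f i) <= B.
  move=> h; rewrite nrmZ absrV absr_nat ler_pdivrMl ?ltr0n //.
  apply: le_trans (nrm_sum _ _ _) _.
  rewrite mulr_natl -[N l in leRHS]card_ord -sumr_const; apply: ler_sum => i _.
  exact: h.
have G1 l m z : (P l + 3 * N l <= m)%N ->
  nrm (W l z) <= 2^-1 ^+ l * nrm z + 2 * nrm (T m z).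
  by rewrite /W /P /N; have [q ->] := hs l; have [_ _ h _] := hPN (l, q); apply: h.
have G2 l : exists M : nat -> X -> X, forall x,
      (forall i, (i < N l)%N -> nrm (M i x) <= 2 * nrm x /\
        nrm (T (P l + 3 * i).+1 (M i x)) <= 2^-1 ^+ l * nrm x) /\
      nrm (x - W l x - (N l)%:R^-1 *: \sum_(i < N l) M i x) <= 2^-1 ^+ l * nrm x.
  by rewrite /W /P /N; have [q ->] := hs l; have [_ _ _ h] := hPN (l, q); apply: h.
have nW l : near_reflection S (2^-1 ^+ l.+2) (W l).
  apply: (near_reflection_average (f := fun i => T (P l + 3 * i)%N)) => // i _.
  apply: near_reflectionW (nT _).
  have le : (l <= P l + 3 * i)%N by apply: leq_trans (Pge l) (leq_addr _ _).
  by apply: ler_wiXn2l; rewrite ?invr_ge0 ?invf_le1 ?ler1n // !ltnS.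
exists W; split=> //.
- move=> x e e0; have [M hM] := TI x e0; exists M => l Ml.
  rewrite -{2}(ave l x) /W /group_average -scalerBr -sumrB.
  apply: (norm_ave l (fun i => T (P l + 3 * i)%N x - x)) => i _; apply: hM.
  by apply: leq_trans Ml _; apply: leq_trans (Pge l) (leq_addr _ _).
- move=> l x; have [M hM] := G2 l.+1; have [h1 h2] := hM x.
  set r := x - W l.+1 x - _ in h2.
  have -> : x - W l.+1 x = (N l.+1)%:R^-1 *: \sum_(i < N l.+1) M i x + r.
    by rewrite /r [RHS]addrC subrK.
  rewrite (linD _ _ (lW l)) (linZ _ _ (lW l)) (lin_sum _ _ _ (lW l)).
  have x0 := nrm_ge0 x.
  have hS : (2^-1 : R) ^+ l.+1 * nrm x =
    2^-1 * (2^-1 ^+ l * nrm x) by rewrite exprS mulrA.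
  have e1 : nrm ((N l.+1)%:R^-1 *: \sum_(i < N l.+1) W l (M i x)) <=
    3 * (2^-1 ^+ l * nrm x).
    apply: (norm_ave l.+1 (fun i => W l (M i x))) => i iN; have [h3 h4] := h1 i iN.
    have Pm : (P l + 3 * N l <= (P l.+1 + 3 * i).+1)%N.
      by apply: leq_trans (ltnW (PS l)) _; rewrite -addnS leq_addr.
    apply: le_trans (G1 l _ (M i x) Pm) _.
    have h5 : 2^-1 ^+ l * nrm (M i x) <= 2^-1 ^+ l * (2 * nrm x).
      by rewrite ler_wpM2l // ltW // half_pow_gt0.
    rewrite hS in h4; lra.
  have e2 : nrm (W l r) <= 2^-1 ^+ l * nrm x.
    apply: le_trans (near_reflection_bound gS (nW l) r) _.
    have : (2^-1 : R) ^+ l.+2 <= 1 by rewrite exprn_ile1 ?invr_ge0 ?invf_le1 ?ler1n.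
    move=> h3; apply: le_trans (_ : 2 * nrm r <= _).
      by rewrite ler_wpM2r ?nrm_ge0 //; lra.
    rewrite hS in h2; lra.
  apply: le_trans (nrmD _ _) _; lra.
Qed.

End average_sequence.

(** * From umap to (u(T_k)) *)

Section umap_u_sequence.
Variables (R : realType) (F : scalar_field).
Local Notation K := (scalars R F).
Variables (S : set K) (X : completeNormedModType K).
Hypothesis gS : sign_group S.

Theorem umap_u_sequence : umap S X -> admits_u_sequence S X.
Proof.
have [S1 Sm1 Sa SM SV] := gS; move=> uX.
have half_le1 i : (2^-1 : R) ^+ i <= 1 by rewrite exprn_ile1 ?invr_ge0 ?invf_le1 ?ler1n.
have [T [T0 fT chT nT TI]] := umap_left_chain gS (h := fun j => 2^-1 ^+ j.+2)
  (fun j => introT andP (conj (half_pow_gt0 R _) (half_le1 _))) uX.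
have [W [fW nW WI stepW]] := average_sequence gS fT T0 chT TI nT.
have [Q' [fQ' QW QI' aQ']] := infinite_product gS fW nW WI stepW.
(* Passing from [W] to [Q] costs 2 * 16 * 2^-N in the near reflection constant at index N; the shift
   by 10 and the tolerance 2^-(j+4) of the perturbation keep the constant of [U j] at 2^-(j+2). *)
pose Q j := Q' (j + 10)%N.
have fQ j : finite_operator (Q j) by apply: fQ'.
have QI : strongly_to_id Q by move=> x; apply: tends0_sub (QI' x) => n; apply: leq_addr.
have aQ j : absorbed Q (Q j).
  move=> e e0; have [N hN] := aQ' (j + 10)%N e e0; exists N => m Nm.
  by apply: hN; apply: leq_trans Nm (leq_addr _ _).
have th0 j : 0 < (2^-1 : R) ^+ j.+4 by apply: half_pow_gt0.
have [n [U [[n0 nS] fU U0 chU UQ]]] := perturbed_chain fQ QI aQ th0.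
have n_ge j : (j <= n j)%N by elim: j => // j ih; apply: leq_ltn_trans ih (nS j).
have lU j : linear (U j) by have [[]] := fU j.
have nU j : near_reflection S (2^-1 ^+ j.+2) (U j).
  case: j => [|j].
    move=> e Se x; rewrite U0 scaler0 add0r subr0 ler_peMl ?nrm_ge0 //.
    by rewrite lerDl ltW // half_pow_gt0.
  have := near_reflection_perturb gS (near_reflection_perturb gS (nW _) (QW (n
    j.+1 + 10)%N)) (UQ j.+1 isT).
  apply: near_reflectionW.
  have : (2^-1 : R) ^+ (n j.+1) <= 2^-1 ^+ j.+1.
    rewrite -(subnKC (n_ge j.+1)) exprD.
    by apply: ler_piMr; [exact/ltW/half_pow_gt0 | exact: half_le1].
  move=> h; have p0 := half_pow_gt0 R j.
  rewrite !exprS !exprD !exprS expr0 !mulr1 in h *.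
  lra.
have UI : strongly_to_id U.
  move=> x e e0.
  have h := tends0D (tends0Z (nrm x) (@half_pow_tends0 R) (fun j => ltW
    (half_pow_gt0 R j)))
    (tends0_sub n_ge (QI x)).
  have [N hN] := h e e0; exists N.+1 => -[//|j] Nj.
  apply: le_trans (hN j.+1 (ltnW Nj));
    rewrite -(subrK (Q (n j.+1) x) (U j.+1 x)) -addrA.
  apply: le_trans (nrmD _ _) _; rewrite lerD2r; apply: le_trans (UQ j.+1 isT x) _.
  rewrite mulrC ler_wpM2l ?nrm_ge0 //.
  by rewrite -[j.+1.+4]addn4 exprD ler_piMr // ltW // half_pow_gt0.
have lchU : left_chain U by move=> i j x ij; have [] := chU i j x ij.
have U2 j : opbound 2 (U j).
  apply: opboundW (near_reflection_bound gS (nU j)).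
  by have := half_le1 j.+2; lra.
(* 5 = 2 + 3, from [left_chain_signs] and from x - U m x. *)
have unU : unconditional_bound S 5 U.
  move=> m e Se x; have h1 := left_chain_signs gS lU U0 lchU nU m x Se.
  have -> : signed_sum U e m x =
    (signed_sum U e m x + (x - U m x)) - (x - U m x) by rewrite addrK.
  apply: le_trans (nrmB _ _) _; have := nrmB x (U m x); have := U2 m x.
  have : growth R m * nrm x <= 2 * nrm x by rewrite ler_wpM2r ?nrm_ge0 ?growth_le2.
  lra.
have [V VE] := linear_seq lU.
have VE1 i : (V i : X -> X) = U i by apply/funext => x; rewrite VE.
have VE' : (fun i => V i : X -> X) = U by apply/funext => i.
have bV k : bounded_linear (V k) by rewrite VE1; case: (fU k).
exists V; split.
- apply/approximating_sequenceP; split; [by move=> x; rewrite VE|by move=> k;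
  rewrite VE1|].
  by rewrite VE'.
- move=> j k x; rewrite !VE; have [jk|kj|->//] := ltngtP j k.
    by have [-> ->] := chU j k x jk.
  by have [-> ->] := chU k j x kj.
- by exists 5; apply/(unconditional_withP _ gS bV); rewrite VE'.
- move=> eps m eps0 m1.
  have [p0 hp0] := @half_pow_tends0 R (eps / 5) ltac:(by rewrite divr_gt0).
  (* [U p] fixes the range of [U m] and kills that of Id - U p.+1, so the near reflection at [p]
     with sign e / f maps f x + y to e x + y. As nrm (f x + y) <= 2 + 3 = 5, the norm grows by at
     most 5 * 2^-(p+2). *)
  pose p := maxn m.+1 p0.
  have mp : (m < p)%N by apply: leq_maxl.
  exists p.+1; first by rewrite ltnW // ltnW.
  move=> _ _ [u u1 <-] [z z1 <-]; apply/(oscP gS); rewrite !VE => e f Se Sf.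
  set x := U m u; set y := z - U p.+1 z.
  have Ux : U p x = x by rewrite /x lchU.
  have Uy : U p y = 0.
    by rewrite /y (linB _ _ (lU p)) (chU p p.+1 z (ltnSn p)).2 subrr.
  have f0 : f != 0.
    by apply/eqP => f0; have := Sa f Sf; rewrite f0 absr0 => /eqP;
      rewrite eq_sym oner_eq0.
  have h := nU p _ (SM _ _ Se (SV _ Sf)) (f *: x + y).
  rewrite (linD _ _ (lU p)) (linZ _ _ (lU p)) Ux Uy addr0 scalerA divfK // in h.
  rewrite [f *: x + y - _]addrC addKr in h.
  apply: le_trans h _; rewrite mulrDl mul1r lerD2l.
  have xb : nrm (f *: x + y) <= 5.
    apply: le_trans (nrmD _ _) _; rewrite nrmZ Sa // mul1r.
    have := U2 m u; have := nrmB z (U p.+1 z); have := U2 p.+1 z.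
    by move: u1 z1; rewrite /unit_ball /= -/x -/y => u1 z1; lra.
  have hp : (2^-1 : R) ^+ p.+2 <= eps / 5.
    by apply: hp0; apply: leq_trans (leq_maxr m.+1 p0) _; do 2 apply: ltnW.
  apply: le_trans (_ : eps / 5 * 5 <= _); last by rewrite divfK.
  by apply: ler_pM; [exact/ltW/half_pow_gt0 | exact: nrm_ge0 | exact: hp | exact: xb].
Qed.

End umap_u_sequence.

Local Close Scope ring_scope.
Local Close Scope classical_set_scope.

Theorem theorem5p3p1 (R : realType) (F : scalar_field) (S : set (scalars R F))
    (hS : S = real_signs (scalars R F) \/
          F = ComplexScalars /\ S = unit_circle (scalars R F))
    (X : completeNormedModType (scalars R F)) (hX : separable X) :
  (umap S X -> admits_u_topology S X) /\
  (admits_u_topology S X <-> admits_u_sequence S X) /\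
  (admits_u_sequence S X -> unconditional_skipped_blocking S X) /\
  (finite_cotype X -> unconditional_skipped_blocking S X -> umap S X).
Proof.
have gS := sign_groupP hS.
split; last split; last split.
- by move=> /(umap_u_sequence gS); apply: u_sequence_u_topology.
- by split; [exact: u_topology_u_sequence | exact: u_sequence_u_topology].
- exact: u_sequence_skipped_blocking.
- exact: skipped_blocking_umap.
Qed.
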